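(* Let $V$ be a DVR with quotient field $K$ and perfect residue field. The extensions of $V$ to $K(X)$ which are DVRs and residually algebraic over $V$ are exactly the valuation domains $V_{\alpha}$, where $\alpha$ runs over the elements of $\mathbb{K}$ transcendental over $K$ for which there is a sequence $\{s_n\}_{n\in\mathbb{N}}\subset\overline{\widehat K}$ with $v(\alpha-s_n)\to\infty$ and $\{e_{s_n}\}_{n\in\mathbb{N}}$ bounded; and, for such an $\alpha$, $\alpha\in\overline{\widehat K}$ precisely when the residue field extension of $V_\alpha$ over $V$ is finite.
   Context: A DVR is a discrete valuation domain of rank one (value group isomorphic to $\mathbb{Z}$). $V$ is a DVR with quotient field $K$, associated valuation $v$ and value group $\Gamma_v$; $X$ is an indeterminate over $K$. An extension of $V$ to $K(X)$ is a valuation domain $W$ of $K(X)$ with $W\cap K=V$; it is residually algebraic over $V$ if its residue field is algebraic over the residue field of $V$. $\widehat K$ is the $v$-adic completion of $K$, $\overline{\widehat K}$ an algebraic closure of $\widehat K$, and $v$ also denotes its unique extension to $\overline{\widehat K}$; $\mathbb{K}$ is the completion of $\overline{\widehat K}$ with respect to $v$, with the extended valuation again denoted $v$ (and $v(0)=\infty$). For $\alpha\in\mathbb{K}$ transcendental over $K$, put $V_\alpha=\{\phi\in K(X)\mid v(\phi(\alpha))\ge 0\}$, a valuation domain of $K(X)$. For $s\in\overline{\widehat K}$, $e_s=e(\widehat K(s)\mid\widehat K)$ is the ramification index, i.e. the index of $v(\widehat K^\times)=\Gamma_v$ in $v(\widehat K(s)^\times)$. *)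

(* Defs.v *)
From HB Require Import structures.
From mathcomp Require Import all_boot all_order all_algebra separable.
From mathcomp Require Import finmap.
From mathcomp Require Import boolp classical_sets cardinality constructive_ereal.

Set Implicit Arguments.
Unset Strict Implicit.
Unset Printing Implicit Defensive.

Import Order.TTheory GRing.Theory Num.Theory.
Local Open Scope ring_scope.

(* A valuation of rank at most one whose value group is contained in Q, the divisible
   hull of Z; the value +oo is taken exactly at 0. *)
Record valuation (F : fieldType) := Valuation {
  val_fun :> F -> \bar rat;
  val_eqy : forall x, (val_fun x == +oo%E) = (x == 0);
  val_neqNy : forall x, val_fun x != -oo%E;
  valM : forall x y, val_fun (x * y) = (val_fun x + val_fun y)%E;
  valD : forall x y, (Order.min (val_fun x) (val_fun y) <= val_fun (x + y)%R)%E
}.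

Definition discrete_valuation (F : fieldType) (v : valuation F) : Prop :=
  forall q : rat, (exists2 x, x != 0 & v x = q%:E) <-> q \is a Num.int.

(* A valuation domain with quotient field F; the membership predicate is
   boolean, which is no restriction in classical logic. *)
Record valuation_ring (F : fieldType) := ValuationRing {
  vring_pred :> {pred F};
  vring_subring : subring_closed vring_pred;
  vring_total : forall x, (x \in vring_pred) || (x^-1 \in vring_pred)
}.

Section Val.
Variables (F : fieldType) (v : valuation F).

Lemma val0 : v 0 = +oo%E. Proof. by apply/eqP; rewrite val_eqy. Qed.

Lemma val_fin x : x != 0 -> exists q : rat, v x = q%:E.
Proof.
rewrite -(val_eqy v); have := val_neqNy v x.
by case: (v x) => // r _ _; exists r.
Qed.

Lemma val1 : v 1 = 0%E.
Proof.
have [q Eq] := val_fin (oner_neq0 F).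
have := valM v 1 1; rewrite mulr1 Eq -EFinD => -[] /eqP.
by rewrite -subr_eq0 opprD addrA subrr sub0r oppr_eq0 => /eqP ->.
Qed.

Lemma valN1 : v (-1) = 0%E.
Proof.
have N1 : (-1 : F) != 0 by rewrite oppr_eq0 oner_neq0.
have [q Eq] := val_fin N1.
have := valM v (-1) (-1); rewrite mulrNN mulr1 val1 Eq -EFinD => -[] /eqP.
by rewrite eq_sym -mulr2n mulrn_eq0 /= => /eqP ->.
Qed.

Lemma valN x : v (- x) = v x.
Proof. by rewrite -mulN1r valM valN1 add0e. Qed.

Definition val_pred : {pred F} := fun x => (0 <= v x)%E.

Lemma val_pred_subring : subring_closed val_pred.
Proof.
split=> [|x y|x y]; rewrite /val_pred /in_mem /=; first by rewrite val1.
- by move=> vx vy; apply: le_trans (valD v x (- y)); rewrite le_min valN vx vy.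
- by move=> vx vy; rewrite valM adde_ge0.
Qed.

Lemma val_pred_total x : (x \in val_pred) || (x^-1 \in val_pred).
Proof.
rewrite /val_pred /in_mem /=.
have [->|x0] := eqVneq x 0; first by rewrite val0.
have [q Eq] := val_fin x0.
have [r Er] : exists r : rat, v x^-1 = r%:E by apply: val_fin; rewrite invr_eq0.
have := valM v x x^-1; rewrite mulfV // val1 Eq Er -EFinD !lee_fin => -[] qr.
case: (lerP 0 q) => //= q0.
by rewrite -(addKr q r) -qr addr0 oppr_ge0 ltW.
Qed.

Definition valuation_ring_of : valuation_ring F :=
  ValuationRing val_pred_subring val_pred_total.

End Val.

(* v is the valuation, normalized to have value group Z, associated with the
   DVR W. *)
Definition dvr_valuation (F : fieldType) (W : valuation_ring F)
    (v : valuation F) : Prop :=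
  discrete_valuation v /\ W =i valuation_ring_of v.

Definition is_dvr (F : fieldType) (W : valuation_ring F) : Prop :=
  exists v : valuation F, dvr_valuation W v.

HB.instance Definition _ (F : fieldType) (W : valuation_ring F) :=
  GRing.isSubringClosed.Build F (vring_pred W) (vring_subring W).

Section Residue.
Variables (F : fieldType) (W : valuation_ring F).

Record vring_elt := VringElt { vring_val : F; _ : vring_val \in vring_pred W }.

HB.instance Definition _ := [isSub for vring_val].
HB.instance Definition _ := [Choice of vring_elt by <:].
HB.instance Definition _ := [SubChoice_isSubComNzRing of vring_elt by <:].

(* The non-units of W; recall that 0^-1 = 0. *)
Definition maximal_ideal : {pred vring_elt} :=
  fun x => (val x == 0) || ((val x)^-1 \notin W).

Lemma maximal_idealE x :
  (x \in maximal_ideal) = (val x == 0) || ((val x)^-1 \notin W).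
Proof. by []. Qed.

Lemma vring_inv_unit (x y : F) :
  x \in W -> y \in W -> x * y != 0 -> (x * y)^-1 \in W -> x^-1 \in W.
Proof.
move=> Wx Wy xy0 Wxy; have [x0 y0] : x != 0 /\ y != 0.
  by move: xy0; rewrite mulf_eq0 negb_or => /andP.
have -> : x^-1 = y * (x * y)^-1.
  by rewrite invfM mulrCA mulfV // mulr1.
by have [_ _] := vring_subring W; apply.
Qed.

Lemma maximal_idealM (a x : vring_elt) :
  x \in maximal_ideal -> a * x \in maximal_ideal.
Proof.
rewrite !maximal_idealE (rmorphM val).
have [//|ax0 /=] := eqVneq (val a * val x) 0.
move=> xM; apply/negP => Wax; move: xM.
have x0 : val x != 0 by move: ax0; rewrite mulf_eq0 negb_or => /andP[].
rewrite (negPf x0) /= => /negP; apply.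
apply: (@vring_inv_unit (val x) (val a)).
- exact: (valP x).
- exact: (valP a).
- by rewrite mulrC.
- by rewrite mulrC.
Qed.

Lemma maximal_idealD (x y : vring_elt) :
  x \in maximal_ideal -> y \in maximal_ideal -> x + y \in maximal_ideal.
Proof.
suff main (a b : vring_elt) : val b != 0 -> val a / val b \in W ->
    b \in maximal_ideal -> a + b \in maximal_ideal.
  move=> Mx My.
  have [y0|y0] := eqVneq (val y) 0.
    by have -> : y = 0 by [apply: val_inj; rewrite y0 (rmorph0 val)]; rewrite addr0.
  have [x0|x0] := eqVneq (val x) 0.
    by have -> : x = 0 by [apply: val_inj; rewrite x0 (rmorph0 val)]; rewrite add0r.
  have /orP[xy|yx] := vring_total W (val x / val y); first exact: main.
  by rewrite addrC; apply: main => //; rewrite invfM invrK mulrC in yx.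
move=> b0 Wab Mb.
have Wc : val a / val b + 1 \in vring_pred W by rewrite rpredD ?rpred1.
have -> : a + b = VringElt Wc * b; last exact: maximal_idealM.
apply: val_inj; rewrite (rmorphM val) (rmorphD val) /=.
by rewrite mulrDl mul1r divfK.
Qed.

Lemma maximal_ideal_closed : idealr_closed maximal_ideal.
Proof.
split=> [||a x y Mx My].
- by rewrite maximal_idealE (rmorph0 val) eqxx.
- by rewrite maximal_idealE (rmorph1 val) oner_eq0 invr1 /= negbK rpred1.
- by apply: maximal_idealD => //; apply: maximal_idealM.
Qed.

HB.instance Definition _ :=
  isIdealr.Build vring_elt maximal_ideal maximal_ideal_closed.

Definition residue_field := {ideal_quot maximal_ideal}.

HB.instance Definition _ := GRing.ComNzRing.on residue_field.

Definition vring_of (x : F) : vring_elt := insubd 0 x.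

Lemma vring_ofK x : x \in W -> vring_val (vring_of x) = x.
Proof. by move=> Wx; rewrite -[LHS]/(val _) val_insubd Wx. Qed.

(* The residue class of an element of W (elements outside W are sent to 0). *)
Definition residue (x : F) : residue_field :=
  \pi_({ideal_quot maximal_ideal})%qT (vring_of x).

Definition residue_lift (a : residue_field) : F := val (repr a).

Definition residue_inv (a : residue_field) : residue_field :=
  residue (residue_lift a)^-1.

Lemma residue_liftK : cancel residue_lift residue.
Proof.
move=> a; rewrite /residue /vring_of /residue_lift valKd; exact: reprK.
Qed.

Lemma residue_lift_in a : residue_lift a \in W.
Proof. exact: (valP (repr a)). Qed.

Lemma residueM x y : x \in W -> y \in W -> residue (x * y) = residue x * residue y.
Proof.
move=> Wx Wy; rewrite /residue -(rmorphM (\pi_({ideal_quot maximal_ideal})%qT)).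
congr (\pi_({ideal_quot maximal_ideal})%qT _); apply: val_inj.
by rewrite (rmorphM val) /= !vring_ofK // rpredM.
Qed.

Lemma residueD x y : x \in W -> y \in W -> residue (x + y) = residue x + residue y.
Proof.
move=> Wx Wy; rewrite /residue -(rmorphD (\pi_({ideal_quot maximal_ideal})%qT)).
congr (\pi_({ideal_quot maximal_ideal})%qT _); apply: val_inj.
by rewrite (rmorphD val) /= !vring_ofK // rpredD.
Qed.

Lemma residue1 : residue 1 = 1.
Proof.
rewrite /residue -(rmorph1 (\pi_({ideal_quot maximal_ideal})%qT)).
congr (\pi_({ideal_quot maximal_ideal})%qT _); apply: val_inj.
by rewrite (rmorph1 val) /= vring_ofK // rpred1.
Qed.

Lemma residue_eq0 x : x \in W -> (residue x == 0) = (x == 0) || (x^-1 \notin W).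
Proof.
move=> Wx; rewrite /residue -(rmorph0 (\pi_({ideal_quot maximal_ideal})%qT)).
rewrite -Quotient.idealrBE subr0.
by rewrite maximal_idealE /= vring_ofK.
Qed.

Lemma residue_mulV a : a != 0 -> residue_inv a * a = 1.
Proof.
rewrite -{1}[a]residue_liftK residue_eq0 ?residue_lift_in // negb_or negbK.
case/andP=> a0 Wa; rewrite -{2}[a]residue_liftK /residue_inv -residueM //.
  by rewrite mulVf // residue1.
exact: residue_lift_in.
Qed.

Lemma residue_inv0 : residue_inv 0 = 0.
Proof.
apply/eqP; rewrite /residue_inv.
have : residue (residue_lift 0) == 0 by rewrite residue_liftK.
rewrite residue_eq0 ?residue_lift_in // => /orP[/eqP->|nW].
  by rewrite invr0 residue_eq0 ?eqxx // (rpred0 (vring_pred W)).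
rewrite /residue /vring_of /insubd insubF; last exact: negPf.
by rewrite /= (rmorph0 (\pi_({ideal_quot maximal_ideal})%qT)).
Qed.

HB.instance Definition _ :=
  GRing.ComNzRing_isField.Build residue_field residue_mulV residue_inv0.

End Residue.

Definition perfect_field (k : fieldType) : Prop :=
  forall p : {poly k}, irreducible_poly p -> separable_poly p.

Section Extension.
Variables (F L : fieldType) (f : {rmorphism F -> L}).

(* W lies over V, i.e. W \cap F = V. *)
Definition extends_ring (V : valuation_ring F) (W : valuation_ring L) : Prop :=
  forall x, (f x \in W) = (x \in V).

Definition extends_val (v : valuation F) (w : valuation L) : Prop :=
  forall x, w (f x) = v x.

(* The map induced by f on residue fields; meaningful when W lies over V. *)
Definition residue_map (V : valuation_ring F) (W : valuation_ring L)
    (a : residue_field V) : residue_field W :=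
  residue W (f (residue_lift a)).

Lemma residue_mapE V W x : extends_ring V W -> x \in V ->
  residue_map W (residue V x) = residue W (f x).
Proof.
move=> VW Vx; apply/eqP; rewrite /residue_map.
set y := residue_lift _; have Vy : y \in V by exact: residue_lift_in.
have : residue V y == residue V x by rewrite residue_liftK.
have Vyx : y - x \in V by rewrite (rpredB (S := vring_pred V)).
have -> : y = (y - x) + x by rewrite subrK.
rewrite rmorphD (residueD Vyx Vx) (@residueD _ W) ?VW //.
have E (k : fieldType) (a b : k) : (a + b == b) = (a == 0).
  by rewrite -subr_eq0 addrK.
rewrite !E !residue_eq0 ?VW //.
by rewrite fmorph_eq0 -fmorphV VW.
Qed.

Definition residually_algebraic (V : valuation_ring F) (W : valuation_ring L) :=
  forall u : residue_field W, algebraicOver (@residue_map V W) u.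

Definition residually_finite (V : valuation_ring F) (W : valuation_ring L) :=
  exists (n : nat) (b : 'I_n -> residue_field W), forall u : residue_field W,
    exists c : 'I_n -> residue_field V, u = \sum_(i < n) residue_map W (c i) * b i.

Definition algebraic_closure : Prop :=
  GRing.closed_field_axiom L /\ forall x : L, algebraicOver f x.

Definition transcendentalOver (a : L) : Prop := ~ algebraicOver f a.

(* The subfield F(a) of L. *)
Definition adjoin (a : L) : set L :=
  [set y | exists p q : {poly F},
     (map_poly f q).[a] != 0 /\ y = (map_poly f p).[a] / (map_poly f q).[a]]%classic.

End Extension.

Section Limits.
Variables (F : fieldType) (v : valuation F).

Definition tends_to_infinity (u : nat -> \bar rat) : Prop :=
  forall c : rat, exists N, forall n, (N <= n)%N -> (c%:E <= u n)%E.

Definition val_converges (s : nat -> F) (l : F) : Prop :=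
  tends_to_infinity (fun n => v (l - s n)).

Definition val_cauchy (s : nat -> F) : Prop :=
  forall c : rat, exists N, forall m n, (N <= m)%N -> (N <= n)%N ->
    (c%:E <= v (s m - s n)%R)%E.

Definition val_complete : Prop :=
  forall s, val_cauchy s -> exists l, val_converges s l.

End Limits.

Definition is_completion (F L : fieldType) (f : {rmorphism F -> L})
    (v : valuation F) (w : valuation L) : Prop :=
  [/\ extends_val f v w,
      val_complete w &
      forall (y : L) (c : rat), exists x : F, (c%:E <= w (y - f x)%R)%E].

Definition value_group (F : fieldType) (v : valuation F) (A : set F) : set rat :=
  [set q | exists x : F, [/\ A x, x != 0 & v x = q%:E]]%classic.

(* The number of cosets of H in G (0 when there are infinitely many). *)
Definition group_index (G H : set rat) : nat :=
  #|` fset_set [set [set (g + h)%R | h in H] | g in G]%classic |%fset.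

Definition ram_index (F L : fieldType) (f : {rmorphism F -> L})
    (v : valuation F) (w : valuation L) (s : L) : nat :=
  group_index (value_group w (adjoin f s)) (value_group v setT).

Section Eval.
Variables (K L : fieldType) (f : {rmorphism K -> L}).

Definition constF : {rmorphism K -> {fraction {poly K}}} :=
  (@tofrac {poly K}) \o polyC.

Definition ratfun_eval (a : L) (phi : {fraction {poly K}}) : L :=
  (map_poly f \n_(repr phi)).[a] / (map_poly f \d_(repr phi)).[a].

Lemma ratfun_numden (phi : {fraction {poly K}}) :
  phi = tofrac \n_(repr phi) / tofrac \d_(repr phi).
Proof.
set n := \n_(repr phi); set d := \d_(repr phi).
have d0 : d != 0 by exact: denom_ratioP.
rewrite -[LHS]reprK -[repr phi]Ratio_numden -/n -/d.
rewrite /GRing.inv /GRing.mul /= -[FracField.inv _]/(FracField.inv _).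
rewrite !piE /FracField.mulf /FracField.invf.
by rewrite !numden_Ratio ?oner_neq0 ?mulr1 ?mul1r.
Qed.

Variables (a : L) (tr : transcendentalOver f a).

Lemma horner_transc_neq0 p : p != 0 -> (map_poly f p).[a] != 0.
Proof. by move=> p0; apply/negP => pa; apply: tr; exists p. Qed.

Lemma ratfun_evalE p q : q != 0 ->
  ratfun_eval a (tofrac p / tofrac q) = (map_poly f p).[a] / (map_poly f q).[a].
Proof.
move=> q0; set phi := _ / _; rewrite /ratfun_eval.
have := ratfun_numden phi.
set n := \n_(repr phi); set d := \d_(repr phi) => Ephi.
have d0 : d != 0 by exact: denom_ratioP.
have : tofrac (p * d) == tofrac (n * q).
  by rewrite !tofracM -eqr_div ?tofrac_eq0 // -Ephi.
rewrite tofrac_eq => /eqP E; apply/eqP.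
rewrite eqr_div ?horner_transc_neq0 // -!hornerM -!rmorphM /=.
by rewrite -E.
Qed.

Lemma ratfunP (phi : {fraction {poly K}}) :
  exists p q, q != 0 /\ phi = tofrac p / tofrac q.
Proof.
exists \n_(repr phi), \d_(repr phi); split; first exact: denom_ratioP.
exact: ratfun_numden.
Qed.

Lemma ratfun_eval1 : ratfun_eval a 1 = 1.
Proof.
have -> : 1 = tofrac 1 / tofrac 1 :> {fraction {poly K}}.
  by rewrite tofrac1 divr1.
by rewrite ratfun_evalE ?oner_neq0 // rmorph1 hornerC divr1.
Qed.

Lemma ratfun_evalM phi psi :
  ratfun_eval a (phi * psi) = ratfun_eval a phi * ratfun_eval a psi.
Proof.
have [p [q [q0 ->]]] := ratfunP phi; have [r [s [s0 ->]]] := ratfunP psi.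
rewrite mulf_div -!tofracM !ratfun_evalE ?mulf_neq0 //.
by rewrite !rmorphM !hornerM mulf_div.
Qed.

Lemma ratfun_evalB phi psi :
  ratfun_eval a (phi - psi) = ratfun_eval a phi - ratfun_eval a psi.
Proof.
have [p [q [q0 ->]]] := ratfunP phi; have [r [s [s0 ->]]] := ratfunP psi.
rewrite -mulNr -tofracN addf_div ?tofrac_eq0 //.
rewrite -!tofracM -tofracD !ratfun_evalE ?mulf_neq0 //.
rewrite -mulNr addf_div ?horner_transc_neq0 //.
by rewrite !(rmorphD, rmorphM, rmorphN) !(hornerD, hornerM, hornerN).
Qed.

Lemma ratfun_evalV phi : ratfun_eval a phi^-1 = (ratfun_eval a phi)^-1.
Proof.
have [->|phi0] := eqVneq phi 0.
  have E0 : ratfun_eval a 0 = 0 by rewrite -(subrr 0) ratfun_evalB subrr.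
  by rewrite invr0 E0 invr0.
apply: (mulIf (x := ratfun_eval a phi)); last first.
  rewrite -ratfun_evalM mulVf // ratfun_eval1 mulVf //.
  by apply: contra_neq (oner_neq0 L) => E;
    rewrite -ratfun_eval1 -(mulVf phi0) ratfun_evalM E mulr0.
by apply: contra_neq (oner_neq0 L) => E;
  rewrite -ratfun_eval1 -(mulVf phi0) ratfun_evalM E mulr0.
Qed.

(* V_a = {phi in K(X) | v(phi(a)) >= 0} *)
Variable v : valuation L.

Definition transc_pred : {pred {fraction {poly K}}} :=
  fun phi => (0 <= v (ratfun_eval a phi))%E.

Lemma transc_predE phi :
  (phi \in transc_pred) = (ratfun_eval a phi \in valuation_ring_of v).
Proof. by []. Qed.

Lemma transc_pred_subring : subring_closed transc_pred.
Proof.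
have [V1 VB VM] := val_pred_subring v.
split=> [|x y|x y]; rewrite !transc_predE ?ratfun_eval1 //.
- by rewrite ratfun_evalB; apply: VB.
- by rewrite ratfun_evalM; apply: VM.
Qed.

Lemma transc_pred_total x : (x \in transc_pred) || (x^-1 \in transc_pred).
Proof. by rewrite !transc_predE ratfun_evalV; apply: val_pred_total. Qed.

Definition transc_ring : valuation_ring {fraction {poly K}} :=
  ValuationRing transc_pred_subring transc_pred_total.

End Eval.

(* a is a v-adic limit of elements of F^alg with bounded ramification. *)
Definition bounded_ram_limit (F L M : fieldType) (j : {rmorphism F -> L})
    (k : {rmorphism L -> M}) (vF : valuation F) (vL : valuation L)
    (vM : valuation M) (a : M) : Prop :=
  exists s : nat -> L, val_converges vM (fun n => k (s n)) a /\
    exists B : nat, forall n, (ram_index j vF vL (s n) <= B)%N.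

(* Main.v *)
Require Import Defs.
From HB Require Import structures.
From mathcomp Require Import all_boot all_order all_algebra separable.
From mathcomp Require Import finmap.
From mathcomp Require Import boolp classical_sets functions cardinality.
From mathcomp Require Import constructive_ereal.
From mathcomp Require Import ring lra zify.

Set Implicit Arguments.
Unset Strict Implicit.
Unset Printing Implicit Defensive.

Import Order.TTheory GRing.Theory Num.Theory.
Local Open Scope ring_scope.

(** The valuation domains V_alpha are discrete and residually algebraic because
    alpha is a limit of algebraic elements s_n: a rational function has the same
    value at alpha and at s_n for large n, so that the value group has
    denominators bounded in terms of the ramification indices
    (transc_value_int), and an integral element of KK is congruent to an
    algebraic one (transc_residually_algebraic).

    Conversely let W be a discrete, residually algebraic extension with
    valuation w normalized to extend v. An embedding of K(X) into KK with
    v(P(a)) = w(P) for all polynomials P must be found, and a must be a limit of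
    elements with bounded ramification. Classically the completion of K(X) is
    totally ramified, of finite degree e, over its maximal unramified part, which
    has the same residue field. Here the completion is replaced by the ring of
    Cauchy sequences, with the limit of the values as a semivaluation. As the
    residue field of V is perfect, residue classes are simple roots, which
    Hensel's lemma lifts (cs_hensel); Zorn's lemma then yields an isometric
    correspondence between a ring of Cauchy sequences that meets all residue
    classes and a subring D' of Kbar (coef_ring_exists). Integral elements are
    approximated by polynomials of degree less than e in a uniformizer pi, with
    coefficients in the first ring. In particular pi is an approximate root of
    Eisenstein polynomials of degree e, whose counterparts over D' have roots in
    Kbar; these can be chosen to form a Cauchy sequence since the degree is
    fixed. Replacing pi by these roots in the expansions of X gives the sequence
    s_n (uniformizer_approx). The values at s_n of polynomials over D' lie in
    (1/e)Z, since polynomials of degree less than e in an element of value 1/e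
    have no cancellation (short_poly_dominant); hence e_{s_n} <= e.

    For the last assertion, if alpha is algebraic over the completion of K then
    linear relations between its rational functions reduce to relations between
    residue classes (algebraic_residually_finite). If the residue extension is
    finite, lifts of a spanning family times powers of a uniformizer generate W modulo t,
    so by completeness of Khat the powers of alpha lie in a finite-dimensional
    space over Khat (finite_residue_algebraic). *)

(** * Semivaluations on commutative rings *)

(** The value of a nonzero element may be +oo. This lets rings of Cauchy
    sequences and products of rings carry a valuation without passing to a
    quotient; an element of value +oo stands for zero there. *)
Record semival (R : comNzRingType) := Semival {
  sv :> R -> \bar rat;
  sv0 : sv 0 = +oo%E;
  sv1 : sv 1 = 0%E;
  svM : forall x y, sv (x * y) = (sv x + sv y)%E;
  svD : forall x y, (Order.min (sv x) (sv y) <= sv (x + y)%R)%E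
}.

Definition sval_of (F : fieldType) (v : valuation F) : semival F :=
  Semival (Defs.val0 v) (Defs.val1 v) (Defs.valM v) (Defs.valD v).

Lemma ereal_lefP (a b : \bar rat) :
  (forall q : rat, (q%:E <= a)%E -> (q%:E <= b)%E) -> (a <= b)%E.
Proof.
case: a b => [r||] [s||] H //; rewrite ?leey ?leNye //.
- exact: H.
- by have := H r (lexx _).
- have := H (s + 1) (leey _); rewrite lee_fin => h; exfalso; lra.
- by have := H 0 (leey _).
Qed.

Lemma ereal_eqfP (a b : \bar rat) :
  (forall q : rat, (q%:E <= a)%E <-> (q%:E <= b)%E) -> a = b.
Proof.
by move=> H; apply/eqP; rewrite eq_le; apply/andP; split; apply: ereal_lefP => q /H.
Qed.

Lemma archi_nat (c : rat) : exists N : nat, forall n, (N <= n)%N -> c <= n%:R.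
Proof.
exists (Num.bound `|c|) => n h; apply: le_trans (ler_norm _) _.
apply: le_trans (ltW (archi_boundP (normr_ge0 _))) _.
by rewrite ler_nat.
Qed.

Section SemivalTheory.
Variables (R : comNzRingType) (v : semival R).
Implicit Types (x y z : R) (p : {poly R}) (q r : \bar rat).

Lemma sv_neqNy x : v x != -oo%E.
Proof.
apply/eqP => E; have := svM v x 0.
by rewrite mulr0 sv0 E.
Qed.

Lemma sv_cases x : (v x = +oo%E) \/ exists a : rat, v x = a%:E.
Proof. by have := sv_neqNy x; case: (v x) => [a||] // _; [right; exists a|left]. Qed.

Lemma svN1 : v (-1) = 0%E.
Proof.
have := svM v (-1) (-1); rewrite mulrNN mulr1 sv1.
case: (sv_cases (-1)) => [->//|[a ->]]; rewrite -EFinD => -[] h.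
by congr (_%:E); lra.
Qed.

Lemma svN x : v (- x) = v x.
Proof. by rewrite -mulN1r svM svN1 add0e. Qed.

Lemma svBC x y : v (x - y) = v (y - x).
Proof. by rewrite -svN opprB. Qed.

Lemma sv_geD q x y : (q <= v x)%E -> (q <= v y)%E -> (q <= v (x + y)%R)%E.
Proof. by move=> hx hy; apply: le_trans (svD v x y); rewrite le_min hx hy. Qed.

Lemma sv_gtD q x y : (q < v x)%E -> (q < v y)%E -> (q < v (x + y)%R)%E.
Proof. by move=> hx hy; apply: lt_le_trans (svD v x y); rewrite lt_min hx hy. Qed.

Lemma sv_geB q x y : (q <= v x)%E -> (q <= v y)%E -> (q <= v (x - y)%R)%E.
Proof. by move=> hx hy; apply: sv_geD; rewrite ?svN. Qed.

Lemma sv_gtB q x y : (q < v x)%E -> (q < v y)%E -> (q < v (x - y)%R)%E.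
Proof. by move=> hx hy; apply: sv_gtD; rewrite ?svN. Qed.

Lemma sv_geB_trans q x y z :
  (q <= v (x - y)%R)%E -> (q <= v (y - z)%R)%E -> (q <= v (x - z)%R)%E.
Proof. by move=> h1 h2; rewrite -(subrK y x) -addrA; apply: sv_geD. Qed.

Lemma sv_ge_sum I (s : seq I) (P : pred I) (F : I -> R) q :
  (forall i, P i -> (q <= v (F i))%E) -> (q <= v (\sum_(i <- s | P i) F i)%R)%E.
Proof.
move=> H; elim/big_ind: _ => //; first by rewrite sv0 leey.
exact: sv_geD.
Qed.

Lemma sv_gt_sum I (s : seq I) (P : pred I) (F : I -> R) (a : rat) :
  (forall i, P i -> (a%:E < v (F i))%E) -> (a%:E < v (\sum_(i <- s | P i) F i)%R)%E.
Proof.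
move=> H; elim/big_ind: _ => //; first by rewrite sv0 ltry.
exact: sv_gtD.
Qed.

Lemma sv_ge0M q x y : (0 <= v x)%E -> (q <= v y)%E -> (q <= v (x * y)%R)%E.
Proof. by move=> hx hy; rewrite svM -[q]add0e leeD. Qed.

Lemma sv_gt0M (a : rat) x y : (0 <= v x)%E -> (a%:E < v y)%E -> (a%:E < v (x * y)%R)%E.
Proof. by move=> hx hy; rewrite svM -[a%:E]add0e lee_ltD. Qed.

Lemma sv_Mge0 q x y : (q <= v x)%E -> (0 <= v y)%E -> (q <= v (x * y)%R)%E.
Proof. by rewrite mulrC => *; apply: sv_ge0M. Qed.

Lemma sv_Mgt0 (a : rat) x y : (a%:E < v x)%E -> (0 <= v y)%E -> (a%:E < v (x * y)%R)%E.
Proof. by rewrite mulrC => *; apply: sv_gt0M. Qed.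

Lemma sv_My x y : v y = +oo%E -> v (x * y) = +oo%E.
Proof. by move=> hy; rewrite svM hy addey // sv_neqNy. Qed.

Lemma sv_ltD x y : (v x < v y)%E -> v (x + y) = v x.
Proof.
move=> xy; apply/eqP; rewrite eq_le; apply/andP; split; last first.
  by apply: sv_geD => //; apply: ltW.
rewrite leNgt; apply/negP => h.
have : (v x < v (x + y - y)%R)%E by apply: sv_gtB.
by rewrite addrK ltxx.
Qed.

Lemma sv_ltB x y : (v x < v (y - x)%R)%E -> v y = v x.
Proof. by move=> h; rewrite -(subrK x y) addrC sv_ltD. Qed.

Lemma sv_congy x y : v (x - y) = +oo%E -> v x = v y.
Proof.
move=> h; have [y0|y0] := eqVneq (v y) +oo%E.
  by rewrite -(subrK y x) y0; apply/eqP; rewrite -leye_eq sv_geD ?h ?y0.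
by apply: sv_ltB; rewrite h ltey.
Qed.

Lemma svX x n : (0 <= v x)%E -> (0 <= v (x ^+ n)%R)%E.
Proof. by move=> hx; elim: n => [|n IH]; rewrite ?expr0 ?sv1 // exprS sv_ge0M. Qed.

Lemma svXfin x (a : rat) n : v x = a%:E -> v (x ^+ n) = (a * n%:R)%:E.
Proof.
move=> hx; elim: n => [|n IH]; first by rewrite expr0 sv1 mulr0.
by rewrite exprS svM IH hx -EFinD -natr1 mulrDr mulr1 addrC.
Qed.

Definition intring : {pred R} := fun x => (0 <= v x)%E.

Lemma intringE x : (x \in intring) = (0 <= v x)%E. Proof. by []. Qed.

Lemma intring_subring : subring_closed intring.
Proof.
split=> [|x y|x y]; rewrite !intringE ?sv1 //; first exact: sv_geB.
exact: sv_ge0M.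
Qed.

HB.instance Definition _ :=
  GRing.isSubringClosed.Build R intring intring_subring.

Lemma intpoly_horner p x : p \is a polyOver intring -> (0 <= v x)%E ->
  (0 <= v p.[x])%E.
Proof. by move=> hp hx; rewrite -intringE; apply: rpred_horner. Qed.

Lemma sv_ge_horner p x q : (forall i, (q <= v p`_i)%E) -> (0 <= v x)%E ->
  (q <= v p.[x])%E.
Proof.
move=> hp hx; rewrite horner_coef; apply: sv_ge_sum => i _.
by apply: sv_Mge0 => //; apply: svX.
Qed.

Lemma sv_gt_horner p x (a : rat) : (forall i, (a%:E < v p`_i)%E) -> (0 <= v x)%E ->
  (a%:E < v p.[x])%E.
Proof.
move=> hp hx; rewrite horner_coef; apply: sv_gt_sum => i _.
by apply: sv_Mgt0 => //; apply: svX.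
Qed.

(** Taylor's formula to second order, with an integral remainder: it serves
    both Newton's iteration and the comparison of nearby roots. *)
Lemma horner_taylor2 p x h : p \is a polyOver intring -> (0 <= v x)%E -> (0 <= v h)%E ->
  exists2 r, (0 <= v r)%E & p.[x + h] = p.[x] + h * (p^`().[x] + h * r).
Proof.
move=> + hx hh; elim/poly_ind: p => [|p c IH] hp.
  by exists 0; [rewrite sv0 leey | rewrite deriv0 !horner0 !(mulr0, addr0)].
have [hp' hc] : p \is a polyOver intring /\ (0 <= v c)%E.
  split.
    apply/polyOverP => i; have /polyOverP/(_ i.+1) := hp.
    by rewrite coefD coefMX coefC /= addr0.
  by have /polyOverP/(_ 0) := hp; rewrite coefD coefMX coefC /= add0r.
have [r hr E] := IH hp'.
exists (p^`().[x] + h * r + r * x).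
  have ? : (0 <= v p^`().[x])%E by apply: intpoly_horner => //; apply: polyOver_deriv.
  by rewrite ?(sv_geD, sv_ge0M).
rewrite derivD derivC addr0 derivM derivX mulr1 !hornerE E.
ring.
Qed.

Lemma horner_diff p x y : p \is a polyOver intring -> (0 <= v x)%E -> (0 <= v y)%E ->
  exists2 r, (0 <= v r)%E & p.[x] - p.[y] = (x - y) * r.
Proof.
move=> hp hx hy; have [||r hr E] := @horner_taylor2 p y (x - y) hp => //.
  exact: sv_geB.
exists (p^`().[y] + (x - y) * r).
  by rewrite sv_geD ?sv_ge0M ?sv_geB ?intpoly_horner ?polyOver_deriv.
by rewrite addrC subrK in E; rewrite E; ring.
Qed.

Lemma sv_ge_horner_diff q p x y : p \is a polyOver intring -> (0 <= v x)%E ->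
  (0 <= v y)%E -> (q <= v (x - y)%R)%E -> (q <= v (p.[x] - p.[y])%R)%E.
Proof. by move=> hp hx hy h; have [r hr ->] := horner_diff hp hx hy; apply: sv_Mge0. Qed.

Lemma sv_gt_horner_diff (a : rat) p x y : p \is a polyOver intring -> (0 <= v x)%E ->
  (0 <= v y)%E -> (a%:E < v (x - y)%R)%E -> (a%:E < v (p.[x] - p.[y])%R)%E.
Proof. by move=> hp hx hy h; have [r hr ->] := horner_diff hp hx hy; apply: sv_Mgt0. Qed.

Lemma sv_lower x : exists a : rat, (a%:E <= v x)%E.
Proof. by case: (sv_cases x) => [->|[a ->]]; [exists 0; rewrite leey|exists a]. Qed.

Lemma horner_bound (b : rat) p :
  exists a : rat, forall x, (b%:E <= v x)%E -> (a%:E <= v p.[x])%E.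
Proof.
elim/poly_ind: p => [|p c [a IH]]; first by exists 0 => x _; rewrite horner0 sv0 leey.
have [a' ha'] := sv_lower c.
exists (Num.min (a + b) a') => x hx; rewrite hornerMXaddC.
apply: sv_geD; last by apply: le_trans ha'; rewrite lee_fin ge_min lexx orbT.
rewrite svM; apply: le_trans (leeD (IH _ hx) hx).
by rewrite -EFinD lee_fin ge_min lexx.
Qed.

(** The constant depends on the polynomial and on a lower bound for the
    values of the arguments, but not on the arguments: polynomials are
    uniformly continuous on bounded sets. *)
Lemma horner_lipschitz (b : rat) p :
  exists a : rat, forall x y (c : rat), (b%:E <= v x)%E -> (b%:E <= v y)%E ->
    (c%:E <= v (x - y)%R)%E -> ((a + c)%:E <= v (p.[x] - p.[y])%R)%E.
Proof.
elim/poly_ind: p => [|p c [a IH]].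
  by exists 0 => x y d _ _ _; rewrite !horner0 subrr sv0 leey.
have [a' ha'] := horner_bound b p.
exists (Num.min (a + b) a') => x y d hx hy hd; rewrite !hornerMXaddC.
have -> : p.[x] * x + c - (p.[y] * y + c) = (p.[x] - p.[y]) * x + p.[y] * (x - y).
  by ring.
apply: sv_geD; rewrite svM.
  apply: le_trans (leeD (IH _ _ _ hx hy hd) hx).
  by rewrite -EFinD lee_fin addrAC lerD2r ge_min lexx.
apply: le_trans (leeD (ha' _ hy) hd).
by rewrite -EFinD lee_fin lerD2r ge_min lexx orbT.
Qed.

(** At an element of negative value the leading term of a monic integral
    polynomial strictly dominates all others. *)
Lemma monic_integral p x : p \is monic -> p \is a polyOver intring ->
  (1 < size p)%N -> (0 <= v p.[x])%E -> (0 <= v x)%E.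
Proof.
move=> mp hp sp hpx; rewrite leNgt; apply/negP => hx.
have [a ha] : exists a : rat, v x = a%:E.
  by case: (sv_cases x) => // E; rewrite E in hx.
have a0 : a < 0 by rewrite -lte_fin -ha.
pose n := (size p).-1; have En : size p = n.+1 by rewrite prednK // ltnW.
have n0 : (0 < n)%N by rewrite -ltnS -En.
move: hpx; rewrite horner_coef En big_ord_recr /=.
have -> : p`_n = 1 by move/monicP: mp; rewrite lead_coefE.
rewrite mul1r addrC sv_ltD ?(svXfin _ ha).
  by rewrite lee_fin nmulr_rge0 // lern0 eqn0Ngt n0.
apply: (@lt_le_trans _ _ (a * n.-1%:R)%:E).
  by rewrite lte_fin ltr_nM2l // ltr_nat prednK.
apply: sv_ge_sum => i _; apply: sv_ge0M; first by have /polyOverP := hp; apply.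
rewrite (svXfin _ ha) lee_fin ler_nM2l // ler_nat.
by have := ltn_ord i; lia.
Qed.

(** The only way for the terms of a sum to cancel is that two of them have
    the same finite value. *)
Lemma sv_sum_dominant (x : nat -> R) n :
  (forall i j, (i < j < n)%N -> v (x i) = v (x j) -> v (x i) = +oo%E) -> (0 < n)%N ->
  exists2 i, (i < n)%N & v (\sum_(i < n) x i) = v (x i) /\
    forall j, (j < n)%N -> (v (x i) <= v (x j))%E.
Proof.
elim: n => // -[|n] IH H _.
  by exists 0%N => //; split=> [|[]//]; rewrite big_ord_recr big_ord0 /= add0r.
have [||i hi [E m]] := IH => //.
  by move=> i j /andP[ij jn]; apply: H; rewrite ij ltnS ltnW.
rewrite big_ord_recr /=; set S := (\sum_(_ < _) _) in E *.
case: (ltgtP (v S) (v (x n.+1))) => h.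
- exists i; first exact: ltnW.
  rewrite sv_ltD //; split=> // j; rewrite ltnS leq_eqVlt => /predU1P[->|]; last exact: m.
  by rewrite -E ltW.
- exists n.+1 => //; split; first by rewrite addrC sv_ltD.
  move=> j; rewrite ltnS leq_eqVlt => /predU1P[->//|/m].
  by apply: le_trans; rewrite -E ltW.
- have xi : v (x i) = +oo%E by apply: (H i n.+1); rewrite ?hi ?leqnn // -E.
  exists i; first exact: ltnW.
  split; last first.
    move=> j; rewrite ltnS leq_eqVlt => /predU1P[->|]; last exact: m.
    by rewrite -h -E.
  by apply/eqP; rewrite xi -leye_eq -xi -E; apply: sv_geD; rewrite // h.
Qed.

End SemivalTheory.

(** * Eventual values of Cauchy sequences *)

Definition evtl (P : nat -> Prop) := exists N, forall n, (N <= n)%N -> P n.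

Lemma evtl_and (P Q : nat -> Prop) : evtl P -> evtl Q -> evtl (fun n => P n /\ Q n).
Proof.
move=> [M hM] [N hN]; exists (maxn M N) => n; rewrite geq_max => /andP[? ?].
by split; [apply: hM|apply: hN].
Qed.

Lemma evtl_imp (P Q : nat -> Prop) : (forall n, P n -> Q n) -> evtl P -> evtl Q.
Proof. by move=> H [N hN]; exists N => n /hN /H. Qed.

Lemma evtl_all (P : nat -> nat -> Prop) k :
  (forall i, evtl (P i)) -> evtl (fun n => forall i, (i < k)%N -> P i n).
Proof.
move=> H; elim: k => [|k IH]; first by exists 0%N.
apply: evtl_imp (evtl_and IH (H k)) => n [h1 h2] i.
by rewrite ltnS leq_eqVlt => /predU1P[->|/h1].
Qed.

Section CauchyRing.
Variables (F : fieldType) (w : valuation F).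
Implicit Types (x y : nat -> F).

Definition evge x (q : rat) := evtl (fun n => q%:E <= w (x n))%E.
Definition eveq x (q : rat) := evtl (fun n => w (x n) = q%:E).

Let sw := sval_of w.

(** If some term of a tail has a value below those of all differences in the
    tail, then all terms of the tail have this value; if this never happens,
    the sequence tends to zero. *)
Lemma cauchy_cases x : val_cauchy w x -> (exists q, eveq x q) \/ forall q, evge x q.
Proof.
move=> cx; have [|/existsNP[c nc]] := pselect (forall q, evge x q); first by right.
left; have [N hN] := cx c.
have [n Nn hn] : exists2 n, (N <= n)%N & (w (x n) < c%:E)%E.
  apply: contrapT => h; apply: nc; exists N => n Nn; rewrite leNgt; apply/negP => h'.
  by apply: h; exists n.
have [q hq] : exists q : rat, w (x n) = q%:E.
  by case: (sv_cases sw (x n)) => //= E; rewrite E in hn.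
exists q, N => m Nm; rewrite -hq.
by apply: (@sv_ltB _ sw); apply: lt_le_trans hn _; apply: hN.
Qed.

Lemma cauchy_bounded x : val_cauchy w x -> exists q, evge x q.
Proof.
move=> /cauchy_cases[[q [N h]]|h]; last by exists 0.
by exists q, N => n /h ->.
Qed.

Definition cauchy_pred : {pred nat -> F} := fun x => `[< val_cauchy w x >].

Lemma cauchy_predP x : x \in cauchy_pred <-> val_cauchy w x.
Proof. by rewrite /in_mem /=; split=> /asboolP. Qed.

Lemma cauchy_cst c : val_cauchy w (cst c : nat -> F).
Proof. by move=> q; exists 0%N => m n _ _; rewrite subrr Defs.val0 leey. Qed.

Lemma cauchy_subring : subring_closed cauchy_pred.
Proof.
split=> [|x y /cauchy_predP cx /cauchy_predP cy|x y /cauchy_predP cx /cauchy_predP cy];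
  apply/cauchy_predP.
- exact: cauchy_cst.
- move=> c; have [M hM] := cx c; have [N hN] := cy c.
  exists (maxn M N) => m n; rewrite !geq_max => /andP[? ?] /andP[? ?].
  rewrite -[(x - y) m]/(x m - y m) -[(x - y) n]/(x n - y n).
  rewrite (_ : _ - _ = (x m - x n) - (y m - y n)); last by ring.
  by apply: (@sv_geB _ sw); [apply: hM|apply: hN].
- move=> c; have [a [A hA]] := cauchy_bounded cx; have [b [B hB]] := cauchy_bounded cy.
  have [M hM] := cx (c - b); have [N hN] := cy (c - a).
  exists (maxn (maxn A B) (maxn M N)) => m n; rewrite !geq_max.
  move=> /andP[/andP[? ?] /andP[? ?]] /andP[/andP[? ?] /andP[? ?]].
  rewrite -[(x * y) m]/(x m * y m) -[(x * y) n]/(x n * y n).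
  rewrite (_ : _ - _ = (x m - x n) * y m + x n * (y m - y n)); last by ring.
  apply: (@sv_geD _ sw) => /=; rewrite Defs.valM.
    by rewrite -(subrK b c) EFinD leeD ?hM ?hB.
  by rewrite -(subrK a c) addrC EFinD leeD ?hN ?hA.
Qed.

HB.instance Definition _ :=
  GRing.isSubringClosed.Build (nat -> F) cauchy_pred cauchy_subring.

(** This ring of sequences, with the limit of the values, replaces the
    completion of F: null sequences are kept as elements of value +oo. *)
Record cauchy_seq := CauchySeq { cs_val :> nat -> F; _ : cs_val \in cauchy_pred }.

HB.instance Definition _ := [isSub for cs_val].
HB.instance Definition _ := [Choice of cauchy_seq by <:].
HB.instance Definition _ := [SubChoice_isSubComNzRing of cauchy_seq by <:].

Lemma csP (x : cauchy_seq) : val_cauchy w x.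
Proof. by apply/cauchy_predP; case: x. Qed.

Definition cs_of x (cx : val_cauchy w x) : cauchy_seq :=
  CauchySeq (iffRL (cauchy_predP x) cx).

Definition cs_cst (c : F) : cauchy_seq := cs_of (cauchy_cst c).

Definition cs_eval n (x : cauchy_seq) : F := x n.

Fact cs_eval_zmod n : zmod_morphism (cs_eval n). Proof. by []. Qed.
Fact cs_eval_monoid n : monoid_morphism (cs_eval n). Proof. by []. Qed.

HB.instance Definition _ n :=
  GRing.isZmodMorphism.Build cauchy_seq F (cs_eval n) (cs_eval_zmod n).
HB.instance Definition _ n :=
  GRing.isMonoidMorphism.Build cauchy_seq F (cs_eval n) (cs_eval_monoid n).

Fact cs_cst_zmod : zmod_morphism cs_cst.
Proof. by move=> a b; apply: val_inj; apply: funext. Qed.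
Fact cs_cst_monoid : monoid_morphism cs_cst.
Proof. by split=> [|a b]; apply: val_inj; apply: funext. Qed.

HB.instance Definition _ :=
  GRing.isZmodMorphism.Build F cauchy_seq cs_cst cs_cst_zmod.
HB.instance Definition _ :=
  GRing.isMonoidMorphism.Build F cauchy_seq cs_cst cs_cst_monoid.

Definition limval (x : cauchy_seq) : \bar rat :=
  if pselect (exists q, eveq x q) is left h then (projT1 (cid h))%:E else +oo%E.

Lemma eveq_limval (x : cauchy_seq) q : eveq x q -> limval x = q%:E.
Proof.
rewrite /limval; case: pselect => [h|h hq]; last by exfalso; apply: h; exists q.
case: cid => r /= hr hq.
have [N hN] := evtl_and hr hq.
by have [-> ->] := hN N (leqnn _).
Qed.

Lemma evge_limvaly (x : cauchy_seq) : (forall q, evge x q) -> limval x = +oo%E.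
Proof.
move=> H; rewrite /limval; case: pselect => //= -[q hq]; case: cid => {hq} q /= hq; exfalso.
have [N hN] := evtl_and hq (H (q + 1)).
have [-> ] := hN N (leqnn _).
by rewrite lee_fin; apply/negP; rewrite -ltNge ltrDl.
Qed.

Lemma limval_geP (x : cauchy_seq) (q : rat) : (q%:E <= limval x)%E <-> evge x q.
Proof.
have [[r hr]|h] := cauchy_cases (csP x); last by rewrite evge_limvaly // leey.
rewrite (eveq_limval hr) lee_fin; split=> [qr|h].
  by apply: evtl_imp hr => n ->.
by have [N hN] := evtl_and hr h; have [->] := hN N (leqnn _).
Qed.

Lemma limval0 : limval 0 = +oo%E.
Proof. by apply: evge_limvaly => q; exists 0%N => n _; rewrite Defs.val0 leey. Qed.

Lemma limval_cst c : limval (cs_cst c) = w c.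
Proof.
have [E|[q E]] := sv_cases sw c; rewrite /= in E; rewrite E.
  by apply: evge_limvaly => q; exists 0%N => n _; rewrite /= /cst E leey.
by apply: eveq_limval; exists 0%N.
Qed.

Lemma limval1 : limval 1 = 0%E.
Proof. by rewrite -(rmorph1 cs_cst) limval_cst Defs.val1. Qed.

Lemma limvalM (x y : cauchy_seq) : limval (x * y) = (limval x + limval y)%E.
Proof.
have null_mul (a b : cauchy_seq) : (forall q, evge a q) -> limval (a * b) = +oo%E.
  move=> ha; apply: evge_limvaly => q; have [r hr] := cauchy_bounded (csP b).
  apply: evtl_imp (evtl_and (ha (q - r)) hr) => n [h1 h2].
  rewrite -[(a * b : cauchy_seq) n]/(a n * b n) Defs.valM.
  by rewrite -[q](subrK r) EFinD leeD.
have [[q hq]|hx] := cauchy_cases (csP x); last first.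
  rewrite null_mul // (evge_limvaly hx).
  have [[r /eveq_limval->]//|/evge_limvaly -> //] := cauchy_cases (csP y).
have [[r hr]|hy] := cauchy_cases (csP y); last first.
  by rewrite mulrC null_mul // (evge_limvaly hy) (eveq_limval hq).
rewrite (eveq_limval hq) (eveq_limval hr); apply: eveq_limval.
apply: evtl_imp (evtl_and hq hr) => n [h1 h2].
by rewrite -[(x * y : cauchy_seq) n]/(x n * y n) Defs.valM h1 h2.
Qed.

Lemma limvalD (x y : cauchy_seq) :
  (Order.min (limval x) (limval y) <= limval (x + y)%R)%E.
Proof.
apply: ereal_lefP => q; rewrite le_min => /andP[/limval_geP hx /limval_geP hy].
apply/limval_geP; apply: evtl_imp (evtl_and hx hy) => n [h1 h2].
exact: (@sv_geD _ sw).
Qed.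

Definition cs_semival : semival cauchy_seq :=
  Semival limval0 limval1 limvalM limvalD.

Lemma cs_gt0P (x : cauchy_seq) :
  (0 < limval x)%E -> exists2 d : rat, 0 < d & evge x d.
Proof.
move=> h; have [E|[q E]] := sv_cases cs_semival x; rewrite /= in E.
  by exists 1 => //; apply/limval_geP; rewrite E leey.
by exists q; [rewrite -lte_fin -E|apply/limval_geP; rewrite E].
Qed.

Lemma evge_gt0 (x : cauchy_seq) (d : rat) : 0 < d -> evge x d -> (0 < limval x)%E.
Proof. by move=> d0 /limval_geP; apply: lt_le_trans; rewrite lte_fin. Qed.

Lemma cs_dense (z : cauchy_seq) q : exists c, (q%:E <= limval (z - cs_cst c)%R)%E.
Proof.
have [N hN] := csP z q; exists (z N); apply/limval_geP; exists N => n Nn.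
by rewrite -[(_ - _ : cauchy_seq) n]/(z n - z N) hN.
Qed.

(** Newton's iteration needs no completeness as long as only an approximate
    root of a prescribed precision is asked for. *)
Lemma newton_approx (p : {poly F}) (z : F) (d : rat) :
  p \is a polyOver (intring sw) -> (0 <= w z)%E -> 0 < d -> (d%:E <= w p.[z])%E ->
  w p^`().[z] = 0%E -> forall q : rat,
  exists2 y, (d%:E <= w (y - z)%R)%E & (q%:E <= w p.[y])%E.
Proof.
move=> hp hz d0 hpz hp'z.
(* Each step gains at least d, the initial precision. *)
suff H n : exists2 y, (d%:E <= w (y - z)%R)%E & ((d * n.+1%:R)%:E <= w p.[y])%E.
  move=> q; have [N hN] := archi_nat (q / d); have [y h1 h2] := H N; exists y => //.
  by apply: le_trans h2; rewrite lee_fin mulrC -ler_pdivrMr // hN.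
elim: n => [|n [y hy hpy]].
  by exists z; rewrite ?subrr ?Defs.val0 ?leey // mulr1.
have wy : (0 <= w y)%E.
  rewrite -(subrK z y); apply: (@sv_geD _ sw) => //.
  by apply: le_trans hy; rewrite lee_fin ltW.
have hp'y : w p^`().[y] = 0%E.
  rewrite -hp'z; apply: (@sv_ltB _ sw); rewrite /= hp'z.
  apply: (@sv_gt_horner_diff _ sw); rewrite ?polyOver_deriv //.
  by apply: lt_le_trans hy; rewrite lte_fin.
have p'0 : p^`().[y] != 0 by rewrite -(val_eqy w) hp'y.
have E : w (p.[y] / p^`().[y]) = w p.[y].
  by rewrite -[p.[y] in RHS](divfK p'0) [RHS]Defs.valM hp'y adde0.
pose h := - (p.[y] / p^`().[y]).
have Eh : w h = w p.[y] by rewrite -E; apply: (@svN _ sw).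
have dn : d <= d * n.+1%:R by rewrite ler_peMr ?ler1n ?ltW.
have hh : (d%:E <= w h)%E by rewrite Eh (le_trans _ hpy).
have [||r hr Er] := @horner_taylor2 _ sw p y h hp => //=.
  by apply: le_trans hh; rewrite lee_fin ltW.
exists (y + h).
  by rewrite addrAC; apply: (@sv_geD _ sw).
rewrite Er [h * (_ + _)]mulrDr addrA {1}/h mulNr divfK // subrr add0r.
apply: (@le_trans _ _ (w h + w h)%E).
  rewrite -natr1 mulrDr mulr1 EFinD leeD // Eh //.
by rewrite mulrA Defs.valM -(Defs.valM w h h) leeDl.
Qed.

(** By Taylor's formula the difference of the two values of p is x - y times
    a unit. *)
Lemma simple_root_isolated (p : {poly F}) (x y : F) :
  p \is a polyOver (intring sw) -> (0 <= w y)%E -> (0 < w (x - y)%R)%E ->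
  w p^`().[y] = 0%E -> w (p.[x] - p.[y]) = w (x - y).
Proof.
move=> hp hy hxy hp'.
have [||r hr] := @horner_taylor2 _ sw p y (x - y) hp => //=; first exact: ltW.
rewrite addrC subrK => ->; rewrite addrAC subrr add0r Defs.valM.
have -> : w (p^`().[y] + (x - y) * r)%R = w p^`().[y].
  by apply: (@sv_ltD _ sw); rewrite /= hp'; apply: (@sv_Mgt0 _ sw).
by rewrite hp' adde0.
Qed.

Lemma cs_poly_int (p : {poly cauchy_seq}) : p \is a polyOver (intring cs_semival) ->
  evtl (fun n => map_poly (cs_eval n) p \is a polyOver (intring sw)).
Proof.
move=> hp.
have H i : evtl (fun n => (0 <= w (p`_i n))%E).
  by apply/(limval_geP p`_i 0); have /polyOverP := hp; apply.
apply: evtl_imp (evtl_all (size p) H) => n h.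
apply/polyOverP => i; rewrite coef_map /= intringE.
have [/h //|si] := ltnP i (size p).
by rewrite nth_default // rmorph0 sv0 leey.
Qed.

(** Hensel's lemma for Cauchy sequences: the n-th term of the root is an
    approximate root, of precision n, of the n-th polynomial, and
    simple_root_isolated makes these terms a Cauchy sequence. *)
Lemma cs_hensel (p : {poly cauchy_seq}) (z : cauchy_seq) :
  p \is a polyOver (intring cs_semival) -> (0 <= limval z)%E ->
  (0 < limval p.[z])%E -> limval p^`().[z] = 0%E ->
  exists2 x : cauchy_seq, limval p.[x] = +oo%E & (0 < limval (x - z)%R)%E.
Proof.
move=> hp hz hpz hp'z.
pose P n := map_poly (cs_eval n) p.
have Pz n (y : cauchy_seq) : p.[y] n = (P n).[y n].
  by rewrite -[LHS]/(cs_eval n _) -horner_map.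
have P'z n : p^`().[z] n = (P n)^`().[z n].
  by rewrite -[LHS]/(cs_eval n _) -horner_map deriv_map.
have [d d0 hd] := cs_gt0P hpz.
have hp'1 : eveq p^`().[z] 0.
  have [[q hq]|h] := cauchy_cases (csP p^`().[z]).
    by move: hp'z; rewrite (eveq_limval hq) => -[<-].
  by rewrite evge_limvaly in hp'z.
have [N hN] : evtl (fun n => exists y : F, [/\ (d%:E <= w (y - z n)%R)%E,
    (n%:R%:E <= w (P n).[y])%E, (P n) \is a polyOver (intring sw), (0 <= w (z n))%E &
    w (P n)^`().[z n] = 0%E]).
  have /limval_geP hz0 := hz.
  apply: evtl_imp (evtl_and (evtl_and (cs_poly_int hp) hz0) (evtl_and hd hp'1)).
  move=> n [[h1 h2] [h3 h4]]; rewrite Pz in h3; rewrite P'z in h4.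
  by have [y ? ?] := newton_approx h1 h2 d0 h3 h4 n%:R; exists y.
have [X hX] : exists X : nat -> F, forall n, (N <= n)%N -> [/\ (d%:E <= w (X n - z n)%R)%E,
    (n%:R%:E <= w (P n).[X n])%E, (P n) \is a polyOver (intring sw), (0 <= w (z n))%E &
    w (P n)^`().[z n] = 0%E].
  have /choice[X hX] : forall n, exists y : F, (N <= n)%N -> [/\ (d%:E <= w (y - z n)%R)%E,
    (n%:R%:E <= w (P n).[y])%E, (P n) \is a polyOver (intring sw), (0 <= w (z n))%E &
    w (P n)^`().[z n] = 0%E].
    move=> n; case: (leqP N n) => [/hN[y hy]|//]; first by exists y.
    by exists 0.
  by exists X.
have X0 n : (N <= n)%N -> (0 <= w (X n))%E.
  move=> /hX[h1 _ _ h2 _]; rewrite -(subrK (z n) (X n)); apply: (@sv_geD _ sw) => //.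
  by apply: le_trans h1; rewrite lee_fin ltW.
have cX : val_cauchy w X.
  move=> c.
  have [M hM] : evtl (fun M => forall m n, (M <= m)%N -> (M <= n)%N ->
      forall i, (c%:E <= w ((P m)`_i - (P n)`_i)%R)%E).
    have H i : evtl (fun M => forall m n, (M <= m)%N -> (M <= n)%N ->
      (c%:E <= w (p`_i m - p`_i n)%R)%E).
      have [M hM] := csP p`_i c; exists M => k Mk m n km kn.
      by apply: hM; apply: leq_trans Mk _.
    apply: evtl_imp (evtl_all (size p) H) => M h m n Mm Mn i; rewrite !coef_map /=.
    have [si|si] := ltnP i (size p); first exact: h.
    by rewrite nth_default // !rmorph0 subrr Defs.val0 leey.
  have [M' hM'] := csP z d.
  have [b hb] := archi_nat c.
  exists (maxn (maxn N M) (maxn M' b)) => m n; rewrite !geq_max.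
  move=> /andP[/andP[Nm Mm] /andP[M'm bm]] /andP[/andP[Nn Mn] /andP[M'n bn]].
  have [m1 m2 m3 m4 m5] := hX m Nm; have [n1 n2 n3 n4 n5] := hX n Nn.
  have dX : (d%:E <= w (X m - X n)%R)%E.
    apply: (@sv_geB_trans _ sw _ _ (z m)) => //.
    apply: (@sv_geB_trans _ sw _ _ (z n)); first exact: hM'.
    by rewrite (svBC sw).
  rewrite -(@simple_root_isolated (P n)) ?X0 //.
  - apply: (@sv_geB _ sw); last by apply: le_trans n2; rewrite lee_fin hb.
    rewrite -(subrK (P m).[X m] (P n).[X m]); apply: (@sv_geD _ sw) => /=.
      rewrite -hornerN -hornerD; apply: (@sv_ge_horner _ sw) => [i|]; last exact: X0.
      by rewrite coefB (hM M).
    by apply: le_trans m2; rewrite lee_fin hb.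
  - by apply: lt_le_trans dX; rewrite lte_fin.
  - rewrite -n5; apply: (@sv_ltB _ sw) => /=; rewrite n5.
    apply: (@lt_le_trans _ _ d%:E); first by rewrite lte_fin.
    by apply: (@sv_ge_horner_diff _ sw) => //; [apply: polyOver_deriv|apply: X0].
exists (cs_of cX).
  apply: evge_limvaly => q; have [b hb] := archi_nat q.
  exists (maxn N b) => n; rewrite geq_max => /andP[Nn bn].
  by rewrite Pz /=; have [_ h _ _ _] := hX n Nn; apply: le_trans h; rewrite lee_fin hb.
apply: (evge_gt0 d0); exists N => n Nn.
by rewrite -[(_ - _ : cauchy_seq) n]/(X n - z n); have [] := hX n Nn.
Qed.

End CauchyRing.

(** * Division with remainder over a subring *)

Record subring (R : comNzRingType) := Subring {
  subring_pred :> {pred R};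
  subring_closedP : subring_closed subring_pred }.

HB.instance Definition _ (R : comNzRingType) (S : subring R) :=
  GRing.isSubringClosed.Build R (subring_pred S) (subring_closedP S).

Section IntegralPart.
Variables (R : comNzRingType) (nu : semival R) (D : subring R).

Definition intpart_pred : {pred R} := fun x => (x \in D) && (x \in intring nu).

Lemma intpart_closed : subring_closed intpart_pred.
Proof.
split=> [|x y /andP[hx hx'] /andP[hy hy']|x y /andP[hx hx'] /andP[hy hy']]; apply/andP.
- by split; rewrite ?rpred1.
- by split; rewrite ?rpredB.
- by split; rewrite ?rpredM.
Qed.

Definition intpart := Subring intpart_closed.

Lemma intpartP x : reflect (x \in D /\ (0 <= nu x)%E) (x \in intpart).
Proof. exact: andP. Qed.

End IntegralPart.

Lemma monic_div (R : comNzRingType) (S : subringClosed R) (p q : {poly R}) :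
  p \is monic -> p \is a polyOver S -> q \is a polyOver S ->
  exists Q r, [/\ Q \is a polyOver S, r \is a polyOver S, q = Q * p + r &
    (size r < size p)%N].
Proof.
move=> mp hp; have p0 : (0 < size p)%N by rewrite size_poly_gt0 monic_neq0.
move: {2}(size q) (leqnn (size q)) => n; elim: n q => [|n IH] q sq hq.
  by exists 0, 0; rewrite !rpred0 mul0r addr0 size_poly0; split=> //; apply/eqP;
    rewrite -size_poly_leq0.
have [lt|le] := ltnP (size q) (size p).
  by exists 0, q; rewrite rpred0 mul0r add0r.
pose c := lead_coef q; pose k := (size q - size p)%N.
have hm : (c%:P * 'X^k) \is a polyOver S.
  by rewrite rpredM ?rpredX ?polyOverX // polyOverC; have /polyOverP := hq; apply.
have [||Q [r [hQ hr E sr]]] := IH (q - c%:P * 'X^k * p); last first.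
- exists (Q + c%:P * 'X^k), r; split=> //; first by rewrite rpredD.
  by rewrite mulrDl addrAC -E subrK.
- by rewrite rpredB // rpredM.
apply/leq_sizeP => j nj; rewrite coefB -mulrA coefCM coefXnM.
have kj : (k <= j)%N by rewrite /k; lia.
rewrite ltnNge kj /=.
have [sj|jn] := ltnP (size q).-1 j.
  rewrite (nth_default _ (s := q)) 1?(nth_default _ (s := p)) ?mulr0 ?subrr // ?/k; lia.
have Ej : j = (size q).-1 by lia.
have -> : p`_(j - k) = 1.
  rewrite (_ : (j - k)%N = (size p).-1); last by rewrite /k; lia.
  by move/monicP: mp.
by rewrite mulr1 /c lead_coefE Ej subrr.
Qed.

(** * Lifting the residue field into an algebraic extension *)

Section ApproximateInverse.
Variables (K : fieldType) (v : valuation K) (R : comNzRingType) (nu : semival R).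
Variables (f : {rmorphism K -> R}).
Hypothesis hf : forall c, nu (f c) = v c.

Lemma intpoly_map (P : {poly K}) : P \is a polyOver (intring (sval_of v)) ->
  map_poly f P \is a polyOver (intring nu).
Proof.
by move=> /polyOverP hP; apply/polyOverP => i; rewrite coef_map intringE /= hf; apply: hP.
Qed.

(** If the constant term of P is a unit, the relation P(z) = 0 in the residue
    field gives the inverse of z; otherwise it can be divided by z. *)
Lemma approx_inverse (P : {poly K}) (z : R) :
  P \is monic -> P \is a polyOver (intring (sval_of v)) ->
  nu z = 0%E -> (0 < nu (map_poly f P).[z])%E ->
  exists2 h : {poly K}, h \is a polyOver (intring (sval_of v)) &
    (0 < nu ((map_poly f h).[z] * z - 1)%R)%E.
Proof.
move: {2}(size P) (leqnn (size P)) => n; elim: n P => [|n IH] P sP mP hP hz hPz.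
  by move: sP; rewrite leqNgt size_poly_gt0 monic_neq0.
have s1 : (1 < size P)%N.
  rewrite ltnNge; apply/negP => /size1_polyC E.
  move: mP hPz; rewrite E => /monicP; rewrite lead_coefC => ->.
  by rewrite rmorph1 hornerC sv1 ltxx.
pose Q := drop_poly 1 P; pose c := P`_0.
have EP : P = Q * 'X + c%:P.
  rewrite -{1}(poly_take_drop 1 P) -/Q addrC; congr (_ + _).
  by apply/polyP => -[|i]; rewrite coef_take_poly coefC.
have hQ : Q \is a polyOver (intring (sval_of v)).
  by apply/polyOverP => i; rewrite coef_drop_poly; have /polyOverP := hP; apply.
have hc : (0 <= v c)%E by have /polyOverP/(_ 0) := hP.
have Ez : (map_poly f P).[z] = (map_poly f Q).[z] * z + f c.
  by rewrite EP rmorphD rmorphM /= map_polyX map_polyC /= hornerMXaddC.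
have [c0|c0] := eqVneq (v c) 0%E.
  exists (- c^-1 *: Q).
    apply/polyOverP => i; rewrite coefZ intringE mulNr svN.
    apply: sv_ge0M; last by have /polyOverP := hQ; apply.
    have cn0 : c != 0 by rewrite -(val_eqy v) c0.
    have := Defs.valM v c c^-1; rewrite c0 add0e mulfV // Defs.val1 /= => <-.
    exact: lexx.
  rewrite map_polyZ /= hornerZ.
  have cn0 : c != 0 by rewrite -(val_eqy v) c0.
  have -> : f (- c^-1) * (map_poly f Q).[z] * z - 1 = - f c^-1 * (map_poly f P).[z].
    by rewrite Ez rmorphN !mulNr mulrDr -rmorphM mulVf // rmorph1 opprD mulrA.
  rewrite mulNr svN svM hf.
  have := Defs.valM v c c^-1; rewrite c0 add0e mulfV // Defs.val1 /= => <-.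
  by rewrite add0e.
apply: (IH Q) => //.
- by rewrite size_drop_poly; lia.
- apply/monicP; rewrite lead_coefE size_drop_poly coef_drop_poly.
  by rewrite (_ : (_ + 1)%N = (size P).-1); [exact: (monicP mP) | lia].
- have : (0 < nu ((map_poly f Q).[z] * z)%R)%E.
    rewrite (_ : _ * _ = (map_poly f P).[z] - f c); last by rewrite Ez addrK.
    by apply: sv_gtB => //; rewrite hf lt_neqAle eq_sym c0.
  by rewrite svM hz adde0.
Qed.

End ApproximateInverse.

Section ResidueLift.
Variables (K : fieldType) (v : valuation K) (B : comNzRingType).
Variables (nu1 nu2 : semival B) (f : {rmorphism K -> B}).
Hypothesis hf1 : forall c, nu1 (f c) = v c.
Hypothesis hf2 : forall c, nu2 (f c) = v c.
Hypothesis hv : discrete_valuation v.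
Hypothesis hsep : forall z, (0 <= nu1 z)%E -> exists P : {poly K},
  [/\ P \is monic, P \is a polyOver (intring (sval_of v)),
      (0 < nu1 (map_poly f P).[z])%E & nu1 (map_poly f P^`()).[z] = 0%E].
Hypothesis hroot : forall (p : {poly B}) (z : B), p \is monic ->
  p \is a polyOver (intring nu1) -> p \is a polyOver (intring nu2) ->
  (0 <= nu1 z)%E -> (0 < nu1 p.[z])%E -> nu1 p^`().[z] = 0%E ->
  exists b, [/\ nu1 p.[b] = +oo%E, nu2 p.[b] = +oo%E & (0 < nu1 (b - z)%R)%E].

(** In the application B is a product ring, nu1 and nu2 are the values of the
    two components, and D is the graph of an isometric isomorphism from an
    unramified subring of the completion of K(X) onto a subring of the
    algebraic closure. Such graphs are closed under unions of chains. *)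
Definition coef_ring (D : subring B) := [/\ forall c, f c \in D,
  {in D, nu1 =1 nu2} &
  {in D, forall x, nu1 x = +oo%E \/ exists m : int, nu1 x = (m%:~R)%:E}].

Section Step.
Variables (D : subring B) (z : B).
Hypothesis gD : coef_ring D.
Hypothesis hz : (0 <= nu1 z)%E.

Let I := intpart nu1 D.

Let nu12 x : x \in D -> nu1 x = nu2 x. Proof. by case: gD => _ h _ /h. Qed.

Let ID p : p \is a polyOver I -> p \is a polyOver D.
Proof. by apply: polyOverS => x /intpartP[]. Qed.
Let I1 p : p \is a polyOver I -> p \is a polyOver (intring nu1).
Proof. by apply: polyOverS => x /intpartP[]. Qed.
Let I2 p : p \is a polyOver I -> p \is a polyOver (intring nu2).
Proof. by apply: polyOverS => x /intpartP[/nu12 E]; rewrite !intringE E. Qed.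
Let If (P : {poly K}) : P \is a polyOver (intring (sval_of v)) ->
  map_poly f P \is a polyOver I.
Proof.
move=> /polyOverP hP; apply/polyOverP => i; rewrite coef_map /=; apply/intpartP.
by case: gD => h _ _; split=> //; rewrite hf1; apply: hP.
Qed.

Let cand p := [/\ p \is monic, p \is a polyOver I & (0 < nu1 p.[z])%E].

Let cand_min : exists2 p, cand p & forall q, cand q -> (size p <= size q)%N.
Proof.
have [P [mP hP hPz _]] := hsep hz.
have ex : exists n, `[< exists2 p, cand p & size p = n >].
  exists (size (map_poly f P)); apply/asboolP; exists (map_poly f P) => //.
  by split; rewrite ?monic_map // If.
case: (ex_minnP ex) => n /asboolP[p hp <-] hmin; exists p => // q hq.
by apply: hmin; apply/asboolP; exists q.
Qed.

Section Minimal.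
Variable p : {poly B}.
Hypothesis hp : cand p.
Hypothesis pmin : forall q, cand q -> (size p <= size q)%N.

(** The polynomial p plays the role of the minimal polynomial of the residue
    class of z over the residue field of D: in a shorter polynomial with a
    unit coefficient, the leading coefficient could be made 1 by
    approx_inverse, which would contradict minimality. *)
Let min_coef s : s \is a polyOver I -> (size s < size p)%N -> (0 < nu1 s.[z])%E ->
  forall i, (0 < nu1 s`_i)%E.
Proof.
move: {2}(size s) (leqnn (size s)) => n; elim: n s => [|n IH] s sn hs sp hsz i.
  by rewrite nth_default ?sv0 ?ltry //; apply: leq_trans sn _.
have [s0|s0] := eqVneq s 0; first by rewrite s0 coef0 sv0 ltry.
have s1 : (0 < size s)%N by rewrite size_poly_gt0.
pose c := lead_coef s; have hc : c \in I by have /polyOverP := hs; apply.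
have [Cc c0] := intpartP _ _ _ hc.
pose m := (size s).-1.
have Em : size s = m.+1 by rewrite prednK.
have [cpos|cz] := boolP (0 < nu1 c)%E.
  have hs' : s - c%:P * 'X^m \is a polyOver I.
    by rewrite rpredB // rpredM ?rpredX ?polyOverX // polyOverC.
  have ss' : (size (s - c%:P * 'X^m)%R <= m)%N.
    apply/leq_sizeP => j mj; rewrite coefB coefCM coefXn.
    have [->|jm] := eqVneq j m; first by rewrite mulr1 subrr.
    by rewrite mulr0 subr0 nth_default // Em ltn_neqAle eq_sym jm.
  have [->|im] := eqVneq i m; first by [].
  have := IH _ _ hs' _ _ i.
  rewrite coefB coefCM coefXn (negPf im) mulr0 subr0; apply.
  - by apply: leq_trans ss' _; rewrite -ltnS -Em.
  - by apply: leq_trans sp; rewrite ltnS (leq_trans ss') // leq_pred.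
  - rewrite hornerD hornerN hornerM hornerC hornerXn; apply: sv_gtB => //.
    by apply: sv_Mgt0 => //; apply: svX.
have Ec : nu1 c = 0%E by apply/eqP; rewrite eq_le c0 andbT leNgt.
have [P [mP hP hPc _]] := hsep c0.
have [h hh hhc] := approx_inverse hf1 mP hP Ec hPc.
pose c' := (map_poly f h).[c].
have hc' : c' \in I by apply: rpred_horner => //; apply: If.
(* c' s, with its leading coefficient c' c replaced by 1 *)
pose q := c'%:P * s - (c' * c - 1)%:P * 'X^m.
have hq : q \is a polyOver I.
  by rewrite rpredB // rpredM ?rpredX ?polyOverX // polyOverC // rpredB ?rpredM ?rpred1.
have sq : (size q <= m.+1)%N.
  apply/leq_sizeP => j mj; rewrite coefB !coefCM coefXn nth_default ?Em //.
  by rewrite gtn_eqF // !mulr0 subrr.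
have qm : q`_m = 1.
  by rewrite coefB !coefCM coefXn eqxx mulr1 -lead_coefE -/c opprB addrC subrK.
have sqE : size q = m.+1.
  apply/eqP; rewrite eqn_leq sq ltnNge; apply/negP => /leq_sizeP/(_ m (leqnn _)).
  by rewrite qm => /eqP; rewrite oner_eq0.
suff /pmin : cand q by rewrite sqE -Em leqNgt sp.
split=> //; first by apply/monicP; rewrite lead_coefE sqE.
rewrite hornerD hornerN !hornerM !hornerC hornerXn; apply: sv_gtB.
  by apply: sv_gt0M => //; have [] := intpartP _ _ _ hc'.
by apply: sv_Mgt0 => //; apply: svX.
Qed.

(** The separable relation P satisfied by z over K is a multiple of p up to
    terms of positive value, so that the derivative of p cannot vanish at z
    when the one of P does not. *)
Lemma minimal_separable : nu1 p^`().[z] = 0%E.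
Proof.
have [mp hpI hpz] := hp.
have [P [mP hP hPz hP'z]] := hsep hz.
have [Q [r [hQ hr E sr]]] := monic_div mp hpI (If hP).
have Qz : (0 <= nu1 Q.[z])%E by apply: intpoly_horner (I1 hQ) hz.
have Q'z : (0 <= nu1 Q^`().[z])%E.
  by apply: intpoly_horner hz; apply: polyOver_deriv; apply: I1.
have hrz : (0 < nu1 r.[z])%E.
  rewrite (_ : r = map_poly f P - Q * p); last by rewrite E addrC addKr.
  by rewrite hornerD hornerN hornerM; apply: sv_gtB => //; apply: sv_gt0M.
have rc := min_coef hr sr hrz.
have hr'z : (0 < nu1 r^`().[z])%E.
  apply: sv_gt_horner => // i; rewrite coef_deriv -mulr_natr; apply: sv_Mgt0 => //.
  by rewrite -intringE rpred_nat.
have hp'z : (0 <= nu1 p^`().[z])%E.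
  by apply: intpoly_horner hz; apply: polyOver_deriv; apply: I1.
apply/eqP; rewrite eq_le hp'z andbT leNgt; apply/negP => hlt.
move: hP'z; rewrite -deriv_map E derivD derivM !hornerE => h.
have : (0 < nu1 (Q^`().[z] * p.[z] + Q.[z] * p^`().[z] + r^`().[z])%R)%E.
  by rewrite !sv_gtD // ?sv_gt0M.
by rewrite h ltxx.
Qed.

Section Root.
Variable b : B.
Hypothesis pb1 : nu1 p.[b] = +oo%E.
Hypothesis pb2 : nu2 p.[b] = +oo%E.
Hypothesis bz : (0 < nu1 (b - z)%R)%E.

Let b1 : (0 <= nu1 b)%E.
Proof. by rewrite -(subrK z b); apply: sv_geD => //; apply: ltW. Qed.

Let p_size : (1 < size p)%N.
Proof.
have [mp _ hpz] := hp; rewrite ltnNge; apply/negP => /size1_polyC E.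
move: mp hpz; rewrite E => /monicP; rewrite lead_coefC => ->.
by rewrite hornerC sv1 ltxx.
Qed.

Let b2 : (0 <= nu2 b)%E.
Proof.
have [mp hpI _] := hp; apply: (monic_integral mp (I2 hpI)) => //.
by rewrite pb2 leey.
Qed.

Let min_coef_b s : s \is a polyOver I -> (size s < size p)%N -> (0 < nu1 s.[b])%E ->
  forall i, (0 < nu1 s`_i)%E.
Proof.
move=> hs ss hsb; apply: min_coef => //.
rewrite -(subrK s.[b] s.[z]); apply: sv_gtD => //.
by apply: sv_gt_horner_diff => //; [apply: I1|rewrite svBC].
Qed.

(** For nu1 this is the minimality of p. It carries over to nu2 because the
    residue class of r(b) has an inverse h(r(b)), where h has coefficients in
    V; modulo p, the polynomial h(r) r - 1 has coefficients of positive value. *)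
Let unit_val r i : r \is a polyOver I -> (size r < size p)%N -> nu1 r`_i = 0%E ->
  nu1 r.[b] = 0%E /\ nu2 r.[b] = 0%E.
Proof.
move=> hr sr ri; have [mp hpI _] := hp.
have rb1 : (0 <= nu1 r.[b])%E by apply: intpoly_horner (I1 hr) b1.
have rb2 : (0 <= nu2 r.[b])%E by apply: intpoly_horner (I2 hr) b2.
have E1 : nu1 r.[b] = 0%E.
  apply/eqP; rewrite eq_le rb1 andbT leNgt; apply/negP => h.
  by have := min_coef_b hr sr h i; rewrite ri ltxx.
split=> //.
have [P [mP hP hPc _]] := hsep rb1.
have [h hh hhc] := approx_inverse hf1 mP hP E1 hPc.
pose A := (map_poly f h \Po r) * r - 1.
have hA : A \is a polyOver I.
  by rewrite rpredB ?rpred1 // rpredM // polyOver_comp // If.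
have [Q [s [hQ hs EA ss]]] := monic_div mp hpI hA.
have Ab : A.[b] = (map_poly f h).[r.[b]] * r.[b] - 1.
  by rewrite hornerD hornerN hornerC hornerM horner_comp.
have sb : (0 < nu1 s.[b])%E.
  rewrite (_ : s = A - Q * p); last by rewrite EA addrC addKr.
  rewrite hornerD hornerN hornerM; apply: sv_gtB; first by rewrite Ab.
  by rewrite sv_My // ltry.
have sc := min_coef_b hs ss sb.
have Ab2 : (0 < nu2 A.[b])%E.
  rewrite EA hornerD hornerM; apply: sv_gtD; first by rewrite sv_My ?ltry.
  apply: sv_gt_horner => // j; rewrite -nu12 //.
  by have /polyOverP/(_ j)/intpartP[] := hs.
apply/eqP; rewrite eq_le rb2 andbT leNgt; apply/negP => hlt.
have : (0 < nu2 (1%R : B))%E; last by rewrite sv1 ltxx.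
rewrite (_ : 1 = (map_poly f h).[r.[b]] * r.[b] - A.[b]); last by rewrite Ab; ring.
apply: sv_gtB => //; apply: sv_gt0M => //.
by apply: intpoly_horner => //; apply: I2; apply: If.
Qed.

Let val_short r : r \is a polyOver D -> (size r < size p)%N ->
  nu1 r.[b] = nu2 r.[b] /\
  (nu1 r.[b] = +oo%E \/ exists m : int, nu1 r.[b] = (m%:~R)%:E).
Proof.
move=> hr sr; have [gf _ gint] := gD.
have Cr i : r`_i \in D by have /polyOverP := hr; apply.
have [all_y|] := pselect (forall i, nu1 r`_i = +oo%E).
  have E1 : nu1 r.[b] = +oo%E.
    by apply/eqP; rewrite -leye_eq; apply: sv_ge_horner => // i; rewrite all_y.
  have E2 : nu2 r.[b] = +oo%E.
    by apply/eqP; rewrite -leye_eq; apply: sv_ge_horner => // i; rewrite -nu12 ?all_y.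
  by rewrite E1 E2; split=> //; left.
move=> /existsNP[i0 hi0].
have i0s : (i0 < size r)%N.
  by rewrite ltnNge; apply/negP => /(nth_default 0) E; apply: hi0; rewrite E sv0.
case: (@arg_minP _ _ _ (Ordinal i0s) xpredT (fun i => nu1 r`_i) isT) => i _ imin.
have [E|[m Em]] := gint _ (Cr i).
  exfalso; apply: hi0; apply/eqP; rewrite -leye_eq -E.
  exact: (imin (Ordinal i0s)).
have [c c0 hc] : exists2 c, c != 0 & v c = (- m%:~R)%:E.
  by apply/(hv (- m%:~R)); rewrite rpredN intr_int.
pose r' := (f c)%:P * r.
have hr' : r' \is a polyOver I.
  apply/polyOverP => k; rewrite coefCM; apply/intpartP; split.
    by rewrite rpredM.
  rewrite svM hf1 hc; have [ks|ks] := ltnP k (size r); last first.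
    by rewrite nth_default // sv0 addey.
  have := imin (Ordinal ks) isT; rewrite /= Em.
  by case: (nu1 r`_k) => // a; rewrite !lee_fin; lra.
have sr' : (size r' < size p)%N.
  by rewrite /r' mul_polyC; apply: leq_ltn_trans (size_scale_leq _ _) sr.
have [|e1 e2] := @unit_val r' i hr' sr'.
  by rewrite coefCM svM hf1 hc Em -EFinD addNr.
move: e1 e2; rewrite !hornerM !hornerC !svM hf1 hf2 hc => e1 e2.
have F1 : nu1 r.[b] = (m%:~R)%:E.
  move: e1; case: (nu1 r.[b]) => // a; rewrite -EFinD => -[] h.
  by congr (_%:E); lra.
have F2 : nu2 r.[b] = (m%:~R)%:E.
  move: e2; case: (nu2 r.[b]) => // a; rewrite -EFinD => -[] h.
  by congr (_%:E); lra.
by rewrite F1 F2; split=> //; right; exists m.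
Qed.

Let val_any q : q \is a polyOver D -> nu1 q.[b] = nu2 q.[b] /\
  (nu1 q.[b] = +oo%E \/ exists m : int, nu1 q.[b] = (m%:~R)%:E).
Proof.
move=> hq; have [mp hpI _] := hp.
have [Q [r [hQ hr E sr]]] := monic_div mp (ID hpI) hq.
have d x : q.[x] - r.[x] = Q.[x] * p.[x] by rewrite E hornerD hornerM addrK.
have -> : nu1 q.[b] = nu1 r.[b] by apply: sv_congy; rewrite d sv_My.
have -> : nu2 q.[b] = nu2 r.[b] by apply: sv_congy; rewrite d sv_My.
exact: val_short.
Qed.

Definition adjoin_pred : {pred B} :=
  fun x => `[< exists2 q, q \is a polyOver D & x = q.[b] >].

Lemma adjoin_closed : subring_closed adjoin_pred.
Proof.
split=> [|x y /asboolP[q hq ->] /asboolP[r hr ->]|x y /asboolP[q hq ->] /asboolP[r hr ->]];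
  apply/asboolP.
- by exists 1; rewrite ?rpred1 ?hornerC.
- by exists (q - r); rewrite ?rpredB // !hornerE.
- by exists (q * r); rewrite ?rpredM // !hornerE.
Qed.

(** Reducing modulo p and scaling by an element of K reduces all values on
    D[b] to those of short polynomials with a unit coefficient, where
    unit_val applies to both semivaluations. *)
Lemma coef_ring_adjoin : coef_ring (Subring adjoin_closed).
Proof.
have [gf _ _] := gD.
split=> [c|_ /asboolP[q hq ->]|_ /asboolP[q hq ->]].
- by apply/asboolP; exists (f c)%:P; rewrite ?hornerC // polyOverC.
- by have [] := val_any hq.
- by have [] := val_any hq.
Qed.

End Root.
End Minimal.

Lemma coef_ring_step : exists D' : subring B, [/\ coef_ring D',
  {subset D <= D'} & exists2 b : B, b \in D' & (0 < nu1 (b - z)%R)%E].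
Proof.
have [p hp pmin] := cand_min; have [mp hpI hpz] := hp.
have [b [pb1 pb2 bz]] :=
  hroot mp (I1 hpI) (I2 hpI) hz hpz (minimal_separable hp pmin).
exists (Subring (adjoin_closed b)); split.
- exact: (coef_ring_adjoin hp pmin pb1 pb2 bz).
- by move=> c hc; apply/asboolP; exists c%:P; rewrite ?hornerC // polyOverC.
- by exists b => //; apply/asboolP; exists 'X; rewrite ?polyOverX ?hornerX.
Qed.

End Step.

Lemma range_closed : subring_closed (fun x : B => `[< range f x >]).
Proof.
split=> [|x y /asboolP[a _ <-] /asboolP[b _ <-]|x y /asboolP[a _ <-] /asboolP[b _ <-]];
  apply/asboolP.
- by exists 1; rewrite ?rmorph1.
- by exists (a - b); rewrite ?rmorphB.
- by exists (a * b); rewrite ?rmorphM.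
Qed.

Lemma coef_ring_range : coef_ring (Subring range_closed).
Proof.
split=> [c|_ /asboolP[a _ <-]|_ /asboolP[a _ <-]].
- by apply/asboolP; exists c.
- by rewrite hf1 hf2.
rewrite hf1; have [->|a0] := eqVneq a 0; first by left; rewrite Defs.val0.
right; have [q hq] := val_fin v a0.
have /(hv q)/intrP[m Em] : exists2 x, x != 0 & v x = q%:E by exists a.
by exists m; rewrite hq Em.
Qed.

(** Zorn's lemma gives a maximal D, and coef_ring_step cannot enlarge it.
    The empty set is admitted as a candidate because it is the union of the
    empty chain. *)
Theorem coef_ring_exists : exists D : subring B, coef_ring D /\
  forall z, (0 <= nu1 z)%E -> exists2 c, c \in D & (0 < nu1 (z - c)%R)%E.
Proof.
pose good (C : set B) := exists2 D : subring B, coef_ring D & forall x, C x <-> x \in D.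
have [|C [hC maxC]] := @Zorn_bigcup B (fun C => C = set0 \/ good C).
  move=> F FP Ftot.
  have [[C0 FC0 [D0 gD0 CD0]]|nogood] := pselect (exists2 C, F C & good C); last first.
    left; apply/seteqP; split=> // x [X FX Xx]; have [X0|gX] := FP _ FX.
      by rewrite X0 in Xx.
    by exfalso; apply: nogood; exists X.
  pose U := (\bigcup_(X in F) X)%classic.
  have both x y : U x -> U y -> exists2 D : subring B, coef_ring D &
      [/\ x \in D, y \in D & forall z, z \in D -> U z].
    move=> [X FX Xx] [Y FY Yy].
    have [Z FZ [Zx Zy]] : exists2 Z, F Z & Z x /\ Z y.
      have [XY|YX] := Ftot _ _ FX FY.
        by exists Y => //; split=> //; apply: XY.
      by exists X => //; split=> //; apply: YX.
    have [Z0|[D gD ZD]] := FP _ FZ; first by rewrite Z0 in Zx.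
    exists D => //; split; [exact/ZD|exact/ZD|].
    by move=> z /ZD Zz; exists Z.
  have U_closed : subring_closed (fun x : B => `[< U x >]).
    split=> [|x y /asboolP hx /asboolP hy|x y /asboolP hx /asboolP hy]; apply/asboolP.
    - by exists C0 => //; apply/CD0; rewrite rpred1.
    - by have [D _ [? ? h]] := both x y hx hy; apply: h; rewrite rpredB.
    - by have [D _ [? ? h]] := both x y hx hy; apply: h; rewrite rpredM.
  right; exists (Subring U_closed); last by move=> x; split=> /asboolP.
  split=> [c|x /asboolP hx|x /asboolP hx].
  - by apply/asboolP; exists C0 => //; apply/CD0; have [] := gD0.
  - by have [D [_ h _] [? _ _]] := both x x hx hx; apply: h.
  - by have [D [_ _ h] [? _ _]] := both x x hx hx; apply: h.
have [D gD CD] : good C.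
  case: hC => // C0; exfalso; apply: (maxC (range f)).
    by rewrite C0; split=> // /(_ (f 0)) []; exists 0.
  right; exists (Subring range_closed); first exact: coef_ring_range.
  by move=> x; split=> /asboolP.
exists D; split=> // z hz.
have [D' [gD' DD' [b D'b bz]]] := coef_ring_step gD hz.
exists b; last by rewrite svBC.
apply: contrapT => nDb; apply: (maxC (fun x => x \in D')).
  split=> [x /CD /DD'//|/(_ b D'b) /CD //].
by right; exists D'.
Qed.

End ResidueLift.

(** * Expansions in a uniformizer *)

(** When the coefficients have integral values and b has value 1/e, the
    terms of degree less than e have values that differ modulo 1, so none
    cancel. *)
Section ShortPolynomials.
Variables (R : comNzRingType) (nu : semival R) (S : {pred R}) (e : nat) (b : R).
Hypothesis e0 : (0 < e)%N.
Hypothesis hS : {in S, forall x, nu x = +oo%E \/ exists m : int, nu x = (m%:~R)%:E}.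
Hypothesis hb : nu b = (e%:R^-1)%:E.
Variable p : {poly R}.
Hypotheses (hp : forall i, p`_i \in S) (sp : (size p <= e)%N).

Lemma short_poly_dominant : exists2 i, (i < e)%N &
  nu p.[b] = (nu p`_i + (i%:R / e%:R)%:E)%E /\
  forall j, (j < e)%N -> (nu p.[b] <= nu p`_j + (j%:R / e%:R)%:E)%E.
Proof.
have eR : e%:R != 0 :> rat by rewrite pnatr_eq0 -lt0n.
have Ex i : nu (p`_i * b ^+ i) = (nu p`_i + (i%:R / e%:R)%:E)%E.
  by rewrite svM (svXfin _ hb) mulrC.
have [|i ie [E m]] := @sv_sum_dominant _ nu (fun i => p`_i * b ^+ i) e _ e0.
  move=> i j /andP[ij je]; rewrite !Ex.
  have [->//|[m ->]] := hS (hp i); have [->//|[n ->]] := hS (hp j).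
  rewrite -!EFinD => -[] E; exfalso.
  have : m%:~R * e%:R + i%:R = n%:~R * e%:R + j%:R :> rat.
    have := congr1 (fun a => a * e%:R) E.
    by rewrite !mulrDl !divfK.
  rewrite !pmulrn -!intrM -!intrD.
  move/intr_inj => {}E.
  have [mn|nm] := lerP m n.
    have : m * e%:Z <= n * e%:Z by rewrite ler_wpM2r.
    lia.
  have : (n + 1) * e%:Z <= m * e%:Z by rewrite ler_wpM2r // lezD1.
  rewrite mulrDl mul1r; lia.
exists i => //; rewrite (horner_coef_wide _ sp) E Ex; split=> // j je.
by rewrite -Ex -E; move: (m j je); rewrite -E Ex.
Qed.

Lemma short_poly_geP q : (q <= nu p.[b])%E <->
  forall i, (i < e)%N -> (q <= nu p`_i + (i%:R / e%:R)%:E)%E.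
Proof.
have [i ie [E m]] := short_poly_dominant; split=> [h j je|]; last by rewrite E; apply.
exact: le_trans (m j je).
Qed.

Lemma short_poly_val : nu p.[b] = +oo%E \/ exists m : int, nu p.[b] = (m%:~R / e%:R)%:E.
Proof.
have [i ie [-> _]] := short_poly_dominant.
have [->|[m ->]] := hS (hp i); first by left.
have eR : e%:R != 0 :> rat by rewrite pnatr_eq0 -lt0n.
right; exists (m * e%:Z + i%:Z); rewrite -EFinD; congr (_%:E).
by rewrite intrD intrM -!pmulrn mulrDl mulfK.
Qed.

End ShortPolynomials.

Section Uniformizer.
Variables (K : fieldType) (v : valuation K) (B : comNzRingType).
Variables (nu1 nu2 : semival B) (f : {rmorphism K -> B}) (D : subring B).
Variables (t : K) (e : nat) (pi pi' : B).
Hypothesis hf1 : forall c, nu1 (f c) = v c.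
Hypothesis ht : v t = 1%E.
Hypothesis gD : coef_ring nu1 nu2 f D.
Hypothesis hres : forall z, (0 <= nu1 z)%E -> exists2 c, c \in D & (0 < nu1 (z - c)%R)%E.
Hypothesis e0 : (0 < e)%N.
Hypothesis hval : forall z, nu1 z = +oo%E \/ exists m : int, nu1 z = (m%:~R / e%:R)%:E.
Hypothesis hpi : nu1 pi = (e%:R^-1)%:E.
Hypothesis piK : pi * pi' = 1.
Hypothesis hsplit : forall (p : {poly B}) (n : nat) (y : B), p \is monic ->
  size p = n.+2 -> exists y', [/\ nu2 p.[y'] = +oo%E, nu1 (y' - y) = +oo%E &
    forall c : rat, (c%:E <= nu2 p.[y])%E -> ((c / n.+1%:R)%:E <= nu2 (y' - y)%R)%E].

Let I := intpart nu1 D.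
Let nu12 x : x \in D -> nu1 x = nu2 x. Proof. by case: gD => _ h _ /h. Qed.
Let hD1 : {in D, forall x, nu1 x = +oo%E \/ exists m : int, nu1 x = (m%:~R)%:E}.
Proof. by case: gD. Qed.
Let hD2 : {in D, forall x, nu2 x = +oo%E \/ exists m : int, nu2 x = (m%:~R)%:E}.
Proof. by move=> x hx; rewrite -nu12 //; apply: hD1. Qed.
Let fD c : f c \in D. Proof. by case: gD. Qed.
Let ID p : p \is a polyOver I -> p \is a polyOver D.
Proof. by apply: polyOverS => x /intpartP[]. Qed.
Let I1 p : p \is a polyOver I -> p \is a polyOver (intring nu1).
Proof. by apply: polyOverS => x /intpartP[]. Qed.
Let I2 p : p \is a polyOver I -> p \is a polyOver (intring nu2).
Proof. by apply: polyOverS => x /intpartP[/nu12 E]; rewrite !intringE E. Qed.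
Let eR : 0 < e%:R :> rat. Proof. by rewrite ltr0n. Qed.

Let pos_ge z : (0 < nu1 z)%E -> ((e%:R^-1)%:E <= nu1 z)%E.
Proof.
have [->|[m ->]] := hval z; first by rewrite leey.
rewrite lte_fin lee_fin => h.
have m0 : 0 < m by move: h; rewrite pmulr_lgt0 ?invr_gt0 // ltr0z.
by rewrite ler_pdivlMr // mulVf ?lt0r_neq0 // ler1z; lia.
Qed.

Let tX m : nu1 (f (t ^+ m)) = (m%:R)%:E.
Proof. by rewrite rmorphXn (@svXfin _ _ _ 1) ?hf1 // mul1r. Qed.

Let tV m : nu1 (f (t ^- m)) = (- m%:R)%:E.
Proof.
have t0 : t != 0 by rewrite -(val_eqy v) ht.
have := svM nu1 (f (t ^+ m)) (f (t ^- m)).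
rewrite -rmorphM mulfV ?expf_neq0 // rmorph1 sv1 tX.
by case: (nu1 _) => // a; rewrite -EFinD => -[] h; congr (_%:E); lra.
Qed.

Let nu_pi' : nu1 pi' = (- e%:R^-1)%:E.
Proof.
have := svM nu1 pi pi'; rewrite piK sv1 hpi.
by case: (nu1 _) => // a; rewrite -EFinD => -[] h; congr (_%:E); lra.
Qed.

Let digits N z : (0 <= nu1 z)%E -> exists p, [/\ p \is a polyOver I, (size p <= N)%N &
  ((N%:R / e%:R)%:E <= nu1 (z - p.[pi])%R)%E].
Proof.
elim: N z => [|N IH] z hz.
  by exists 0; rewrite rpred0 size_poly0 horner0 subr0 mul0r.
have [c hc hzc] := hres hz.
have hcI : c \in I.
  apply/intpartP; split=> //; rewrite -(subrK z c) addrC; apply: sv_geD => //.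
  by rewrite svBC ltW.
have [|p [hp sp hpz]] := IH ((z - c) * pi').
  rewrite svM nu_pi'; have := pos_ge hzc.
  by case: (nu1 _) => // a; rewrite !lee_fin subr_ge0.
exists (p * 'X + c%:P); split.
- by rewrite rpredD ?rpredM ?polyOverX // polyOverC.
- rewrite size_MXaddC; case: ifP => // _; rewrite ltnS.
- rewrite hornerMXaddC.
  have -> : z - (p.[pi] * pi + c) = ((z - c) * pi' - p.[pi]) * pi.
    by rewrite mulrBl -mulrA [pi' * _]mulrC piK mulr1; ring.
  rewrite svM hpi; apply: le_trans (leeD2r _ hpz).
  by rewrite -EFinD lee_fin -natr1 mulrDl mul1r.
Qed.

(** Subtracting representatives of residue classes in D gives e digits in
    the uniformizer pi; the remainder is divisible by t, of value 1, and the
    process repeats with coefficients scaled by powers of t. *)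
Lemma short_expansion z m : (0 <= nu1 z)%E -> exists p, [/\ p \is a polyOver I,
  (size p <= e)%N & ((m%:R)%:E <= nu1 (z - p.[pi])%R)%E].
Proof.
move=> hz; elim: m => [|m [p [hp sp hpz]]].
  by exists 0; rewrite rpred0 size_poly0 horner0 subr0.
have [|q [hq sq hqz]] := @digits e (f (t ^- m) * (z - p.[pi])).
  rewrite svM tV; move: hpz.
  by case: (nu1 _) => // a; rewrite !lee_fin; lra.
have tmI : f (t ^+ m) \in I by apply/intpartP; rewrite fD tX lee_fin ler0n.
exists (p + (f (t ^+ m))%:P * q); split.
- by rewrite rpredD ?rpredM // polyOverC.
- apply: leq_trans (size_polyD _ _) _; rewrite geq_max sp.
  by rewrite mul_polyC (leq_trans (size_scale_leq _ _)).
have t0 : t != 0 by rewrite -(val_eqy v) ht.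
rewrite hornerD hornerM hornerC.
have -> : z - (p.[pi] + f (t ^+ m) * q.[pi]) =
    f (t ^+ m) * (f (t ^- m) * (z - p.[pi]) - q.[pi]).
  rewrite mulrBr mulrA -rmorphM mulfV ?expf_neq0 // rmorph1 mul1r; ring.
rewrite svM tX -natr1 EFinD leeD //.
by move: hqz; rewrite divff // lt0r_neq0.
Qed.

(** Both sides are the minimum of the same numbers, see short_poly_geP. *)
Let iso p b1 b2 : p \is a polyOver D -> (size p <= e)%N ->
  nu1 b1 = (e%:R^-1)%:E -> nu2 b2 = (e%:R^-1)%:E -> nu1 p.[b1] = nu2 p.[b2].
Proof.
move=> /polyOverP hp sp h1 h2; apply: ereal_eqfP => q.
rewrite (short_poly_geP e0 hD1 h1 hp sp) (short_poly_geP e0 hD2 h2 hp sp).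
by split=> h i ie; move: (h i ie); rewrite nu12.
Qed.

(** For such g the polynomial 'X^e - g is Eisenstein: it is an approximation
    of the minimal polynomial of pi over the unramified part. *)
Let eis g := [/\ g \is a polyOver I, (size g <= e)%N &
  ((2%:R)%:E <= nu1 (pi ^+ e - g.[pi])%R)%E].

Let eis_coef g : eis g -> nu1 g`_0 = 1%E /\ forall i, (1 <= nu1 g`_i)%E.
Proof.
move=> [hg sg hpig].
have hgc i : g`_i \in D by have /polyOverP := ID hg; apply.
have Epi : nu1 (pi ^+ e) = 1%E by rewrite (svXfin _ hpi) mulVf // lt0r_neq0.
have Eg : nu1 g.[pi] = 1%E.
  rewrite -Epi; apply: sv_ltB; rewrite Epi svBC.
  by apply: lt_le_trans hpig; rewrite lte_fin ltr1n.
have ge1 i : (1 <= nu1 g`_i)%E.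
  have [ie|ei] := ltnP i e; last by rewrite nth_default ?sv0 ?leey // (leq_trans sg).
  have /(short_poly_geP e0 hD1 hpi hgc sg)/(_ i ie) : (1 <= nu1 g.[pi])%E by rewrite Eg.
  have [->|[m ->]] := hD1 (hgc i); first by rewrite !leey.
  rewrite -EFinD !lee_fin => h.
  have : i%:R / e%:R < 1 :> rat by rewrite ltr_pdivrMr // mul1r ltr_nat.
  move=> h'; have : 0 < m%:~R :> rat by lra.
  by rewrite ltr0z ler1z; lia.
split=> //.
have [i ie [E _]] := short_poly_dominant e0 hD1 hpi hgc sg.
move: E; rewrite Eg; case: i ie => [|i] ie.
  by rewrite mul0r adde0 => <-.
have := ge1 i.+1; case: (nu1 _) => // a; rewrite lee_fin => a1.
rewrite -EFinD => -[] E; exfalso.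
have : 0 < i.+1%:R / e%:R :> rat by rewrite divr_gt0 // ltr0n.
lra.
Qed.

Let eisP (g : {poly B}) : {poly B} := 'X^e - g.

Let eisP_size g : eis g -> size (eisP g) = e.+1.
Proof. by move=> [_ sg _]; rewrite size_polyDl size_polyXn // size_polyN ltnS. Qed.

Let eisP_monic g : eis g -> eisP g \is monic.
Proof.
move=> [_ sg _]; rewrite monicE lead_coefDl ?lead_coefXn //.
by rewrite size_polyN size_polyXn ltnS.
Qed.

Let eisP_int g : eis g -> eisP g \is a polyOver I.
Proof. by move=> [hg _ _]; rewrite rpredB // rpredX ?polyOverX. Qed.

Let eis_root g w : eis g -> nu2 (eisP g).[w] = +oo%E -> nu2 w = (e%:R^-1)%:E.
Proof.
move=> hg hw; have [g0 g1] := eis_coef hg; have [hgI sg _] := hg.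
have hgc i : g`_i \in D by have /polyOverP := ID hgI; apply.
have w0 : (0 <= nu2 w)%E.
  apply: (monic_integral (eisP_monic hg) (I2 (eisP_int hg))); last by rewrite hw leey.
  by rewrite eisP_size // ltnS.
have Ew : nu2 (w ^+ e) = nu2 g.[w].
  apply: sv_congy; rewrite -hw; congr (nu2 _).
  by rewrite /eisP hornerD hornerN hornerXn.
have gw1 : (1 <= nu2 g.[w])%E.
  by apply: sv_ge_horner => // i; rewrite -nu12.
have wpos : (0 < nu2 w)%E.
  rewrite lt_neqAle w0 andbT; apply/negP => /eqP E.
  by move: gw1; rewrite -Ew (svXfin _ (esym E)) mul0r.
have Egw : nu2 g.[w] = 1%E.
  have E0 : nu2 g`_0 = 1%E by rewrite -nu12.
  rewrite -E0; apply: sv_ltB; rewrite E0.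
  have -> : g.[w] - g`_0 = (drop_poly 1 g).[w] * w.
    have {1}-> : g = drop_poly 1 g * 'X + (g`_0)%:P.
      rewrite -{1}(poly_take_drop 1 g) addrC; congr (_ + _).
      by apply/polyP => -[|i]; rewrite coef_take_poly coefC.
    by rewrite hornerMXaddC addrK.
  rewrite svM -[1%E]adde0; apply: lee_ltD => //.
  by apply: sv_ge_horner => // i; rewrite coef_drop_poly -nu12.
move: Ew; rewrite Egw; have [E|[a Ea]] := sv_cases nu2 w.
  have -> : w ^+ e = w * w ^+ e.-1 by rewrite -exprS prednK.
  by rewrite mulrC sv_My.
by rewrite (svXfin _ Ea) Ea => -[] E; congr (_%:E); rewrite -[a](mulfK (lt0r_neq0 eR)) E mul1r.
Qed.

(** Each better approximation of the Eisenstein polynomial has a small value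
    at the previous root, hence a root close to it. The degree e is fixed, so
    the loss of precision in passing to a single root is a bounded factor. *)
Let tower : exists (g : nat -> {poly B}) (w : nat -> B), [/\
  forall m, eis (g m),
  forall m, ((m.+2%:R)%:E <= nu1 (pi ^+ e - (g m).[pi])%R)%E,
  forall m, nu2 (eisP (g m)).[w m] = +oo%E,
  forall m, nu1 (w m - pi) = +oo%E &
  forall m, ((m.+2%:R / e%:R)%:E <= nu2 (w m.+1 - w m)%R)%E].
Proof.
have epi : (0 <= nu1 (pi ^+ e)%R)%E.
  by rewrite (svXfin _ hpi) lee_fin mulVf ?lt0r_neq0.
have /choice[g hg] : forall m, exists p, [/\ p \is a polyOver I, (size p <= e)%N &
    ((m.+2%:R)%:E <= nu1 (pi ^+ e - p.[pi])%R)%E].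
  by move=> m; apply: short_expansion.
have eg m : eis (g m).
  have [h1 h2 h3] := hg m; split=> //; apply: le_trans h3.
  by rewrite lee_fin ler_nat.
have /choice[rt hrt] : forall my : nat * B, exists y',
    [/\ nu2 (eisP (g my.1)).[y'] = +oo%E, nu1 (y' - my.2) = +oo%E &
    forall c : rat, (c%:E <= nu2 (eisP (g my.1)).[my.2])%E ->
      ((c / e%:R)%:E <= nu2 (y' - my.2)%R)%E].
  move=> [m y] /=; have [] := @hsplit (eisP (g m)) e.-1 y (eisP_monic (eg m)).
    by rewrite eisP_size // prednK.
  by rewrite prednK // => y' hy'; exists y'.
pose w := nat_rect (fun _ => B) (rt (0%N, pi)) (fun m y => rt (m.+1, y)).
have wr m : nu2 (eisP (g m)).[w m] = +oo%E.
  by case: m => [|m] /=; [have [] := hrt (0%N, pi)|have [] := hrt (m.+1, w m)].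
have wpi m : nu1 (w m - pi) = +oo%E.
  elim: m => [|m IH] /=; first by have [] := hrt (0%N, pi).
  apply/eqP; rewrite -leye_eq; apply: (@sv_geB_trans _ _ _ _ (w m)); rewrite ?IH //.
  by have [_ -> _] := hrt (m.+1, w m).
exists g, w; split=> // m; first by have [] := hg m.
have [_ _ /=] := hrt (m.+1, w m); apply.
have -> : (eisP (g m.+1)).[w m] = (eisP (g m)).[w m] - (g m.+1 - g m).[w m].
  by rewrite /eisP !hornerE; ring.
apply: sv_geB; first by rewrite wr leey.
have [hg1 sg1 hp1] := hg m; have [hg2 sg2 hp2] := hg m.+1.
rewrite -(@iso (g m.+1 - g m) pi) //.
- rewrite hornerD hornerN.
  have -> : (g m.+1).[pi] - (g m).[pi] =
    (pi ^+ e - (g m).[pi]) - (pi ^+ e - (g m.+1).[pi]) by ring.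
  by apply: sv_geB => //; apply: le_trans hp2; rewrite lee_fin ler_nat.
- by rewrite rpredB // ID.
- by apply: leq_trans (size_polyD _ _) _; rewrite size_polyN geq_max sg1 sg2.
- exact: eis_root (eg m) (wr m).
Qed.

(** Take a short expansion of x of precision m in pi and substitute the
    root w m for pi. The values of polynomials at x and at s m agree up to
    precision m because pi and w m satisfy the same Eisenstein equation up to
    that precision, and then isometry holds on short polynomials. *)
Theorem uniformizer_approx x : (0 <= nu1 x)%E -> exists s : nat -> B, [/\
  forall m, ((m%:R / e%:R)%:E <= nu2 (s m.+1 - s m)%R)%E,
  forall m (P : {poly K}), nu2 (map_poly f P).[s m] = +oo%E \/
    exists k : int, nu2 (map_poly f P).[s m] = (k%:~R / e%:R)%:E &
  forall (P : {poly K}) (a : rat) m, P \is a polyOver (intring (sval_of v)) ->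
    nu1 (map_poly f P).[x] = a%:E -> a < m%:R -> nu2 (map_poly f P).[s m] = a%:E].
Proof.
move=> hx; have [g [w [eg gm wr wpi ww]]] := tower.
have /choice[h hh] : forall m, exists p, [/\ p \is a polyOver I, (size p <= e)%N &
    ((m%:R)%:E <= nu1 (x - p.[pi])%R)%E].
  by move=> m; apply: short_expansion.
have wval m : nu2 (w m) = (e%:R^-1)%:E by apply: eis_root (eg m) (wr m).
have wint m : (0 <= nu2 (w m))%E by rewrite wval lee_fin invr_ge0 ltW.
have piint : (0 <= nu1 pi)%E by rewrite hpi lee_fin invr_ge0 ltW.
exists (fun m => (h m).[w m]); split=> [m|m P|P a m hP Ea am].
- have [h1 s1 x1] := hh m; have [h2 s2 x2] := hh m.+1.
  have -> : (h m.+1).[w m.+1] - (h m).[w m] =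
     (h m.+1 - h m).[w m.+1] + ((h m).[w m.+1] - (h m).[w m]).
    by rewrite hornerD hornerN; ring.
  apply: sv_geD.
    rewrite -(@iso (h m.+1 - h m) pi) //; last first.
    - by apply: leq_trans (size_polyD _ _) _; rewrite size_polyN geq_max s1 s2.
    - by rewrite rpredB // ID.
    apply: (@le_trans _ _ m%:R%:E).
      by rewrite lee_fin ler_pdivrMr // ler_peMr ?ler1n.
    rewrite hornerD hornerN.
    have -> : (h m.+1).[pi] - (h m).[pi] = (x - (h m).[pi]) - (x - (h m.+1).[pi]) by ring.
    by apply: sv_geB => //; apply: le_trans x2; rewrite lee_fin ler_nat.
  apply: sv_ge_horner_diff => //; first exact: I2.
  apply: le_trans (ww m); rewrite lee_fin ler_pM2r ?invr_gt0 // ler_nat.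
  by rewrite -addn2 leq_addr.
- have [hm sm _] := hh m.
  have hq : (map_poly f P \Po h m) \is a polyOver D.
    apply: polyOver_comp (ID hm); apply/polyOverP => i; rewrite coef_map; exact: fD.
  have [Q [r [hQ hr E sr]]] := monic_div (eisP_monic (eg m)) (ID (eisP_int (eg m))) hq.
  have -> : nu2 (map_poly f P).[(h m).[w m]] = nu2 r.[w m].
    by apply: sv_congy; rewrite -horner_comp E hornerD addrK hornerM sv_My.
  apply: (short_poly_val e0 hD2) => //.
    by move=> i; have /polyOverP := hr; apply.
  by rewrite -ltnS -(eisP_size (eg m)).
- have [hm sm xm] := hh m.
  have hPI : map_poly f P \is a polyOver I.
    apply/polyOverP => i; rewrite coef_map; apply/intpartP; split; first exact: fD.
    by rewrite hf1; have /polyOverP := hP; apply.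
  have hq : (map_poly f P \Po h m) \is a polyOver I by rewrite polyOver_comp.
  have [Q [r [hQ hr E sr]]] := monic_div (eisP_monic (eg m)) (eisP_int (eg m)) hq.
  have -> : nu2 (map_poly f P).[(h m).[w m]] = nu2 r.[w m].
    by apply: sv_congy; rewrite -horner_comp E hornerD addrK hornerM sv_My.
  rewrite -(@iso r pi) //; last by rewrite -ltnS -(eisP_size (eg m)).
    rewrite -Ea; apply: sv_ltB; rewrite Ea svBC.
    apply: (@lt_le_trans _ _ m%:R%:E); first by rewrite lte_fin.
    rewrite -(subrK (map_poly f P \Po h m).[pi] (map_poly f P).[x]) -addrA.
    apply: sv_geD.
      rewrite horner_comp; apply: sv_ge_horner_diff => //; first exact: I1.
      by apply: intpoly_horner (I1 hm) piint.
    rewrite E hornerD addrK hornerM; apply: sv_ge0M.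
      by apply: intpoly_horner (I1 hQ) piint.
    rewrite /eisP hornerD hornerN hornerXn; apply: le_trans (gm m).
    by rewrite lee_fin ler_nat -addn2 leq_addr.
  exact: ID.
Qed.

End Uniformizer.

(** * Roots over an algebraically closed valued field *)

Lemma monic_split (L : fieldType) (p : {poly L}) : GRing.closed_field_axiom L ->
  p \is monic -> exists2 rs : seq L, size p = (size rs).+1 &
    p = \prod_(r <- rs) ('X - r%:P).
Proof.
move=> hL; move: {2}(size p) (leqnn (size p)) => n.
elim: n p => [|n IH] p sp mp.
  by move: sp; rewrite leqNgt size_poly_gt0 monic_neq0.
have [/eqP s1|s1] := boolP (size p == 1%N).
  exists [::]; rewrite ?s1 // big_nil; have [c c0 Ep] := size_poly1P p (introT eqP s1).
  by move: mp; rewrite Ep => /monicP; rewrite lead_coefC => ->.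
have s0 : (0 < (size p).-1)%N.
  by have := size_poly_gt0 p; rewrite monic_neq0 //; move: s1; lia.
have [x hx] := hL (size p).-1 (fun i => - p`_i) s0.
have rx : root p x.
  apply/rootP; rewrite horner_coef -(prednK (n := size p)); last by move: s0; lia.
  rewrite big_ord_recr /= -lead_coefE (monicP mp) mul1r hx -big_split /=.
  by rewrite big1 // => i _; rewrite mulNr addrN.
have [q Eq] := factor_theorem p x rx.
have mq : q \is monic by move: mp; rewrite Eq monicMr // monicXsubC.
have sq : size p = (size q).+1.
  by rewrite Eq size_Mmonic ?monic_neq0 ?monicXsubC // size_XsubC addn2.
have [|rs srs Ers] := IH q _ mq; first by rewrite -ltnS -sq.
exists (x :: rs); first by rewrite /= -srs.
by rewrite big_cons -Ers mulrC.
Qed.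

(** The value of p at y is the sum of the n + 1 values of its differences
    with the roots, so the largest of these is at least the mean. *)
Lemma nearest_root (L : fieldType) (v : valuation L) (p : {poly L}) (n : nat) (y : L) :
  GRing.closed_field_axiom L -> p \is monic -> size p = n.+2 ->
  exists2 r, root p r & forall c : rat, (c%:E <= v p.[y])%E ->
    ((c / n.+1%:R)%:E <= v (r - y)%R)%E.
Proof.
move=> hL mp sp; have [rs srs Ers] := monic_split hL mp.
have {}srs : size rs = n.+1 by move: srs; rewrite sp => -[].
have [r rin rmax] : exists2 r, r \in rs &
    forall r', r' \in rs -> (v (y - r')%R <= v (y - r)%R)%E.
  elim: rs {Ers} n srs {sp} => // a [|a' rs] IH n.
    by exists a => [|r']; rewrite inE ?eqxx // => /eqP->.
  case: n => // n [e]; have [r rin rmax] := IH n (congr1 S e).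
  have [ar|ra] := leP (v (y - a)%R) (v (y - r)%R).
    exists r; first by rewrite inE rin orbT.
    by move=> r'; rewrite inE => /predU1P[->//|/rmax].
  exists a; first by rewrite inE eqxx.
  by move=> r'; rewrite inE => /predU1P[->//|/rmax h]; apply: le_trans h (ltW ra).
exists r; first by rewrite Ers root_prod_XsubC.
move=> c hc; have -> : v (r - y) = v (y - r) by exact: (svBC (sval_of v)).
have [E|[q E]] := sv_cases (sval_of v) (y - r); rewrite /= in E.
  by rewrite E leey.
rewrite E lee_fin ler_pdivrMr ?ltr0n // -srs.
rewrite -lee_fin; apply: le_trans hc _; rewrite Ers.
have {}rmax r' : r' \in rs -> (v (y - r')%R <= q%:E)%E by rewrite -E; apply: rmax.
elim: rs {srs Ers rin} rmax => [|a rs IH] rmax.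
  by rewrite big_nil hornerC Defs.val1 mulr0.
rewrite big_cons hornerM Defs.valM /= -natr1 mulrDr mulr1 addrC EFinD leeD //; last first.
  by rewrite hornerXsubC rmax // inE eqxx.
by apply: IH => r' h; apply: rmax; rewrite inE h orbT.
Qed.

Section ProductRing.
Variables (R S : comNzRingType) (mu : semival R) (nu : semival S).

Definition sv_fst : semival (R * S)%type :=
  @Semival (R * S)%type (fun x => mu x.1) (sv0 mu) (sv1 mu)
    (fun x y => svM mu x.1 y.1) (fun x y => svD mu x.1 y.1).

Definition sv_snd : semival (R * S)%type :=
  @Semival (R * S)%type (fun x => nu x.2) (sv0 nu) (sv1 nu)
    (fun x y => svM nu x.2 y.2) (fun x y => svD nu x.2 y.2).

Lemma horner_fst (p : {poly (R * S)%type}) x : p.[x].1 = (map_poly fst p).[x.1].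
Proof. by rewrite horner_map. Qed.

Lemma horner_snd (p : {poly (R * S)%type}) x : p.[x].2 = (map_poly snd p).[x.2].
Proof. by rewrite horner_map. Qed.

Variables (K : fieldType) (f : {rmorphism K -> R}) (g : {rmorphism K -> S}).

Definition pair_morph (c : K) : (R * S)%type := (f c, g c).

Fact pair_morph_zmod : zmod_morphism pair_morph.
Proof. by move=> a b; rewrite /pair_morph !rmorphB. Qed.
Fact pair_morph_monoid : monoid_morphism pair_morph.
Proof. by split=> [|a b]; rewrite /pair_morph ?rmorph1 ?rmorphM. Qed.

HB.instance Definition _ :=
  GRing.isZmodMorphism.Build K (R * S)%type pair_morph pair_morph_zmod.
HB.instance Definition _ :=
  GRing.isMonoidMorphism.Build K (R * S)%type pair_morph pair_morph_monoid.

Lemma horner_pair_fst (P : {poly K}) x :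
  (map_poly pair_morph P).[x].1 = (map_poly f P).[x.1].
Proof. by rewrite horner_fst -map_poly_comp. Qed.

Lemma horner_pair_snd (P : {poly K}) x :
  (map_poly pair_morph P).[x].2 = (map_poly g P).[x.2].
Proof. by rewrite horner_snd -map_poly_comp. Qed.

End ProductRing.

Section ProductRoots.
Variables (F L : fieldType) (w : valuation F) (vL : valuation L).
Hypothesis hL : GRing.closed_field_axiom L.
Let B := (cauchy_seq w * L)%type.
Let nu1 : semival B := sv_fst L (cs_semival w).
Let nu2 : semival B := sv_snd (cauchy_seq w) (sval_of vL).

(** The first component is the root given by Hensel's lemma; the second may
    be any root, since a residue class in Kbar is not prescribed. *)
Lemma product_hensel (p : {poly B}) (z : B) : p \is monic ->
  p \is a polyOver (intring nu1) ->
  (0 <= nu1 z)%E -> (0 < nu1 p.[z])%E -> nu1 p^`().[z] = 0%E ->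
  exists b, [/\ nu1 p.[b] = +oo%E, nu2 p.[b] = +oo%E & (0 < nu1 (b - z)%R)%E].
Proof.
move=> mp hp1 hz hpz hp'z.
have hp : map_poly fst p \is a polyOver (intring (cs_semival w)).
  by apply/polyOverP => i; rewrite coef_map; have /polyOverP := hp1; apply.
have [||x hx xz] := cs_hensel hp hz.
- by rewrite -horner_fst.
- by rewrite deriv_map -horner_fst.
have mp2 : map_poly snd p \is monic by apply: monic_map.
have [rs srs Ers] := monic_split hL mp2.
case: rs srs Ers => [|r rs] srs Ers.
  exfalso; have E : p = 1.
    have /size1_polyC E : (size p <= 1)%N.
      by move: srs; rewrite size_map_poly_id0 ?(monicP mp) ?oner_eq0 // => ->.
    by move: mp; rewrite E => /monicP; rewrite lead_coefC => ->.
  by move: hpz; rewrite E hornerC sv1 ltxx.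
exists (x, r); split=> //; first by rewrite /= horner_fst.
by rewrite /= horner_snd Ers horner_prod big_cons hornerXsubC subrr mul0r Defs.val0.
Qed.

(** Only the second component moves: a root in the algebraically closed
    field, close to the given approximate root. *)
Lemma product_nearest_root (p : {poly B}) (n : nat) (y : B) : p \is monic ->
  size p = n.+2 -> exists y', [/\ nu2 p.[y'] = +oo%E, nu1 (y' - y) = +oo%E &
    forall c : rat, (c%:E <= nu2 p.[y])%E -> ((c / n.+1%:R)%:E <= nu2 (y' - y)%R)%E].
Proof.
move=> mp sp; have mp2 : map_poly snd p \is monic by apply: monic_map.
have sp2 : size (map_poly snd p) = n.+2.
  by rewrite size_map_poly_id0 ?(monicP mp) ?oner_eq0.
have [r /rootP rr hr] := nearest_root vL y.2 hL mp2 sp2.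
exists (y.1, r); split.
- by rewrite /= horner_snd rr Defs.val0.
- by rewrite /= subrr limval0.
- by move=> c; rewrite /= horner_snd => /hr.
Qed.

End ProductRoots.

(** * Counting cosets of the integers *)

Section CosetCount.
Variables (G H : set rat).
Hypothesis HZ : forall q, H q <-> q \is a Num.int.

Let coset (q : rat) : set rat := [set q + h | h in H]%classic.

Let coset_eq q r : coset q = coset r <-> q - r \is a Num.int.
Proof.
split=> [E|qr].
  have : coset q q by exists 0; rewrite ?addr0 //; apply/HZ.
  by rewrite E => -[h /HZ hh <-]; rewrite addrAC subrr add0r.
apply/seteqP; split=> _ [h /HZ hh <-].
  by exists (q - r + h); [apply/HZ; rewrite rpredD|rewrite addrA subrKC].
exists (h - (q - r)); [by apply/HZ; rewrite rpredB|ring].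
Qed.

Let cosets := [set coset g | g in G]%classic.

Lemma group_indexE : group_index G H = #|` fset_set cosets |%fset.
Proof. by []. Qed.

Variable N : nat.
Hypothesis N0 : (0 < N)%N.
Hypothesis hN : forall q, G q -> q * N%:R \is a Num.int.

Let cosets_sub C : cosets C -> C \in [seq coset (i%:R / N%:R) | i <- iota 0 N].
Proof.
move=> [q Gq <-]; have /intrP[k Ek] := hN Gq.
have NR : N%:R != 0 :> rat by rewrite pnatr_eq0 -lt0n.
pose i := `|(k %% N)%Z|%N.
have Ei : (i%:Z = (k %% N)%Z) by rewrite /i gez0_abs // modz_ge0 // eqz_nat -lt0n.
apply/mapP; exists i.
  by rewrite mem_iota /= add0n -ltz_nat Ei ltz_pmod.
apply/coset_eq; apply/intrP; exists (k %/ N)%Z.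
rewrite -[q](mulfK NR) Ek -mulrBl.
have -> : i%:R = ((k %% N)%Z)%:~R :> rat by rewrite -Ei.
by rewrite -intrB {1}(divz_eq k N) addrK intrM mulfK.
Qed.

Let cosets_fin : finite_set cosets.
Proof.
apply: (@sub_finite_set _ _ [set` [seq coset (i%:R / N%:R) | i <- iota 0 N]]%classic).
  by move=> C /cosets_sub.
exact: finite_seq.
Qed.

(** The hypothesis puts the cosets of H among those of the fractions i / N
    with i < N. *)
Lemma group_index_le : (group_index G H <= N)%N.
Proof.
rewrite group_indexE cardfE -[N](size_iota 0) -(size_map (fun i => coset (i%:R / N%:R))).
rewrite -cardfE; apply: uniq_leq_size; first exact: fset_uniq.
by move=> C; rewrite in_fset_set // inE => /cosets_sub.
Qed.

(** Among the first B + 1 multiples of q two are congruent modulo H, since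
    there are at most B cosets. The hypothesis on N excludes an infinite
    number of cosets, for which group_index is 0. *)
Lemma group_index_int q B : (forall i : nat, G (q *+ i)) -> (group_index G H <= B)%N ->
  q * (B`!)%:R \is a Num.int.
Proof.
move=> hq hB.
have [i [j [ij jB E]]] : exists i j, [/\ (i < j)%N, (j <= B)%N &
    coset (q *+ i) = coset (q *+ j)].
  apply: contrapT => nex.
  have u : uniq [seq coset (q *+ i) | i <- iota 0 B.+1].
    rewrite map_inj_in_uniq ?iota_uniq // => i j; rewrite !mem_iota /= !add0n !ltnS.
    move=> iB jB E; case: (ltngtP i j) => // h; exfalso; apply: nex.
      by exists i, j.
    by exists j, i.
  have := @uniq_leq_size _ _ (fset_set cosets) u.
  rewrite size_map size_iota => /(_ _)/leq_trans/(_ hB); rewrite ltnn => /(_ _).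
  suff h : {subset [seq coset (q *+ i) | i <- iota 0 B.+1] <= fset_set cosets}.
    by move/(_ h).
  by move=> _ /mapP[i _ ->]; rewrite in_fset_set // inE; exists (q *+ i).
have /coset_eq d := esym E.
have {}d : q *+ (j - i) \is a Num.int by rewrite mulrnBr // ltnW.
have /dvdnP[c Ec] : (j - i %| B`!)%N by apply: dvdn_fact; lia.
rewrite Ec mulr_natr mulnC mulrnA; exact: rpredMn.
Qed.

End CosetCount.

(** * Residue fields in terms of values *)

Lemma val_inv (F : fieldType) (w : valuation F) x q : w x = q%:E -> w x^-1 = (- q)%:E.
Proof.
move=> hx; have x0 : x != 0 by rewrite -(val_eqy w) hx.
have := Defs.valM w x x^-1; rewrite mulfV // Defs.val1 hx.
by case: (w _) => // a; rewrite -EFinD => -[] h; congr (_%:E); lra.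
Qed.

Section ResidueValue.
Variables (F : fieldType) (W : valuation_ring F) (w : valuation F).
Hypothesis hW : W =i valuation_ring_of w.

Lemma vringE x : (x \in W) = (0 <= w x)%E.
Proof. by rewrite hW. Qed.

Lemma residue_eq0_val x : x \in W -> (residue W x == 0) = (0 < w x)%E.
Proof.
move=> Wx; rewrite residue_eq0 // vringE; rewrite vringE in Wx.
have [->|x0] := eqVneq x 0; first by rewrite Defs.val0 ltry.
have [q hq] := val_fin w x0; rewrite (val_inv hq) hq lee_fin lte_fin oppr_ge0.
by rewrite -ltNge.
Qed.

Lemma residue0 : residue W 0 = 0.
Proof. by apply/eqP; rewrite residue_eq0_val ?rpred0 // Defs.val0 ltry. Qed.

Lemma residueN x : x \in W -> residue W (- x) = - residue W x.
Proof.
by move=> Wx; apply/eqP; rewrite -addr_eq0 -residueD ?rpredN // addNr residue0.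
Qed.

Lemma residueB x y : x \in W -> y \in W -> residue W (x - y) = residue W x - residue W y.
Proof. by move=> Wx Wy; rewrite residueD ?rpredN // residueN. Qed.

Lemma residue_sum I (s : seq I) (P : pred I) (G : I -> F) :
  (forall i, G i \in W) ->
  residue W (\sum_(i <- s | P i) G i) = \sum_(i <- s | P i) residue W (G i).
Proof.
move=> hG; elim: s => [|i s IH]; first by rewrite !big_nil residue0.
rewrite !big_cons; case: (P i) => //; rewrite residueD ?IH //.
by rewrite rpred_sum.
Qed.

Lemma residueX x n : x \in W -> residue W (x ^+ n) = residue W x ^+ n.
Proof.
move=> Wx; elim: n => [|n IH]; first by rewrite !expr0 residue1.
by rewrite !exprS residueM ?rpredX // IH.
Qed.

Lemma residueMn x n : x \in W -> residue W (x *+ n) = residue W x *+ n.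
Proof.
move=> Wx; elim: n => [|n IH]; first by rewrite !mulr0n residue0.
by rewrite !mulrS residueD ?rpredMn // IH.
Qed.

Lemma monic_lift (p : {poly residue_field W}) : p \is monic ->
  exists P : {poly F}, [/\ P \is monic, P \is a polyOver W & map_poly (residue W) P = p].
Proof.
move=> mp; pose n := (size p).-1.
have sp : size p = n.+1 by rewrite prednK // size_poly_gt0 monic_neq0.
pose P := 'X^n + \poly_(i < n) residue_lift p`_i.
exists P; split.
- rewrite monicE lead_coefDl ?lead_coefXn // size_polyXn ltnS; exact: size_poly.
- rewrite rpredD ?rpredX ?polyOverX //; apply/polyOverP => i; rewrite coef_poly.
  by case: ifP => _; [exact: residue_lift_in|exact: rpred0].
apply/polyP => i; rewrite coef_map_id0 ?residue0 // coefD coefXn coef_poly.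
have [->|ni] := eqVneq i n.
  by rewrite ltnn addr0 residue1; move/monicP: mp.
rewrite add0r; case: ltnP => h; first exact: residue_liftK.
by rewrite residue0 nth_default // sp; lia.
Qed.

End ResidueValue.

Section ResidueMorphism.
Variables (K F : fieldType) (f : {rmorphism K -> F}).
Variables (V : valuation_ring K) (W : valuation_ring F).
Variables (v : valuation K) (w : valuation F).
Hypotheses (hV : V =i valuation_ring_of v) (hW : W =i valuation_ring_of w).
Hypothesis hext : extends_ring f V W.

(** The map of residue fields, with the hypothesis that makes it a morphism
    as an argument so that it can carry that structure. *)
Definition residue_morph of V =i valuation_ring_of v & W =i valuation_ring_of w &
  extends_ring f V W : residue_field V -> residue_field W := @residue_map K F f V W.

Local Notation rho := (residue_morph hV hW hext).

Lemma residue_morphE x : x \in V -> rho (residue V x) = residue W (f x).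
Proof. exact: residue_mapE. Qed.

Fact residue_morph_zmod : zmod_morphism rho.
Proof.
move=> a b; rewrite -[a]residue_liftK -[b]residue_liftK.
set x := residue_lift a; set y := residue_lift b.
have [Vx Vy] : x \in V /\ y \in V by split; exact: residue_lift_in.
by rewrite -(residueB hV) // !residue_morphE ?rpredB // rmorphB (residueB hW) ?hext.
Qed.

Fact residue_morph_monoid : monoid_morphism rho.
Proof.
split; first by rewrite -(residue1 V) residue_morphE ?rpred1 // rmorph1 residue1.
move=> a b; rewrite -[a]residue_liftK -[b]residue_liftK.
set x := residue_lift a; set y := residue_lift b.
have [Vx Vy] : x \in V /\ y \in V by split; exact: residue_lift_in.
by rewrite -residueM // !residue_morphE ?rpredM // rmorphM residueM ?hext.
Qed.

HB.instance Definition _ := GRing.isZmodMorphism.Build _ _ rho residue_morph_zmod.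
HB.instance Definition _ := GRing.isMonoidMorphism.Build _ _ rho residue_morph_monoid.

Lemma residue_horner (P : {poly K}) z : P \is a polyOver V -> z \in W ->
  residue W (map_poly f P).[z] = (map_poly rho (map_poly (residue V) P)).[residue W z].
Proof.
move=> /polyOverP hP Wz.
rewrite (horner_coef_wide z (size_poly _ _ : (size (map_poly f P) <= size P)%N)).
rewrite (residue_sum hW); last first.
  by move=> i; rewrite coef_map rpredM ?rpredX //= hext.
rewrite (@horner_coef_wide _ (size P)); last first.
  by rewrite size_map_poly; exact: size_poly.
apply: eq_bigr => i _.
rewrite !coef_map /= coef_map_id0 ?(residue0 hV) //.
by rewrite residueM ?rpredX ?hext // residueX // residue_morphE.
Qed.

Lemma polyOver_vring (P : {poly K}) :
  (P \is a polyOver V) = (P \is a polyOver (intring (sval_of v))).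
Proof.
by apply/idP/idP => /polyOverP h; apply/polyOverP => i; move: (h i);
  rewrite intringE (vringE hV).
Qed.

(** P lifts the minimal polynomial of the residue class of z, whose
    derivative does not vanish there because the residue field is perfect. *)
Lemma approx_simple_root : perfect_field (residue_field V) ->
  residually_algebraic f V W -> forall z, (0 <= w z)%E -> exists P : {poly K},
  [/\ P \is monic, P \is a polyOver (intring (sval_of v)),
      (0 < w (map_poly f P).[z])%E & w (map_poly f P^`()).[z] = 0%E].
Proof.
move=> hperf halg z wz; have Wz : z \in W by rewrite (vringE hW).
pose u := residue W z.
pose isroot p := (p != 0) && root (map_poly rho p) u.
have ex : exists n, `[< exists2 p, isroot p & size p = n >].
  have [p p0 pu] := halg u; exists (size p); apply/asboolP; exists p => //.
  by rewrite /isroot p0.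
case: (ex_minnP ex) => _ /asboolP[p0 /andP[p00 p0u] <-] minp.
pose p := (lead_coef p0)^-1 *: p0.
have l0 : (lead_coef p0)^-1 != 0 by rewrite invr_eq0 lead_coef_eq0.
have mp : p \is monic by rewrite monicE lead_coefZ mulVf // lead_coef_eq0.
have sp : size p = size p0 by rewrite size_scale.
have pu : root (map_poly rho p) u.
  by rewrite /p map_polyZ /root hornerZ (rootP p0u) mulr0.
have {}minp q : isroot q -> (size p <= size q)%N.
  by move=> hq; rewrite sp; apply: minp; apply/asboolP; exists q.
have s1 : (1 < size p)%N.
  rewrite ltnNge; apply/negP => /size1_polyC E.
  move: mp pu; rewrite E => /monicP; rewrite lead_coefC => ->.
  by rewrite rmorph1 rootE hornerC oner_eq0.
have irr : irreducible_poly p.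
  split=> // d sd /dvdpP[q Eq].
  have [q0 d0] : q != 0 /\ d != 0.
    by apply/andP; rewrite -negb_or -mulf_eq0 -Eq monic_neq0.
  have ss : size p = (size q + size d).-1 by rewrite Eq size_mul.
  move: pu; rewrite Eq rmorphM rootM => /orP[qu|du].
    have := minp q; rewrite /isroot q0 qu => /(_ isT); rewrite ss.
    have : (0 < size d)%N by rewrite size_poly_gt0.
    have : (0 < size q)%N by rewrite size_poly_gt0.
    move=> q1 d1 qd; exfalso; have {}sd : size d != 1%N := sd.
    by move: sd q1 d1 qd; move: (size d) (size q) => a b /eqP; lia.
  have := minp d; rewrite /isroot d0 du => /(_ isT) pd.
  rewrite -Eq -dvdp_size_eqp; last by apply/dvdpP; exists q.
  rewrite eqn_leq pd andbT; apply: dvdp_leq; first by rewrite monic_neq0.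
  by apply/dvdpP; exists q.
have sep := hperf p irr.
have [P [mP hP EP]] := monic_lift hV mp.
have P'E : map_poly (residue V) P^`() = p^`().
  apply/polyP => i; rewrite coef_map_id0 ?(residue0 hV) // !coef_deriv -EP.
  rewrite coef_map_id0 ?(residue0 hV) // (residueMn hV) //.
  by have /polyOverP := hP; apply.
have hP' : P^`() \is a polyOver V by apply: polyOver_deriv.
have inW (Q : {poly K}) : Q \is a polyOver V -> (map_poly f Q).[z] \in W.
  move=> hQ; rewrite rpred_horner //; apply/polyOverP => i.
  by rewrite coef_map /= hext; have /polyOverP := hQ; apply.
exists P; split=> //; first by rewrite -polyOver_vring.
  rewrite -(residue_eq0_val hW (inW _ hP)) (residue_horner hP Wz) EP.
  exact: pu.
apply/eqP; rewrite eq_le -(vringE hW) inW // andbT leNgt.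
rewrite -(residue_eq0_val hW) ?inW // residue_horner // P'E -deriv_map.
have : coprimep (map_poly rho p) (map_poly rho p)^`().
  by move: sep; rewrite deriv_map coprimep_map unlock.
by move=> /coprimep_root/(_ pu).
Qed.

End ResidueMorphism.

(** * Scaling, limits and approximation *)

Section ScaledValuation.
Variables (F : fieldType) (w : valuation F) (c : rat).

Definition scale_fun (x : F) : \bar rat := if w x is r%:E then (c * r)%:E else w x.

Lemma scale_funE x r : w x = r%:E -> scale_fun x = (c * r)%:E.
Proof. by rewrite /scale_fun => ->. Qed.

Fact scale_eqy x : (scale_fun x == +oo%E) = (x == 0).
Proof. by rewrite /scale_fun -(val_eqy w); case: (w x). Qed.

Fact scale_neqNy x : scale_fun x != -oo%E.
Proof. by rewrite /scale_fun; have := val_neqNy w x; case: (w x). Qed.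

Fact scale_valM x y : scale_fun (x * y) = (scale_fun x + scale_fun y)%E.
Proof.
rewrite /scale_fun Defs.valM; have := val_neqNy w x; have := val_neqNy w y.
by case: (w x) (w y) => [r||] [s||] //=; rewrite mulrDr.
Qed.

Hypothesis c0 : 0 < c.

Fact scale_valD x y : (Order.min (scale_fun x) (scale_fun y) <= scale_fun (x + y))%E.
Proof.
have := Defs.valD w x y; rewrite /scale_fun !ge_min.
have := val_neqNy w x; have := val_neqNy w y; have := val_neqNy w (x + y).
case: (w x) (w y) (w (x + y)) => [r||] [s||] [u||] //=; rewrite ?leey ?orbT //.
all: by rewrite !lee_fin !(ler_pM2l c0).
Qed.

Definition scale_val : valuation F :=
  Valuation scale_eqy scale_neqNy scale_valM scale_valD.

Lemma scale_val_ge0 x : (0 <= scale_val x)%E = (0 <= w x)%E.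
Proof. by rewrite /= /scale_fun; case: (w x) => // r; rewrite !lee_fin pmulr_rge0. Qed.

End ScaledValuation.

Lemma val_exprn (F : fieldType) (w : valuation F) x q n :
  w x = q%:E -> w (x ^+ n) = (q * n%:R)%:E.
Proof. exact: (@svXfin _ (sval_of w)). Qed.

Lemma val_exprz (F : fieldType) (w : valuation F) x q (m : int) :
  w x = q%:E -> w (x ^ m) = (q * m%:~R)%:E.
Proof.
move=> hx; case: m => n; first by rewrite -exprnP (val_exprn _ hx).
by rewrite NegzE -exprnN (val_inv (val_exprn _ hx)) -mulrN rmorphN.
Qed.

Lemma sv_ge_expr (R : comNzRingType) (v : semival R) x (b : rat) n :
  (b%:E <= v x)%E -> ((b * n%:R)%:E <= v (x ^+ n)%R)%E.
Proof.
move=> hx; elim: n => [|n IH]; first by rewrite mulr0 sv1.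
by rewrite exprS svM -natr1 mulrDr mulr1 addrC EFinD leeD.
Qed.

Lemma horner_small (R : comNzRingType) (v : semival R) (b a : rat) n :
  exists c : rat, forall p : {poly R}, (size p <= n)%N ->
    (forall i, (c%:E <= v p`_i)%E) -> forall x, (b%:E <= v x)%E -> (a%:E < v p.[x])%E.
Proof.
pose b0 := Num.min b 0; exists (a + 1 - b0 * n%:R) => p sp hp x hx.
apply: (@lt_le_trans _ _ (a + 1)%:E); first by rewrite lte_fin ltrDl.
rewrite (horner_coef_wide _ sp); apply: sv_ge_sum => i _; rewrite svM.
have hx0 : (b0%:E <= v x)%E by apply: le_trans hx; rewrite lee_fin ge_min lexx.
apply: le_trans (leeD (hp i) (sv_ge_expr i hx0)).
rewrite -EFinD lee_fin -addrA lerDl addrC subr_ge0 ler_wnM2l ?ler_nat 1?ltnW ?ltn_ord //.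
by rewrite ge_min lexx orbT.
Qed.

Section Convergence.
Variables (L : fieldType) (v : valuation L).

Lemma steps_cauchy (s : nat -> L) (e : nat) : (0 < e)%N ->
  (forall m, ((m%:R / e%:R)%:E <= v (s m.+1 - s m)%R)%E) -> val_cauchy v s.
Proof.
move=> e0 hs c; have [N hN] := archi_nat (c * e%:R).
have H m : (N <= m)%N -> (c%:E <= v (s m - s N)%R)%E.
  elim: m => [|m IH]; first by rewrite leqn0 => /eqP->; rewrite subrr Defs.val0 leey.
  rewrite leq_eqVlt => /predU1P[<-|Nm]; first by rewrite subrr Defs.val0 leey.
  apply: (@sv_geB_trans _ (sval_of v) _ _ (s m)); last exact: IH.
  by apply: le_trans (hs m); rewrite lee_fin ler_pdivlMr ?ltr0n // hN.
exists N => m n Nm Nn; apply: (@sv_geB_trans _ (sval_of v) _ _ (s N)); first exact: H.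
have -> : sval_of v (s N - s n) = sval_of v (s n - s N) by exact: svBC.
exact: H.
Qed.

Lemma converges_horner (s : nat -> L) (a : L) (p : {poly L}) (c : rat) :
  val_converges v s a -> evtl (fun n => c%:E <= v (p.[a] - p.[s n])%R)%E.
Proof.
move=> hs; have [b hb] := sv_lower (sval_of v) a.
have [d hd] := horner_lipschitz (sval_of v) b p.
have [N hN] := evtl_and (hs b) (hs (c - d)); exists N => n /hN[h1 h2].
rewrite -(subrKC d c).
apply: hd => //; rewrite -(subKr a (s n)); exact: (@sv_geB _ (sval_of v)).
Qed.

Lemma converges_val (s : nat -> L) (a : L) (p : {poly L}) (q : rat) :
  val_converges v s a -> v p.[a] = q%:E -> evtl (fun n => v p.[s n] = q%:E).
Proof.
move=> hs hq; apply: evtl_imp (converges_horner p (q + 1) hs) => n h.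
rewrite -hq; apply: (@sv_ltB _ (sval_of v)).
have -> : sval_of v (p.[s n] - p.[a]) = sval_of v (p.[a] - p.[s n]) by exact: svBC.
by apply: lt_le_trans h; rewrite /= hq lte_fin ltrDl.
Qed.

Lemma converges_val_lim (s : nat -> L) (a : L) (p : {poly L}) (q : rat) :
  val_converges v s a -> evtl (fun n => v p.[s n] = q%:E) -> v p.[a] = q%:E.
Proof.
move=> hs hq; have [N hN] := evtl_and hq (converges_horner p (q + 1) hs).
have [hq' h] := hN N (leqnn _).
rewrite -hq'; apply: (@sv_ltB _ (sval_of v)).
by apply: lt_le_trans h; rewrite /= hq' lte_fin ltrDl.
Qed.

End Convergence.

(** * Normalized extensions of discrete valuations *)

Section DiscreteExtension.
Variables (K F : fieldType) (f : {rmorphism K -> F}).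
Variables (V : valuation_ring K) (W : valuation_ring F) (v : valuation K).
Hypotheses (hV : dvr_valuation V v) (hext : extends_ring f V W).

Lemma discrete_uniformizer : exists2 t, t != 0 & v t = 1%E.
Proof. by have [hd _] := hV; apply/(hd 1). Qed.

Lemma poly_clear_denominators t (P : {poly K}) : v t = 1%E ->
  exists N, (t ^+ N) *: P \is a polyOver (intring (sval_of v)).
Proof.
move=> ht.
have H (i : nat) : evtl (fun N => (0 <= v (t ^+ N * P`_i)%R)%E).
  have [b hb] := sv_lower (sval_of v) P`_i.
  have [N hN] := archi_nat (- b); exists N => n /hN h.
  rewrite Defs.valM (val_exprn _ ht) mul1r.
  apply: le_trans (leeD2l _ hb); rewrite -EFinD lee_fin; lra.
have [N hN] := evtl_all (size P) H; exists N; apply/polyOverP => i; rewrite coefZ intringE.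
have [h|h] := ltnP i (size P); first exact: (hN N).
by rewrite nth_default // mulr0 sv0 leey.
Qed.

(** The normalized valuation of W multiplies that of V by the ramification
    index e; dividing it by e gives an extension of v. *)
Lemma normalize_dvr : is_dvr W -> exists (e : nat) (w : valuation F),
  [/\ (0 < e)%N, forall c, w (f c) = v c, W =i valuation_ring_of w,
      forall x, w x = +oo%E \/ exists m : int, w x = (m%:~R / e%:R)%:E &
      exists pi, w pi = (e%:R^-1)%:E].
Proof.
have [hvd hVv] := hV.
move=> [w0 [hd hW0]]; have [t t0 ht] := discrete_uniformizer.
have inW x : (x \in W) = (0 <= w0 x)%E by rewrite hW0.
have inV x : (x \in V) = (0 <= v x)%E by rewrite hVv.
have ft0 : f t != 0 by rewrite fmorph_eq0.
have [q hq] := val_fin w0 ft0.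
have /(hd q)/intrP[m Em] : exists2 x, x != 0 & w0 x = q%:E by exists (f t).
have q0 : 0 < q.
  have : f t^-1 \notin W by rewrite hext inV (val_inv ht) lee_fin oppr_ge0 -ltNge.
  by rewrite fmorphV inW (val_inv hq) lee_fin oppr_ge0 -ltNge.
pose e := `|m|%N.
have m0 : 0 < m by move: q0; rewrite Em ltr0z.
have Ee : e%:R = q by rewrite Em /e pmulrn gez0_abs // ltW.
have e0 : (0 < e)%N by rewrite /e absz_gt0 gt_eqF.
have iq : 0 < e%:R^-1 :> rat by rewrite invr_gt0 Ee.
exists e, (scale_val w0 iq); split=> //.
- move=> c; have [->|c0] := eqVneq c 0; first by rewrite rmorph0 !Defs.val0.
  have [r hr] := val_fin v c0.
  have /(hvd r)/intrP[n En] : exists2 x, x != 0 & v x = r%:E by exists c.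
  have hu : v (c * t ^ (- n)) = 0%E.
    by rewrite Defs.valM hr (val_exprz _ ht) -EFinD En mul1r rmorphN subrr.
  have w0u : w0 (f (c * t ^ (- n))) = 0%E.
    apply/eqP; rewrite eq_le -inW hext inV hu lexx andbT.
    have : (0 <= w0 (f (c * t ^ (- n))%R)^-1%R)%E.
      by rewrite -inW -fmorphV hext inV (val_inv hu) oppr0.
    have u0 : f (c * t ^ (- n)) != 0 by rewrite fmorph_eq0 -(val_eqy v) hu.
    have [a ha] := val_fin w0 u0; rewrite (val_inv ha) ha !lee_fin; lra.
  have Ec : c = c * t ^ (- n) * t ^ n by rewrite -mulrA -expfzDr // addNr expr0z mulr1.
  have w0c : w0 (f c) = (q * n%:~R)%:E.
    by rewrite Ec rmorphM Defs.valM w0u add0e rmorphXz ?unitfE // (val_exprz _ hq).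
  by rewrite [LHS](scale_funE _ w0c) hr En mulrA Ee mulVf ?mul1r // gt_eqF.
- by move=> x; rewrite inW -(scale_val_ge0 _ iq).
- move=> x; have [->|x0] := eqVneq x 0; first by left; rewrite Defs.val0.
  have [a ha] := val_fin w0 x0.
  have /(hd a)/intrP[n En] : exists2 x, x != 0 & w0 x = a%:E by exists x.
  by right; exists n; rewrite [LHS](scale_funE _ ha) En mulrC.
- have [pi _ hpi] : exists2 x, x != 0 & w0 x = 1%E by apply/(hd 1).
  by exists pi; rewrite [LHS](scale_funE _ hpi) mulr1.
Qed.

End DiscreteExtension.

Lemma constF_horner (K : fieldType) (Q : {poly K}) :
  (map_poly (constF K) Q).[tofrac 'X] = tofrac Q.
Proof.
rewrite /constF /= map_poly_comp /=.
by rewrite horner_map /= -[_.['X]]/(Q \Po 'X) comp_polyXr.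
Qed.

(** * Linear dependence *)

Lemma kernel_vector (k : fieldType) n (M : 'M[k]_(n.+1, n)) :
  exists2 c : 'rV[k]_n.+1, c != 0 & c *m M = 0.
Proof.
have : kermx M != 0.
  rewrite -mxrank_eq0 mxrank_ker -lt0n subn_gt0 ltnS.
  exact: rank_leq_col.
by case/rowV0Pn => c /sub_kermxP cM c0; exists c.
Qed.

Lemma kernel_family (k : fieldType) (T : finType) (d : 'I_#|T|.+1 -> T -> k) :
  exists2 c : 'I_#|T|.+1 -> k, exists l, c l != 0 & forall x, \sum_l c l * d l x = 0.
Proof.
have [c c0 cM] := kernel_vector (\matrix_(l, x) d l (enum_val x)).
exists (fun l => c 0 l).
  by have /rV0Pn[l hl] := c0; exists l.
move=> x; have /rowP/(_ (enum_rank x)) := cM.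
rewrite !mxE => E; rewrite -[RHS]E; apply: eq_bigr => l _.
by rewrite mxE enum_rankK.
Qed.

Section DependentFamilies.
Variables (k l : fieldType) (rho : {rmorphism k -> l}).

Definition dependent n (u : 'I_n -> l) :=
  exists2 c : 'I_n -> k, exists i, c i != 0 & \sum_i rho (c i) * u i = 0.

(** Take an independent family of the largest possible size. *)
Lemma dependent_span n : (forall u : 'I_n.+1 -> l, dependent u) ->
  exists (m : nat) (b : 'I_m -> l), forall x, exists c : 'I_m -> k,
    x = \sum_i rho (c i) * b i.
Proof.
elim: n => [|n IH] H.
  exists 0%N, (fun _ => 0) => x; exists (fun _ => 0); rewrite big_ord0.
  have [c [i ci]] := H (fun _ => x); rewrite big_ord_recl big_ord0 addr0 => /eqP.
  by rewrite ord1 in ci; rewrite mulf_eq0 fmorph_eq0 (negPf ci) => /eqP.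
have [Hn|/existsNP[b nb]] := pselect (forall u : 'I_n.+1 -> l, dependent u).
  exact: IH.
exists n.+1, b => x.
pose u (i : 'I_n.+2) := oapp b x (unlift ord0 i).
have [c [i ci]] := H u; rewrite big_ord_recl /u unlift_none /=.
have -> : \sum_(i < n.+1) rho (c (lift ord0 i)) * oapp b x (unlift ord0 (lift ord0 i)) =
    \sum_(i < n.+1) rho (c (lift ord0 i)) * b i.
  by apply: eq_bigr => m _; rewrite liftK.
have [c0|c0] := eqVneq (c ord0) 0.
  rewrite c0 rmorph0 mul0r add0r => E; exfalso; apply: nb.
  exists (fun m => c (lift ord0 m)) => //.
  case: (unliftP ord0 i) => [m Em|Em]; last by rewrite Em c0 eqxx in ci.
  by exists m; rewrite -Em.
move=> E; exists (fun m => - (c ord0)^-1 * c (lift ord0 m)).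
have rc0 : rho (c ord0) != 0 by rewrite fmorph_eq0.
apply: (mulfI rc0); rewrite mulr_sumr.
move/eqP: E; rewrite addr_eq0 => /eqP ->; rewrite -sumrN; apply: eq_bigr => m _.
by rewrite rmorphM rmorphN fmorphV !mulNr mulrN !mulrA mulfV // mul1r.
Qed.

End DependentFamilies.

Section AdjoinDegree.
Variables (k l : fieldType) (f : {rmorphism k -> l}) (s : l).

Lemma adjoin_horner (p : {poly k}) : adjoin f s (map_poly f p).[s].
Proof. by exists p, 1; rewrite rmorph1 hornerC oner_neq0 divr1. Qed.

Lemma adjoinX y n : adjoin f s y -> adjoin f s (y ^+ n).
Proof.
move=> [p [q [q0 ->]]]; exists (p ^+ n), (q ^+ n).
by rewrite !rmorphXn !horner_exp expf_neq0 // exprMn exprVn.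
Qed.

(** After multiplication by a common denominator the elements are values at
    s of polynomials, which may be reduced modulo a polynomial that
    vanishes at s. *)
Lemma adjoin_dependent : algebraicOver f s -> exists n, forall y : 'I_n.+1 -> l,
  (forall m, adjoin f s (y m)) -> dependent f y.
Proof.
move=> [P P0 Ps]; exists (size P).-1 => y hy.
set n := (size P).-1 in y hy *.
have sP : size P = n.+1 by rewrite prednK // size_poly_gt0.
have /choice[p /choice[q hpq]] := hy.
pose Q := \prod_m q m; pose r m := (p m * \prod_(m' | m' != m) q m') %% P.
have Q0 : (map_poly f Q).[s] != 0.
  by rewrite rmorph_prod horner_prod; apply/prodf_neq0 => m _; have [] := hpq m.
have rE m : (map_poly f (r m)).[s] = y m * (map_poly f Q).[s].
  have [qm ->] := hpq m; rewrite /Q (bigD1 m) //= rmorphM hornerM mulrA divfK //.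
  rewrite -hornerM -rmorphM (divp_eq (p m * _) P) rmorphD rmorphM hornerD hornerM.
  by rewrite (rootP Ps) mulr0 add0r.
have sr m : (size (r m) <= n)%N by rewrite -ltnS -sP ltn_modp.
have [c c0 cM] := kernel_vector (\matrix_(m < n.+1, x < n) (r m)`_x).
exists (fun m => c 0 m); first by have /rV0Pn[m hm] := c0; exists m.
apply: (mulIf Q0); rewrite mul0r mulr_suml.
have sum0 : (map_poly f (\sum_m c 0 m *: r m)).[s] = 0.
  suff -> : \sum_m c 0 m *: r m = 0 by rewrite rmorph0 horner0.
  apply/polyP => x; rewrite coef0 coef_sum.
  have [xn|nx] := ltnP x n.
    have /rowP/(_ (Ordinal xn)) := cM; rewrite !mxE => E; rewrite -[RHS]E.
    by apply: eq_bigr => m _; rewrite coefZ !mxE.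
  by rewrite big1 // => m _; rewrite coefZ nth_default ?mulr0 // (leq_trans (sr m)).
rewrite -[RHS]sum0 rmorph_sum horner_sum; apply: eq_bigr => m _.
by rewrite /= map_polyZ hornerZ rE mulrA.
Qed.

End AdjoinDegree.

(** * Values and residues of algebraic elements *)

Lemma normalize_family (F : fieldType) (v : valuation F) (T : finType) (c : T -> F) :
  (exists x, c x != 0) -> exists d, (forall x, 0 <= v (d * c x)%R)%E /\
    exists x, v (d * c x) = 0%E.
Proof.
move=> [x0 cx0]; case: (@arg_minP _ _ _ x0 xpredT (fun x => v (c x)) isT) => x _ xmin.
have [q hq] : exists q : rat, v (c x) = q%:E.
  have [E|//] := sv_cases (sval_of v) (c x); exfalso.
  have := xmin x0 isT; rewrite /= in E; rewrite E leye_eq val_eqy => /eqP E0.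
  by rewrite E0 eqxx in cx0.
have cx : c x != 0 by rewrite -(val_eqy v) hq.
exists (c x)^-1; split=> [y|].
  rewrite Defs.valM (val_inv hq); have := xmin y isT; rewrite hq.
  by case: (v _) => // a; rewrite !lee_fin; lra.
by exists x; rewrite mulVf // Defs.val1.
Qed.

(** A subgroup of the rational numbers with bounded denominators is cyclic:
    its least positive element d / N is found by division with remainder. *)
Lemma discrete_scaling (F : fieldType) (w : valuation F) (N : nat) : (0 < N)%N ->
  (forall x, x != 0 -> exists m : int, w x = (m%:~R / N%:R)%:E) ->
  (exists x, w x = 1%E) ->
  exists (c : rat) (c0 : 0 < c), discrete_valuation (scale_val w c0).
Proof.
move=> N0 hN [x1 hx1].
have NR : N%:R != 0 :> rat by rewrite pnatr_eq0 -lt0n.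
have ex : exists n, (0 < n)%N && `[< exists x, w x = (n%:R / N%:R)%:E >].
  by exists N; rewrite N0; apply/asboolP; exists x1; rewrite hx1 divff.
case: (ex_minnP ex) => d /andP[d0 /asboolP[pi hpi]] dmin.
have dR : d%:R != 0 :> rat by rewrite pnatr_eq0 -lt0n.
have c0 : 0 < N%:R / d%:R :> rat by rewrite divr_gt0 ?ltr0n.
exists (N%:R / d%:R), c0 => q; split=> [[x x0]|/intrP[m ->]].
  have [m hm] := hN x x0; rewrite [LHS](scale_funE _ hm) => -[<-].
  have hr : w (x * pi ^ (- (m %/ d)%Z)) = (((m %% d)%Z)%:~R / N%:R)%:E.
    rewrite Defs.valM hm (val_exprz _ hpi) -EFinD; congr (_%:E).
    rewrite {1}(divz_eq m d) rmorphD rmorphM rmorphN /= mulrN.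
    rewrite -[d%:~R]/(d%:R) [d%:R / _ * _]mulrAC.
    rewrite -[in RHS](addrK ((m %/ d)%Z%:~R * d%:R) (_ %% _)%Z%:~R).
    by rewrite mulrBl [d%:R * _]mulrC; congr (_ / _ - _); rewrite addrC.
  have r0 : (m %% d)%Z = 0.
    have r_ge : 0 <= (m %% d)%Z by rewrite modz_ge0 // eqz_nat -lt0n.
    have r_lt : (m %% d)%Z < d%:Z by rewrite ltz_pmod.
    apply/eqP; rewrite eq_le r_ge andbT leNgt; apply/negP => r_gt.
    have := dmin `|(m %% d)%Z|%N; rewrite absz_gt0 gt_eqF //=.
    have -> : `[< exists x, w x = (`|(m %% d)%Z|%N%:R / N%:R)%:E >].
      apply/asboolP; exists (x * pi ^ (- (m %/ d)%Z)); rewrite hr.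
      by rewrite [X in (X / _)%:E]pmulrn gez0_abs.
    move=> /(_ isT); rewrite -lez_nat gez0_abs // => /(lt_le_trans r_lt).
    by rewrite ltxx.
  rewrite {1}(divz_eq m d) r0 addr0 intrM mulrA mulrAC -[d%:~R]/(d%:R).
  have -> : N%:R / d%:R / N%:R * ((m %/ d)%Z%:~R * d%:R) = (m %/ d)%Z%:~R :> rat.
    by field; rewrite NR dR.
  exact: intr_int.
have pi0 : pi != 0 by rewrite -(val_eqy w) hpi.
exists (pi ^ m); first by rewrite expfz_neq0.
rewrite [LHS](scale_funE _ (val_exprz m hpi)); congr (_%:E).
by field; rewrite NR dR.
Qed.

Section EvaluationValuation.
Variables (K L : fieldType) (f : {rmorphism K -> L}) (a : L) (v : valuation L).
Hypothesis tr : transcendentalOver f a.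

Local Notation F := {fraction {poly K}}.
Local Notation ev := (@ratfun_eval K L f a).

Lemma ratfun_eval_poly (P : {poly K}) : ev (tofrac P) = (map_poly f P).[a].
Proof.
have -> : tofrac P = tofrac P / tofrac 1 by rewrite tofrac1 divr1.
by rewrite ratfun_evalE ?oner_neq0 // rmorph1 hornerC divr1.
Qed.

Lemma ratfun_eval_cst c : ev (constF K c) = f c.
Proof. by rewrite ratfun_eval_poly map_polyC hornerC. Qed.

(** The evaluation at a is a morphism only when a is transcendental; the
    proof of this is an argument so that the morphism structure can be
    attached to it. *)
Definition eval_morph of transcendentalOver f a : F -> L := ev.

Fact eval_morph_zmod : zmod_morphism (eval_morph tr).
Proof. exact: ratfun_evalB. Qed.
Fact eval_morph_monoid : monoid_morphism (eval_morph tr).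
Proof. by split; [exact: ratfun_eval1|exact: ratfun_evalM]. Qed.

HB.instance Definition _ :=
  GRing.isZmodMorphism.Build F L (eval_morph tr) eval_morph_zmod.
HB.instance Definition _ :=
  GRing.isMonoidMorphism.Build F L (eval_morph tr) eval_morph_monoid.

Fact eval_val_eqy x : (v (eval_morph tr x) == +oo%E) = (x == 0).
Proof. by rewrite val_eqy fmorph_eq0. Qed.
Fact eval_valM x y :
  v (eval_morph tr (x * y)) = (v (eval_morph tr x) + v (eval_morph tr y))%E.
Proof. by rewrite rmorphM Defs.valM. Qed.
Fact eval_valD x y : (Order.min (v (eval_morph tr x)) (v (eval_morph tr y)) <=
  v (eval_morph tr (x + y)%R))%E.
Proof. by rewrite rmorphD Defs.valD. Qed.

Definition eval_val : valuation F :=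
  Valuation eval_val_eqy (fun x => val_neqNy v _) eval_valM eval_valD.

Lemma transc_ringE : transc_ring tr v =i valuation_ring_of eval_val.
Proof. by []. Qed.

Lemma eval_morph_horner (P : {poly K}) x :
  eval_morph tr (map_poly (constF K) P).[x] = (map_poly f P).[eval_morph tr x].
Proof.
rewrite -horner_map -map_poly_comp; congr (_.[_]); apply: eq_map_poly => c /=.
exact: ratfun_eval_cst.
Qed.

End EvaluationValuation.

(** * The tower of completions *)

Section Tower.
Variables (K Khat Kbar KK : fieldType) (V : valuation_ring K) (v : valuation K).
Variables (vhat : valuation Khat) (vbar : valuation Kbar) (vKK : valuation KK).
Variables (i : {rmorphism K -> Khat}) (j : {rmorphism Khat -> Kbar}).
Variable (k : {rmorphism Kbar -> KK}).
Hypothesis hV : dvr_valuation V v.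
Hypothesis hKhat : is_completion i v vhat.
Hypothesis hKbar : algebraic_closure j.
Hypothesis hvbar : extends_val j vhat vbar.
Hypothesis hKK : is_completion k vbar vKK.

Let iota : {rmorphism K -> KK} := k \o j \o i.
Let g : {rmorphism K -> Kbar} := j \o i.

Let vi c : vhat (i c) = v c. Proof. by case: hKhat => h _ _; apply: h. Qed.
Let vg c : vbar (g c) = v c. Proof. by rewrite /= hvbar vi. Qed.
Let vk x : vKK (k x) = vbar x. Proof. by case: hKK => h _ _; apply: h. Qed.

Lemma iota_horner (P : {poly K}) x :
  (map_poly iota P).[k x] = k (map_poly g P).[x].
Proof.
have -> : map_poly iota P = map_poly k (map_poly g P) by rewrite -map_poly_comp.
by rewrite horner_map.
Qed.

Lemma completion_val_int x : x != 0 -> exists m : int, vhat x = (m%:~R)%:E.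
Proof.
move=> x0; have [q hq] := val_fin vhat x0.
have [_ _ hd] := hKhat; have [y hy] := hd x (q + 1).
have vy : v y = q%:E.
  rewrite -vi -hq; apply: (@sv_ltB _ (sval_of vhat)).
  have -> : sval_of vhat (i y - x) = sval_of vhat (x - i y) by exact: svBC.
  by apply: lt_le_trans hy; rewrite /= hq lte_fin ltrDl.
have [hvd _] := hV.
have /(hvd q)/intrP[m Em] : exists2 y, y != 0 & v y = q%:E.
  by exists y => //; rewrite -(val_eqy v) vy.
by exists m; rewrite hq Em.
Qed.

Lemma completion_value_group q : value_group vhat setT q <-> q \is a Num.int.
Proof.
split=> [[x [_ x0 hx]]|hq].
  by have [m] := completion_val_int x0; rewrite hx => -[->]; apply: intr_int.
have [hvd _] := hV; have [x x0 hx] := iffRL (hvd q) hq.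
by exists (i x); rewrite fmorph_eq0 vi.
Qed.

(** Polynomials over K are dense among those over its completion, and a value
    is locally constant away from zero. *)
Lemma approx_coefficients (p : {poly Khat}) (s : Kbar) :
  (map_poly j p).[s] != 0 -> exists P : {poly K},
    vbar (map_poly g P).[s] = vbar (map_poly j p).[s].
Proof.
move=> ps0; have [q hq] := val_fin vbar ps0.
have [b hb] := sv_lower (sval_of vbar) s.
have [c hc] := horner_small (sval_of vbar) b q (size p).
have [_ _ hd] := hKhat.
have /choice[y hy] : forall n, exists y, (c%:E <= vhat (p`_n - i y)%R)%E.
  by move=> n; apply: hd.
exists (\poly_(n < size p) y n); set P := \poly_(_ < _) _.
have E : map_poly g P = map_poly j (map_poly i P) by rewrite -map_poly_comp.
rewrite E; apply: (@sv_ltB _ (sval_of vbar)); rewrite /= hq.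
have -> : vbar ((map_poly j (map_poly i P)).[s] - (map_poly j p).[s]) =
   vbar (map_poly j (map_poly i P - p)).[s] by rewrite rmorphB /= !hornerE.
apply: hc hb; first by rewrite size_map_poly; apply: leq_trans (size_polyD _ _) _;
  rewrite size_polyN geq_max leqnn andbT size_map_poly size_poly.
move=> n; rewrite coef_map /= hvbar coefB coef_map /= coef_poly.
have -> : vhat (i (if (n < size p)%N then y n else 0) - p`_n) =
   vhat (p`_n - i (if (n < size p)%N then y n else 0)) by exact: (svBC (sval_of vhat)).
case: ltnP => h; first exact: hy.
by rewrite nth_default // rmorph0 subrr Defs.val0 leey.
Qed.

Lemma ram_index_le (s : Kbar) e : (0 < e)%N ->
  (forall P : {poly K}, vbar (map_poly g P).[s] = +oo%E \/
     exists m : int, vbar (map_poly g P).[s] = (m%:~R / e%:R)%:E) ->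
  (ram_index j vhat vbar s <= e)%N.
Proof.
move=> e0 hs; apply: group_index_le => //; first exact: completion_value_group.
have eR : e%:R != 0 :> rat by rewrite pnatr_eq0 -lt0n.
have H (p : {poly Khat}) : (map_poly j p).[s] != 0 ->
    exists m : int, vbar (map_poly j p).[s] = (m%:~R / e%:R)%:E.
  move=> ps0; have [P EP] := approx_coefficients ps0; rewrite -EP.
  by have [E|//] := hs P; move: ps0; rewrite -(val_eqy vbar) -EP E.
move=> q [x [[p [r [r0 Ex]]] x0 hx]].
have p0 : (map_poly j p).[s] != 0.
  by apply: contraNneq x0 => p0; rewrite Ex p0 mul0r.
have [m hm] := H p p0; have [n hn] := H r r0.
move: hx; rewrite Ex Defs.valM hm (val_inv hn) -EFinD => -[<-].
by rewrite -mulrBl divfK // -intrB intr_int.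
Qed.

(** The product of the ring of Cauchy sequences of K(X) and of Kbar contains
    the graph of an isomorphism between the unramified parts, by
    coef_ring_exists; uniformizer_approx then gives elements s m of Kbar that
    imitate X and converge to the required a. As X need not be integral, this
    is done for its multiple x0 by a power of t, and undone at the end. *)
Lemma separable_extension_limit (w : valuation {fraction {poly K}}) (e : nat) :
  (0 < e)%N -> (forall c, w (constF K c) = v c) ->
  (forall x, w x = +oo%E \/ exists m : int, w x = (m%:~R / e%:R)%:E) ->
  (exists pi, w pi = (e%:R^-1)%:E) ->
  (forall z, (0 <= w z)%E -> exists P : {poly K},
     [/\ P \is monic, P \is a polyOver (intring (sval_of v)),
      (0 < w (map_poly (constF K) P).[z])%E & w (map_poly (constF K) P^`()).[z] = 0%E]) ->
  exists a : KK, bounded_ram_limit j k vhat vbar vKK a /\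
    forall P : {poly K}, vKK (map_poly iota P).[a] = w (tofrac P).
Proof.
move=> e0 hw hval [pi0 hpi0] hsep.
have [hL halg] := hKbar; have [hvd _] := hV.
have [t t0 ht] := discrete_uniformizer hV.
pose F := {fraction {poly K}}; pose f := constF K.
pose A := cauchy_seq w; pose B := (A * Kbar)%type.
pose nu1 : semival B := sv_fst Kbar (cs_semival w).
pose nu2 : semival B := sv_snd A (sval_of vbar).
pose fA : {rmorphism K -> A} := @cs_cst F w \o f.
pose fB : {rmorphism K -> B} := pair_morph fA g.
have hf1 c : nu1 (fB c) = v c by rewrite /= limval_cst hw.
have hf2 c : nu2 (fB c) = v c by rewrite /= vg.
have fA_horner (P : {poly K}) (z : F) :
    (map_poly fA P).[@cs_cst F w z] = @cs_cst F w (map_poly f P).[z].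
  by rewrite map_poly_comp horner_map.
have hsepB z : (0 <= nu1 z)%E -> exists P : {poly K},
    [/\ P \is monic, P \is a polyOver (intring (sval_of v)),
      (0 < nu1 (map_poly fB P).[z])%E & nu1 (map_poly fB P^`()).[z] = 0%E].
  move=> /= hz; have [c hc] := cs_dense z.1 1.
  have hc0 : (0 < limval (z.1 - @cs_cst F w c)%R)%E by apply: lt_le_trans hc; rewrite lte_fin.
  have wc : (0 <= w c)%E.
    rewrite -(limval_cst w) -[X in limval X](subKr z.1).
    by apply: (@sv_geB _ (cs_semival w)) => //; apply: ltW.
  have [P [mP hP P1 P2]] := hsep c wc; exists P.
  have intA (Q : {poly K}) : Q \is a polyOver (intring (sval_of v)) ->
      map_poly fA Q \is a polyOver (intring (cs_semival w)).
    by apply: intpoly_map => x /=; rewrite limval_cst hw.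
  have close (Q : {poly K}) : Q \is a polyOver (intring (sval_of v)) ->
      (0 < limval ((map_poly fA Q).[z.1] - @cs_cst F w (map_poly f Q).[c])%R)%E.
    move=> hQ; rewrite -fA_horner.
    apply: (@sv_gt_horner_diff _ (cs_semival w)) => //; first exact: intA.
    by rewrite /= limval_cst.
  split=> //; rewrite horner_pair_fst.
    rewrite -(subrK (@cs_cst F w (map_poly f P).[c]) (map_poly fA P).[z.1]).
    by apply: (@sv_gtD _ (cs_semival w)); rewrite /= ?limval_cst // close.
  rewrite -P2 -(limval_cst w); apply: (@sv_ltB _ (cs_semival w)).
  by rewrite /= limval_cst P2; apply: close; apply: polyOver_deriv.
have [D [gD Dres]] := coef_ring_exists hf1 hf2 hvd hsepB
  (fun p z mp hp1 _ => @product_hensel F Kbar w vbar hL p z mp hp1).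
(* The second component 1 makes pi invertible. *)
pose pi : B := (@cs_cst F w pi0, 1); pose pi' : B := (@cs_cst F w pi0^-1, 1).
have pi00 : pi0 != 0 by rewrite -(val_eqy w) hpi0.
have piK : pi * pi' = 1.
  by congr pair; [rewrite /= -rmorphM mulfV // rmorph1|rewrite /= mulr1].
have hpi : nu1 pi = (e%:R^-1)%:E by rewrite /= limval_cst.
have hvalB z : nu1 z = +oo%E \/ exists m : int, nu1 z = (m%:~R / e%:R)%:E.
  have [[q hq]|h] := cauchy_cases (csP z.1); last by left; apply: evge_limvaly.
  right; have [N /(_ N (leqnn _)) hN] := hq.
  have [E|[m E]] := hval (z.1 N); first by rewrite hN in E.
  by exists m; rewrite /= (eveq_limval hq) -hN.
pose X : F := tofrac 'X.
have [N hN] : exists N, (0 <= w (f (t ^+ N) * X)%R)%E.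
  have [b hb] := sv_lower (sval_of w) X; have [N hN] := archi_nat (- b).
  exists N; rewrite Defs.valM hw (val_exprn _ ht) mul1r.
  apply: le_trans (leeD2l _ hb); rewrite -EFinD lee_fin.
  by have := hN N (leqnn _); lra.
set x0 := f (t ^+ N) * X in hN.
pose x : B := (@cs_cst F w x0, 0).
have hx : (0 <= nu1 x)%E by rewrite /= limval_cst.
have [s [s_step s_val s_eq]] := uniformizer_approx hf1 ht gD Dres e0 hvalB hpi piK
  (@product_nearest_root F Kbar w vbar hL) hx.
have s_step2 m : ((m%:R / e%:R)%:E <= vKK (k (s m.+1).2 - k (s m).2)%R)%E.
  by rewrite -rmorphB vk; apply: s_step.
have [_ compl _] := hKK.
have [a ha] := compl _ (steps_cauchy e0 s_step2).
have tN0 : t ^+ N != 0 by rewrite expf_neq0.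
pose sc := (t ^- N)%:P * 'X : {poly K}.
have sc_eval (R : comNzRingType) (h : {rmorphism K -> R}) (P : {poly K}) y :
    (map_poly h (P \Po sc)).[y] = (map_poly h P).[h (t ^- N) * y].
  by rewrite map_comp_poly horner_comp rmorphM /= map_polyC map_polyX hornerCM hornerX.
have key (P : {poly K}) : vKK (map_poly iota P).[a] = w (map_poly f P).[x0].
  have [N' hN'] := poly_clear_denominators P ht.
  pose c := t ^+ N'; have c0 : c != 0 by rewrite expf_neq0.
  have [y Ey] := val_fin v c0.
  have scale_eq : vKK (map_poly iota (c *: P)).[a] = w (map_poly f (c *: P)).[x0].
    have [P0|P0] := eqVneq (c *: P) 0.
      by rewrite P0 !rmorph0 !horner0 !Defs.val0.
    have nz : (map_poly f (c *: P)).[x0] != 0.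
      have -> : x0 = f (t ^+ N) * X by [].
      rewrite (_ : (map_poly f (c *: P)).[f (t ^+ N) * X] =
          tofrac ((c *: P) \Po ((t ^+ N)%:P * 'X))).
        rewrite tofrac_eq0 comp_poly_eq0 // size_Cmul ?size_polyX //.
      rewrite -constF_horner map_comp_poly horner_comp rmorphM /= map_polyC map_polyX.
      by rewrite hornerCM hornerX.
    have [q hq] := val_fin w nz; rewrite hq.
    apply: (converges_val_lim ha).
    have [M hM] := archi_nat (q + 1); exists M => m /hM hm.
    rewrite iota_horner vk -(horner_pair_snd fA g).
    apply: (s_eq _ q m hN'); last by lra.
    by rewrite /= horner_pair_fst fA_horner limval_cst.
  move: scale_eq; rewrite !map_polyZ /= !hornerZ !Defs.valM.
  have -> : vKK (k (j (i c))) = y%:E by rewrite vk hvbar vi.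
  have -> : w (f c) = y%:E by rewrite hw.
  case: (vKK _) (w _) => [r1||] [r2||] //=.
  by rewrite -!EFinD => -[] /addrI ->.
exists (iota (t ^- N) * a); split; last first.
  move=> P; rewrite -sc_eval key sc_eval /x0 mulrA -rmorphM mulVf // rmorph1 mul1r.
  by rewrite constF_horner.
exists (fun m => g (t ^- N) * (s m).2); split.
  move=> c; have [M hM] := ha (c + N%:R); exists M => n /hM h.
  rewrite rmorphM -mulrBr Defs.valM vk vg.
  rewrite (val_inv (val_exprn _ ht)) mul1r -[c](addrK N%:R) addrC EFinD.
  by rewrite leeD.
exists e => m; apply: ram_index_le => // P; rewrite -sc_eval -(horner_pair_snd fA g).
exact: s_val.
Qed.

(** If the powers of an element of value r are linearly dependent over Khat,
    two terms of the relation have the same value, so that a bounded multiple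
    of r is an integer. This makes the number of cosets finite, and then
    group_index_int bounds the denominators in terms of B. *)
Lemma algebraic_value_int (s : Kbar) B q : (ram_index j vhat vbar s <= B)%N ->
  value_group vbar (adjoin j s) q -> q * (B`!)%:R \is a Num.int.
Proof.
move=> hB; have [_ halg] := hKbar.
have [n hn] := adjoin_dependent (halg s).
have powers (r : rat) : value_group vbar (adjoin j s) r ->
    forall m, value_group vbar (adjoin j s) (r *+ m).
  move=> [y [hy y0 hr]] m; exists (y ^+ m); split; rewrite ?expf_neq0 //.
    exact: adjoinX.
  by rewrite (val_exprn _ hr) mulr_natr.
move=> Gq; apply: (group_index_int completion_value_group (N := n`!) _ _ (powers q Gq) hB).
  exact: fact_gt0.
move=> {Gq}r [y [hy y0 hr]].
have [c [m0 cm0] E] := hn (fun m => y ^+ m) (fun m => adjoinX m hy).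
pose x m := if insub m is Some l then j (c l) * y ^+ m else 0.
have xE (m : 'I_n.+1) : x m = j (c m) * y ^+ m by rewrite /x valK.
have sum_x : \sum_(m < n.+1) x m = 0 by rewrite -[RHS]E; apply: eq_bigr => m _; rewrite xE.
have xval (m : 'I_n.+1) : c m != 0 -> exists z : int, vbar (x m) = (z%:~R + r * m%:R)%:E.
  move=> cm; have [z hz] := completion_val_int cm; exists z.
  by rewrite xE Defs.valM hvbar hz (val_exprn _ hr).
have [/(sv_sum_dominant (v := sval_of vbar))/(_ isT)|] :=
  pselect (forall a b, (a < b < n.+1)%N -> vbar (x a) = vbar (x b) -> vbar (x a) = +oo%E).
  move=> [m mn]; rewrite sum_x sv0 => -[Em /(_ m0 (ltn_ord m0))].
  rewrite -Em leye_eq; have [z /= ->] := xval m0 cm0.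
  by [].
move=> /existsNP[a /existsNP[b /not_implyP[/andP[ab bn] /not_implyP[Eab xa]]]].
have an : (a < n.+1)%N by apply: ltn_trans ab bn.
have c_neq0 (m : 'I_n.+1) : vbar (x m) <> +oo%E -> c m != 0.
  by move=> h; apply/eqP => c0; apply: h; rewrite xE c0 rmorph0 mul0r Defs.val0.
have [za ha] := xval (Ordinal an) (c_neq0 (Ordinal an) xa).
have [zb hb] := xval (Ordinal bn) (c_neq0 (Ordinal bn) (fun e => xa (etrans Eab e))).
have : r * (b - a)%:R = (za - zb)%:~R.
  move: Eab; rewrite [vbar (x a)]ha [vbar (x b)]hb => -[].
  by rewrite natrB ?intrD ?rmorphN /=; [lra|exact: ltnW].
have /dvdnP[d ->] : (b - a %| n`!)%N by apply: dvdn_fact; lia.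
by rewrite mulnC natrM mulrA => ->; rewrite rpredM ?intr_int ?natr_int.
Qed.

Let viota c : vKK (iota c) = v c.
Proof. by rewrite -[LHS]/(vKK (k (j (i c)))) vk hvbar vi. Qed.

Section BoundedLimit.
Variable a : KK.
Hypothesis tr : transcendentalOver iota a.

Local Notation W := (transc_ring tr vKK).
Local Notation w := (eval_val vKK tr).
Local Notation F := {fraction {poly K}}.

Let ev_cst c : eval_morph tr (constF K c) = k (j (i c)).
Proof. by rewrite /eval_morph (ratfun_eval_cst tr). Qed.

Let ev_scale c z :
  eval_morph tr (constF K c * z) = k (j (i c)) * eval_morph tr z.
Proof. by rewrite [LHS]rmorphM; congr (_ * _); apply: ev_cst. Qed.

Let w_cst c : w (constF K c) = v c.
Proof.
by rewrite /= /eval_morph (ratfun_eval_cst tr) viota.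
Qed.

Let hVv : V =i valuation_ring_of v. Proof. by case: hV. Qed.
Let hWw : W =i valuation_ring_of w. Proof. by []. Qed.

Lemma transc_extends : extends_ring (constF K) V W.
Proof. by move=> c; rewrite (vringE hWw) (vringE hVv) w_cst. Qed.
Let hext := transc_extends.

Let scaleW c z : c \in V -> z \in W -> constF K c * z \in W.
Proof. by move=> Vc Wz; have Wc : constF K c \in W; rewrite ?hext // rpredM. Qed.

(** A polynomial has the same value at a and at s n for large n, and there
    the denominators are bounded by the ramification indices. *)
Lemma transc_value_int : bounded_ram_limit j k vhat vbar vKK a ->
  exists2 N, (0 < N)%N & forall x, x != 0 -> exists m : int, w x = (m%:~R / N%:R)%:E.
Proof.
move=> [s [hs [B hB]]]; exists B`!; first exact: fact_gt0.
have NR : (B`!)%:R != 0 :> rat by rewrite pnatr_eq0 -lt0n fact_gt0.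
have H (P : {poly K}) : P != 0 -> exists m : int, w (tofrac P) = (m%:~R / (B`!)%:R)%:E.
  move=> P0; have wP : w (tofrac P) = vKK (map_poly iota P).[a].
    by rewrite /= /eval_morph (ratfun_eval_poly tr).
  have [q hq] : exists q : rat, w (tofrac P) = q%:E by apply: val_fin; rewrite tofrac_eq0.
  have [n] := converges_val hs (etrans (esym wP) hq).
  move=> /(_ n (leqnn _)); rewrite iota_horner vk => hn.
  have Gq : value_group vbar (adjoin j (s n)) q.
    exists (map_poly g P).[s n]; split=> //.
      have -> : map_poly g P = map_poly j (map_poly i P) by rewrite -map_poly_comp.
      exact: adjoin_horner.
    by rewrite -(val_eqy vbar) hn.
  have /intrP[m Em] := algebraic_value_int (hB n) Gq.
  by exists m; rewrite hq -Em mulfK.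
move=> x x0; have [p [q [q0 Ex]]] := ratfunP x.
have p0 : p != 0 by apply: contraNneq x0 => p0; rewrite Ex p0 tofrac0 mul0r.
have [m hm] := H p p0; have [n hn] := H q q0.
exists (m - n); rewrite Ex Defs.valM hm (val_inv hn) -EFinD intrD rmorphN /=.
by rewrite mulrDl mulNr.
Qed.

Lemma transc_dvr : bounded_ram_limit j k vhat vbar vKK a -> is_dvr W.
Proof.
move=> /transc_value_int[N N0 hN].
have [t t0 ht] := discrete_uniformizer hV.
have [|c [c0 hd]] := discrete_scaling N0 hN.
  by exists (constF K t); rewrite w_cst.
exists (scale_val w c0); split=> // x.
by rewrite (vringE hWw) -(scale_val_ge0 _ c0).
Qed.

(** An integral element y of KK is congruent to an integral element b of Kbar,
    algebraic over Khat. Normalizing its equation so that the coefficients are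
    integral with one of them a unit, and approximating these by elements of K,
    gives a polynomial over V whose value at y is not a unit. *)
Lemma transc_residually_algebraic : residually_algebraic (constF K) V W.
Proof.
move=> u; pose phi := residue_lift u.
have Wphi : phi \in W by exact: residue_lift_in.
pose y := eval_morph tr phi.
have y0 : (0 <= vKK y)%E by rewrite (vringE hWw) in Wphi.
have [_ _ dense] := hKK; have [b hb] := dense y 1.
have b0 : (0 <= vbar b)%E.
  rewrite -vk -(subKr y (k b)); apply: (@sv_geB _ (sval_of vKK)) => //.
  by apply: le_trans hb; rewrite lee_fin.
have [_ halg] := hKbar; have [P P0 Pb] := halg b.
have [d [dint [n0 hn0]]] : exists d, (forall n : 'I_(size P), 0 <= vhat (d * P`_n)%R)%E /\
    exists n : 'I_(size P), vhat (d * P`_n) = 0%E.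
  apply: normalize_family; have sP : ((size P).-1 < size P)%N.
    by rewrite prednK // size_poly_gt0.
  by exists (Ordinal sP); rewrite -lead_coefE lead_coef_eq0.
have [_ _ denseK] := hKhat.
have /choice[c hc] : forall n, exists c, (1 <= vhat (d * P`_n - i c)%R)%E.
  by move=> n; apply: denseK.
pose Q := \poly_(n < size P) c n.
have cQ n : (1 <= vhat ((d *: P)`_n - i Q`_n)%R)%E.
  rewrite coefZ coef_poly; case: ltnP => h; first exact: hc.
  by rewrite nth_default // mulr0 rmorph0 subrr Defs.val0 leey.
have dPint n : (0 <= vhat (d *: P)`_n)%E.
  rewrite coefZ; have [h|h] := ltnP n (size P); first exact: (dint (Ordinal h)).
  by rewrite nth_default // mulr0 Defs.val0 leey.
have Qint : Q \is a polyOver V.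
  apply/polyOverP => n; rewrite (vringE hVv) -vi -(subKr (d *: P)`_n (i Q`_n)).
  apply: (@sv_geB _ (sval_of vhat)) => //=; apply: le_trans (cQ n).
  by rewrite lee_fin.
have Qn0 : v Q`_n0 = 0%E.
  rewrite -vi -hn0 -coefZ; apply: (@sv_ltB _ (sval_of vhat)); rewrite /= coefZ hn0.
  have -> : vhat (i Q`_n0 - d * P`_n0) = vhat (d * P`_n0 - i Q`_n0).
    exact: (svBC (sval_of vhat)).
  by rewrite -coefZ; apply: lt_le_trans (cQ n0); rewrite lte_fin.
have Qb : (0 < vbar (map_poly g Q).[b])%E.
  have -> : (map_poly g Q).[b] = - (map_poly j (d *: P - map_poly i Q)).[b].
    rewrite rmorphB /= map_polyZ hornerD hornerN hornerZ (rootP Pb) mulr0 sub0r opprK.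
    by rewrite -map_poly_comp.
  have -> : vbar (- (map_poly j (d *: P - map_poly i Q)).[b]) =
     vbar (map_poly j (d *: P - map_poly i Q)).[b] by exact: (svN (sval_of vbar)).
  apply: (@lt_le_trans _ _ 1%E); first by rewrite lte_fin.
  apply: (@sv_ge_horner _ (sval_of vbar)) => // n.
  by rewrite coef_map /= hvbar coefB coef_map; apply: cQ.
have Qy : (0 < vKK (map_poly iota Q).[y])%E.
  rewrite -(subrK (map_poly iota Q).[k b] (map_poly iota Q).[y]).
  apply: (@sv_gtD _ (sval_of vKK)); last by rewrite /= iota_horner vk.
  apply: (@sv_gt_horner_diff _ (sval_of vKK)) => //=.
  - apply/polyOverP => n; rewrite coef_map intringE /= viota.
    by rewrite -(vringE hVv); have /polyOverP := Qint; apply.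
  - by rewrite vk.
  - by apply: lt_le_trans hb; rewrite lte_fin.
exists (map_poly (residue V) Q).
  apply/eqP => /polyP/(_ n0); rewrite coef0 coef_map_id0 ?(residue0 hVv) //.
  move/eqP; rewrite (residue_eq0_val hVv) ?Qn0 ?ltxx //.
  by have /polyOverP := Qint; apply.
have E := residue_horner hVv hWw hext Qint Wphi.
rewrite residue_liftK in E; apply/rootP; rewrite -[LHS]E.
apply/eqP; rewrite (residue_eq0_val hWw).
  by rewrite /= eval_morph_horner.
rewrite rpred_horner //; apply/polyOverP => n.
by rewrite coef_map /= hext; have /polyOverP := Qint; apply.
Qed.

(** A linear relation over Khat between values of rational functions at s,
    with coefficients normalized to be integral and one of them a unit,
    reduces to a nontrivial relation between residue classes. *)
Lemma algebraic_residually_finite : (exists s, k s = a) ->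
  residually_finite (constF K) V W.
Proof.
move=> [s Es]; have [_ halg] := hKbar.
have [n hn] := adjoin_dependent (halg s).
apply: (@dependent_span _ _ (residue_morph hVv hWw hext) n) => u.
pose phi m := residue_lift (u m).
have Wphi m : phi m \in W by exact: residue_lift_in.
have /choice[y hy] : forall m, exists y, adjoin j s y /\ k y = eval_morph tr (phi m).
  move=> m; have [p [q [q0 ->]]] := ratfunP (phi m).
  exists ((map_poly g p).[s] / (map_poly g q).[s]); split.
    exists (map_poly i p), (map_poly i q); rewrite -!map_poly_comp; split=> //.
    by rewrite -(fmorph_eq0 k) -iota_horner Es; apply: horner_transc_neq0.
  by rewrite fmorph_div -!iota_horner Es /eval_morph ratfun_evalE.
have [c0 [m1 hm1] E0] := hn y (fun m => (hy m).1).
have [d [dint [m0 hm0]]] := normalize_family vhat (ex_intro _ m1 hm1).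
pose c m := d * c0 m.
have cE : \sum_m j (c m) * y m = 0.
  have -> : \sum_m j (c m) * y m = j d * \sum_m j (c0 m) * y m.
    by rewrite mulr_sumr; apply: eq_bigr => m _; rewrite rmorphM mulrA.
  by rewrite E0 mulr0.
have [_ _ denseK] := hKhat.
have /choice[x hx] : forall m, exists x, (1 <= vhat (c m - i x)%R)%E.
  by move=> m; apply: denseK.
have Vx m : x m \in V.
  rewrite (vringE hVv) -vi -(subKr (c m) (i (x m))).
  apply: (@sv_geB _ (sval_of vhat)); first exact: dint.
  by apply: le_trans (hx m); rewrite lee_fin.
exists (fun m => residue V (x m)).
  exists m0; rewrite (residue_eq0_val hVv) // -vi.
  have -> : vhat (i (x m0)) = vhat (c m0).
    apply: (@sv_ltB _ (sval_of vhat)); rewrite /= hm0.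
    have -> : vhat (i (x m0) - c m0) = vhat (c m0 - i (x m0)) by exact: (svBC (sval_of vhat)).
    by apply: lt_le_trans (hx m0); rewrite lte_fin.
  by rewrite hm0 ltxx.
have termW m : constF K (x m) * phi m \in W by exact: scaleW.
have -> : \sum_m residue_morph hVv hWw hext (residue V (x m)) * u m =
    residue W (\sum_m constF K (x m) * phi m).
  rewrite (residue_sum hWw) //; apply: eq_bigr => m _.
  by rewrite residueM ?hext // residue_morphE // residue_liftK.
apply/eqP; rewrite (residue_eq0_val hWw); last first.
  by apply: (rpred_sum (S := vring_pred W)) => m _; apply: termW.
rewrite /=.
have -> : eval_morph tr (\sum_m constF K (x m) * phi m) =
    - \sum_m k (j (c m - i (x m))) * k (y m).
  rewrite rmorph_sum -sumrN; have /eqP := congr1 k cE.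
  rewrite rmorph0 rmorph_sum => /eqP kE.
  transitivity (\sum_m eval_morph tr (constF K (x m) * phi m) -
      \sum_m k (j (c m) * y m)); first by rewrite kE subr0.
  rewrite -sumrB; apply: eq_bigr => m _.
  rewrite ev_scale [k (_ * y m)]rmorphM.
  by rewrite !rmorphB mulrBl opprB (hy m).2.
have -> : vKK (- \sum_m k (j (c m - i (x m))) * k (y m)) =
    vKK (\sum_m k (j (c m - i (x m))) * k (y m)) by exact: (svN (sval_of vKK)).
apply: (@sv_gt_sum _ (sval_of vKK)) => m _; apply: (@sv_Mgt0 _ (sval_of vKK)) => /=.
  by rewrite vk hvbar; apply: lt_le_trans (hx m); rewrite lte_fin.
by rewrite (hy m).2; have := Wphi m; rewrite (vringE hWw).
Qed.

Section FiniteResidue.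
Hypothesis hbounded : bounded_ram_limit j k vhat vbar vKK a.
Variables (n : nat) (b : 'I_n -> residue_field W).
Hypothesis hspan : forall u : residue_field W, exists c : 'I_n -> residue_field V,
  u = \sum_l residue_map (constF K) W (c l) * b l.

Let B l : F := residue_lift (b l).
Let WB l : B l \in W. Proof. exact: residue_lift_in. Qed.

(** The lifts of a family spanning the residue field times the powers of exponent less than e of a
    uniformizer of W, where t has value e in W. *)
Let finite_generation t : v t = 1%E -> exists (T : finType) (E : T -> F),
  forall z, z \in W -> exists (c : T -> K) z', [/\ forall x, c x \in V, z' \in W &
    z = \sum_x constF K (c x) * E x + constF K t * z'].
Proof.
move=> ht; have [e [w' [e0 hw' hW' hval [pi hpi]]]] :=
  normalize_dvr hV hext (transc_dvr hbounded).
have pi0 : pi != 0 by rewrite -(val_eqy w') hpi.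
have eR : e%:R != 0 :> rat by rewrite pnatr_eq0 -lt0n.
have W_pi z : z \in W -> (0 < w' z)%E -> z / pi \in W.
  move=> Wz; rewrite (vringE hW') Defs.valM (val_inv hpi).
  have [->|[m ->]] := hval z; first by rewrite leey.
  rewrite lte_fin -EFinD lee_fin pmulr_lgt0 ?invr_gt0 ?ltr0n // ltr0z => m0.
  rewrite subr_ge0 ler_peMl ?invr_ge0 // ler1z; lia.
have Wpi : pi \in W by rewrite (vringE hW') hpi lee_fin invr_ge0.
have step z : z \in W -> exists (c : 'I_n -> K) z', [/\ forall l, c l \in V, z' \in W &
    z = \sum_l constF K (c l) * B l + pi * z'].
  move=> Wz; have [c hc] := hspan (residue W z).
  pose S := \sum_l constF K (residue_lift (c l)) * B l.
  have WS : S \in W.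
    by apply: (rpred_sum (S := vring_pred W)) => l _; rewrite scaleW ?residue_lift_in.
  exists (fun l => residue_lift (c l)), ((z - S) / pi); split.
  - by move=> l; exact: residue_lift_in.
  - apply: W_pi; first by rewrite rpredB.
    rewrite -(residue_eq0_val hW') ?rpredB // (residueB hWw) // subr_eq0 hc.
    apply/eqP; rewrite (residue_sum hWw) => [|l]; last by rewrite scaleW ?residue_lift_in.
    apply: eq_bigr => l _; rewrite residueM ?hext ?residue_lift_in //.
    by rewrite residue_liftK.
  - by rewrite mulrC divfK // /S addrC subrK.
have steps m z : z \in W -> exists (c : nat -> 'I_n -> K) z',
    [/\ forall r l, c r l \in V, z' \in W &
    z = \sum_(r < m) \sum_l constF K (c r l) * (B l * pi ^+ r) + pi ^+ m * z'].
  move=> Wz; elim: m => [|m [c [z' [hc Wz' Ez]]]].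
    exists (fun _ _ => 0), z; split=> //; first by move=> *; rewrite rpred0.
    by rewrite big_ord0 add0r expr0 mul1r.
  have [c' [z'' [hc' Wz'' Ez']]] := step z' Wz'.
  exists (fun r => if r == m then c' else c r), z''; split=> //.
    by move=> r l; case: ifP.
  rewrite big_ord_recr /= eqxx Ez Ez'.
  have -> : \sum_(r < m) \sum_l
      constF K ((if r == m :> nat then c' else c r) l) * (B l * pi ^+ r) =
      \sum_(r < m) \sum_l constF K (c r l) * (B l * pi ^+ r).
    by apply: eq_bigr => r _; rewrite ltn_eqF.
  rewrite -addrA; congr (_ + _); rewrite mulrDr exprSr mulrA; congr (_ + _).
  by rewrite mulr_sumr; apply: eq_bigr => l _; ring.
exists ('I_e * 'I_n)%type, (fun x : 'I_e * 'I_n => B x.2 * pi ^+ x.1) => z Wz.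
have [c [z' [hc Wz' Ez]]] := steps e z Wz.
exists (fun x : 'I_e * 'I_n => c x.1 x.2), (z' * (pi ^+ e / constF K t)); split.
- by move=> x; apply: hc.
- apply: rpredM => //; have wt : w' (constF K t) = 1%E by rewrite hw'.
  by rewrite (vringE hW') Defs.valM (val_exprn _ hpi) (val_inv wt) mulVf.
- have ft0 : constF K t != 0 by rewrite fmorph_eq0 -(val_eqy v) ht.
  rewrite {1}Ez pair_bigA /=; congr (_ + _).
  by rewrite [RHS]mulrCA [X in _ = _ * X]mulrCA mulfV // mulr1 mulrC.
Qed.

(** Iterating finite_generation expresses z by series whose coefficients
    converge in the complete field Khat, while the remainder is divisible by
    arbitrary powers of t. *)
Let finite_dimension : exists (T : finType) (E : T -> KK), forall z : F,
  exists c : T -> Khat, eval_morph tr z = \sum_x k (j (c x)) * E x.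
Proof.
have [t t0 ht] := discrete_uniformizer hV.
have [T [E hE]] := finite_generation ht; exists T, (fun x => eval_morph tr (E x)).
suff int_case z : z \in W -> exists c : T -> Khat,
    eval_morph tr z = \sum_x k (j (c x)) * eval_morph tr (E x).
  move=> z; have [q hq] := sv_lower (sval_of w) z.
  have [N hN] := archi_nat (- q).
  have [|c hc] := int_case (constF K (t ^+ N) * z).
    rewrite (vringE hWw) Defs.valM w_cst (val_exprn _ ht) mul1r.
    apply: le_trans (leeD2l _ hq); rewrite -EFinD lee_fin.
    by have := hN N (leqnn _); lra.
  exists (fun x => (i (t ^+ N))^-1 * c x).
  have tN0 : k (j (i (t ^+ N))) != 0 by rewrite !fmorph_eq0 expf_neq0.
  apply: (mulfI tN0); rewrite -ev_scale hc mulr_sumr; apply: eq_bigr => x _.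
  rewrite !rmorphM !fmorphV !mulrA mulfV ?mul1r //.
move=> Wz.
have /choice[cn hcn] : forall z, exists cz : (T -> K) * F, z \in W ->
    [/\ forall x, cz.1 x \in V, cz.2 \in W &
      z = \sum_x constF K (cz.1 x) * E x + constF K t * cz.2].
  move=> y; have [Wy|nWy] := boolP (y \in W); last by exists (fun _ => 0, 0).
  by have [c [y' hy]] := hE y Wy; exists (c, y').
pose zs m := iter m (fun y => (cn y).2) z.
have Wzs m : zs m \in W by elim: m => [//|m IH]; have [] := hcn _ IH.
pose S m x := \sum_(r < m) t ^+ r * (cn (zs r)).1 x.
have expand m : z = \sum_x constF K (S m x) * E x + constF K (t ^+ m) * zs m.
  elim: m => [|m IH].
    rewrite expr0 rmorph1 mul1r big1 ?add0r // => x _.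
    by rewrite /S big_ord0 rmorph0 mul0r.
  have [_ _ Ezs] := hcn _ (Wzs m).
  rewrite {1}IH Ezs mulrDr addrA; congr (_ + _); last first.
    by rewrite mulrA -rmorphM exprSr.
  rewrite mulr_sumr -big_split; apply: eq_bigr => x _.
  have -> : S m.+1 x = S m x + t ^+ m * (cn (zs m)).1 x by rewrite /S big_ord_recr.
  by rewrite [constF K (_ + _)]rmorphD [constF K (_ * _)]rmorphM mulrDl mulrA.
have Sstep m x : (m%:R%:E <= vhat (i (S m.+1 x) - i (S m x))%R)%E.
  rewrite -rmorphB /S big_ord_recr /= addrAC subrr add0r vi Defs.valM.
  rewrite (val_exprn _ ht) mul1r leeDl //.
  by have [h _ _] := hcn _ (Wzs m); rewrite -(vringE hVv).
have [_ compl _] := hKhat.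
have /choice[c hc] : forall x, exists l, val_converges vhat (fun m => i (S m x)) l.
  move=> x; apply: compl; apply: (@steps_cauchy _ _ _ 1) => // m.
  by rewrite divr1.
exists c; apply/eqP; rewrite -subr_eq0 -(val_eqy vKK) -leye_eq; apply: ereal_lefP => q _.
have [bd hbd] : exists bd : rat, forall x, (bd%:E <= vKK (eval_morph tr (E x)))%E.
  have [y hy] : exists y : T -> rat, forall x, ((y x)%:E <= vKK (eval_morph tr (E x)))%E.
    have /choice[y hy] : forall x, exists y : rat, (y%:E <= vKK (eval_morph tr (E x)))%E.
      by move=> x; apply: (sv_lower (sval_of vKK)).
    by exists y.
  exists (\big[Num.min/0]_x y x) => x; apply: le_trans (hy x).
  by rewrite lee_fin (bigD1 x) //= ge_min lexx.
have [M hM] : evtl (fun m => forall x, ((q - bd)%:E <= vhat (c x - i (S m x))%R)%E).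
  pose P (r m : nat) := if insub r is Some l then
     let x := enum_val (l : 'I_#|T|) in
     ((q - bd)%:E <= vhat (c x - i (S m x))%R)%E else true.
  have HP r : evtl (fun m => P r m).
    rewrite /P; case: insubP => [l _ _|_]; last by exists 0%N.
    by have [M hM] := hc (enum_val l) (q - bd); exists M.
  apply: evtl_imp (evtl_all #|T| HP) => m h x.
  have := h (enum_rank x) (ltn_ord _).
  by rewrite /P valK enum_rankK.
have [M' hM'] := archi_nat q.
pose m := maxn M M'.
have -> : eval_morph tr z - \sum_x k (j (c x)) * eval_morph tr (E x) =
    k (j (i (t ^+ m))) * eval_morph tr (zs m) -
    \sum_x k (j (c x - i (S m x))) * eval_morph tr (E x).
  have -> : eval_morph tr z = \sum_x k (j (i (S m x))) * eval_morph tr (E x) +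
      k (j (i (t ^+ m))) * eval_morph tr (zs m).
    rewrite {1}(expand m) [LHS]rmorphD; congr (_ + _); last exact: ev_scale.
    by rewrite rmorph_sum; apply: eq_bigr => x _; apply: ev_scale.
  rewrite addrAC addrC; congr (_ + _).
  rewrite -sumrB -sumrN; apply: eq_bigr => x _.
  by rewrite !rmorphB mulrBl opprB.
apply: (@sv_geB _ (sval_of vKK)) => /=.
  rewrite Defs.valM vk hvbar vi (val_exprn _ ht) mul1r.
  apply: (@le_trans _ _ m%:R%:E); first by rewrite lee_fin hM' // leq_maxr.
  by rewrite leeDl //; have := Wzs m; rewrite (vringE hWw).
apply: (@sv_ge_sum _ (sval_of vKK)) => x _ /=; rewrite Defs.valM vk hvbar.
by rewrite -[q](subrK bd) EFinD leeD ?hbd ?hM ?leq_maxl.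
Qed.

(** By finite_dimension the powers of a are linearly dependent over Khat, and
    all roots of the resulting polynomial lie in Kbar. *)
Lemma finite_residue_algebraic : exists s, k s = a.
Proof.
have [T [E hE]] := finite_dimension.
have /choice[d hd] : forall l : 'I_#|T|.+1, exists d : T -> Khat,
    a ^+ l = \sum_x k (j (d x)) * E x.
  move=> l; have [d hd] := hE (tofrac 'X^l); exists d; rewrite -hd.
  by rewrite /eval_morph (ratfun_eval_poly tr) map_polyXn hornerXn.
have [c [l0 cl0] hc] := kernel_family d.
pose Q := \poly_(l < #|T|.+1) (if insub l is Some l' then c l' else 0).
have Qc (l : 'I_#|T|.+1) : Q`_l = c l by rewrite coef_poly ltn_ord valK.
have Q0 : Q != 0.
  by apply: contraNneq cl0 => Q0; rewrite -Qc Q0 coef0.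
have Qa : (map_poly k (map_poly j Q)).[a] = 0.
  rewrite (@horner_coef_wide _ #|T|.+1); last first.
    by rewrite !size_map_poly size_poly.
  have -> : \sum_(l < #|T|.+1) (map_poly k (map_poly j Q))`_l * a ^+ l =
      \sum_x \sum_(l < #|T|.+1) k (j (c l * d l x)) * E x.
    rewrite exchange_big; apply: eq_bigr => l _.
    rewrite !coef_map Qc hd mulr_sumr; apply: eq_bigr => x _.
    by rewrite !rmorphM mulrA.
  rewrite big1 // => x _; rewrite -mulr_suml -!rmorph_sum hc !rmorph0 mul0r //.
have [hL _] := hKbar.
pose P := map_poly j Q; have P0 : lead_coef P != 0.
  by rewrite lead_coef_eq0 map_poly_eq0.
have mP : (lead_coef P)^-1 *: P \is monic by rewrite monicE lead_coefZ mulVf.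
have [rs _ Ers] := monic_split hL mP.
have : (map_poly k (\prod_(r <- rs) ('X - r%:P))).[a] = 0.
  by rewrite -Ers map_polyZ hornerZ Qa mulr0.
rewrite rmorph_prod horner_prod => /eqP; rewrite prodf_seq_eq0 => /hasP[r _ /=].
rewrite rmorphB /= map_polyX map_polyC hornerXsubC subr_eq0 => /eqP ->.
by exists r.
Qed.

End FiniteResidue.

End BoundedLimit.

End Tower.

(** Residue fields of valuation rings with the same elements are different
    types unless the rings are equal as records. *)
Lemma valuation_ring_eq (F : fieldType) (W W' : valuation_ring F) : W =i W' -> W = W'.
Proof.
case: W W' => [P hP tP] [Q hQ tQ] /= E.
have PQ : P = Q by apply: funext => x; apply: E.
subst Q; congr ValuationRing; exact: Prop_irrelevance.
Qed.

Theorem corollary5p7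
  (K Khat Kbar KK : fieldType)
  (V : valuation_ring K) (v : valuation K)
  (vhat : valuation Khat) (vbar : valuation Kbar) (vKK : valuation KK)
  (i : {rmorphism K -> Khat}) (j : {rmorphism Khat -> Kbar})
  (k : {rmorphism Kbar -> KK})
  (hV : dvr_valuation V v)
  (hperf : perfect_field (residue_field V))
  (hKhat : is_completion i v vhat)
  (hKbar : algebraic_closure j)
  (hvbar : extends_val j vhat vbar)
  (hKK : is_completion k vbar vKK) :
  let iota : {rmorphism K -> KK} := k \o j \o i in
  let bounded := bounded_ram_limit j k vhat vbar vKK in
  (forall W : valuation_ring {fraction {poly K}},
     (extends_ring (constF K) V W /\ is_dvr W /\
        residually_algebraic (constF K) V W)
     <->
     (exists (a : KK) (tr : transcendentalOver iota a),
        bounded a /\ W =i transc_ring tr vKK))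
  /\
  (forall (a : KK) (tr : transcendentalOver iota a), bounded a ->
     ((exists s : Kbar, k s = a)
      <-> residually_finite (constF K) V (transc_ring tr vKK))).
Proof.
move=> iota bounded; split=> [W|a tr hb]; last first.
  split=> [|[n [b hspan]]]; first exact:
    (algebraic_residually_finite hV hKhat hKbar hvbar hKK).
  exact: (finite_residue_algebraic hV hKhat hKbar hvbar hKK hb hspan).
split=> [[hext [hdvr halg]]|[a [tr [hb hW]]]]; last first.
  rewrite (valuation_ring_eq hW); split; first exact:
    (transc_extends hV hKhat hvbar hKK).
  split; first exact: (transc_dvr hV hKhat hKbar hvbar hKK tr hb).
  exact: (transc_residually_algebraic hV hKhat hKbar hvbar hKK).
have [e [w [e0 hw hWw hval hpi]]] := normalize_dvr hV hext hdvr.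
have hsep := approx_simple_root (proj2 hV) hWw hext hperf halg.
have [a [ba ha]] :=
  separable_extension_limit hV hKhat hKbar hvbar hKK e0 hw hval hpi hsep.
have tr : transcendentalOver iota a.
  move=> [p p0 /rootP pa]; have := ha p; rewrite pa Defs.val0 => /esym/eqP.
  by rewrite val_eqy tofrac_eq0 (negPf p0).
exists a, tr; split=> // x; rewrite (vringE hWw) transc_ringE -[RHS]/(0 <= _)%E /=.
congr (_ <= _)%E; have [p [q [q0 ->]]] := ratfunP x.
rewrite /eval_morph (ratfun_evalE tr) // !Defs.valM; congr (_ + _)%E.
  exact: (esym (ha p)).
have [b hb] : exists b : rat, w (tofrac q) = b%:E by apply: val_fin; rewrite tofrac_eq0.
by rewrite (val_inv hb); apply: esym; apply: val_inv; apply: etrans (ha q) hb.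
Qed.
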